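(* Suppose $F$ is purely even and symmetric (i.e. its Nakayama automorphism is the identity). Let $n\ge1$, $d\in\mathbb{N}$, and let $\mathbf{c}^{(1)},\dots,\mathbf{c}^{(d)}\in(Z(F)^{\otimes n})^{S_n}$ be elements of degree $\delta$, where $Z(F)$ is the center of $F$. Let $\mathcal{A}_n^{\mathbf{C}}(F)$ be the quotient of $\mathcal{A}_n(F)$ by the two-sided ideal generated by $\prod_{j=1}^d(x_1-\mathbf{c}^{(j)})$. Then $\mathcal{A}_n^{\mathbf{C}}(F)$ is a symmetric algebra.
   Context: $\Bbbk$ is a commutative ring of characteristic not equal to $2$; $\mathbb{N}$ is the set of nonnegative integers. $F$ is an $\mathbb{N}$-graded associative unital $\Bbbk$-algebra (all elements of even parity), free of finite rank over $\Bbbk$. A graded $\Bbbk$-algebra $A$ (purely even) is a Frobenius algebra if it has a linear trace map $\operatorname{tr}\colon A\to\Bbbk$, homogeneous in degree, such that $f\mapsto(g\mapsto\operatorname{tr}(gf))$ is an isomorphism $A\to\operatorname{Hom}_\Bbbk(A,\Bbbk)$, and is a symmetric algebra if moreover $\operatorname{tr}(fg)=\operatorname{tr}(gf)$ for all $f,g\in A$ (that is, its Nakayama automorphism is the identity). $\delta$ is the maximum degree of elements of $F$. $B$ is a homogeneous basis of $F$ and $\{b^\vee\mid b\in B\}$ its dual basis: $\operatorname{tr}(b^\vee c)=\delta_{b,c}$. For $f\in F$, $f_i=1^{\otimes(i-1)}\otimes f\otimes1^{\otimes(n-i)}\in F^{\otimes n}$. $S_n$ acts on $F^{\otimes n}$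 by permuting factors, written ${}^\pi\mathbf{f}$; $s_i$ is the transposition of $i,i+1$. In this setting the affine wreath product algebra $\mathcal{A}_n(F)$ is the free product $\Bbbk[x_1,\dots,x_n]\star F^{\otimes n}\star\Bbbk S_n$ modulo the relations: $\mathbf{f}x_i=x_i\mathbf{f}$ ($\mathbf f\in F^{\otimes n}$); $s_ix_j=x_js_i$ ($j\ne i,i+1$); $s_ix_i=x_{i+1}s_i-t_{i,i+1}$; $\pi\mathbf{f}={}^\pi\mathbf{f}\,\pi$ ($\pi\in S_n$), where $t_{i,j}=\sum_{b\in B}b_i(b^\vee)_j$ for $i\neq j$. It is graded with $|x_i|=\delta$, $|f_i|=|f|$, $|\pi|=0$. *)

(* Defs.v *)
From HB Require Import structures.
From mathcomp Require Import all_boot all_order all_algebra all_fingroup.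
From mathcomp Require Import finmap boolp monalg generic_quotient.

Set Implicit Arguments.
Unset Strict Implicit.
Unset Printing Implicit Defensive.

Import GRing.Theory.
Local Open Scope ring_scope.

(* [algType] requires [1 != 0], but a cyclotomic quotient can be the zero      *)
(* algebra (e.g. for an empty product of factors).  The multiplication is a    *)
(* field of the mixin because Hierarchy Builder does not accept a new join of  *)
(* [PzRing] and [Lmodule].                                                     *)
HB.mixin Record isPzAlgebra (k : pzRingType) A of GRing.Lmodule k A := {
  pzone : A;
  pzmul : A -> A -> A;
  pzmulA : associative pzmul;
  pzmul1r : left_id pzone pzmul;
  pzmulr1 : right_id pzone pzmul;
  pzmulDl : left_distributive pzmul +%R;
  pzmulDr : right_distributive pzmul +%R;
  pzmulZl : forall (a : k) (x y : A), a *: pzmul x y = pzmul (a *: x) y;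
  pzmulZr : forall (a : k) (x y : A), a *: pzmul x y = pzmul x (a *: y)
}.

#[short(type="pzAlgType")]
HB.structure Definition PzAlgebra (k : pzRingType) :=
  {A of GRing.Lmodule k A & isPzAlgebra k A}.

HB.instance Definition _ (k : pzRingType) (A : pzAlgType k) :=
  GRing.Zmodule_isPzRing.Build (A : Type) (@pzmulA k A) (@pzmul1r k A)
    (@pzmulr1 k A) (@pzmulDl k A) (@pzmulDr k A).

Section PzAlgebraTheory.
Variables (k : pzRingType) (A : pzAlgType k).

Lemma pzscalerAl (a : k) (x y : A) : a *: (x * y) = (a *: x) * y.
Proof. exact: pzmulZl. Qed.

Lemma pzscalerAr (a : k) (x y : A) : a *: (x * y) = x * (a *: y).
Proof. exact: pzmulZr. Qed.

End PzAlgebraTheory.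

Inductive lspan (k : pzRingType) (V : lmodType k) (S : V -> Prop) : V -> Prop :=
| lspan0 : lspan S 0
| lspanZD a u v : S u -> lspan S v -> lspan S (a *: u + v).

Section LmodQuotient.
Variables (k : pzRingType) (V : lmodType k) (S : V -> Prop).

Lemma lspan_gen u : S u -> lspan S u.
Proof. by move=> Su; rewrite -[u]addr0 -[u]scale1r; apply/lspanZD/lspan0. Qed.

Lemma lspanD u v : lspan S u -> lspan S v -> lspan S (u + v).
Proof.
by elim=> [|a s w Ss _ IH] Sv; rewrite ?add0r // -addrA; apply/lspanZD/IH.
Qed.

Lemma lspanZ a u : lspan S u -> lspan S (a *: u).
Proof.
elim=> [|b s w Ss _ IH]; first by rewrite scaler0; apply: lspan0.
by rewrite scalerDr scalerA; apply: lspanZD.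
Qed.

Definition lspan_pred : {pred V} := fun x => `[< lspan S x >].

Fact lspan_pred_closed : zmod_closed lspan_pred.
Proof.
split=> [|x y /asboolP Sx /asboolP Sy]; apply/asboolP; first exact: lspan0.
by rewrite -scaleN1r; apply/lspanD/lspanZ.
Qed.

HB.instance Definition _ :=
  GRing.isZmodClosed.Build V lspan_pred lspan_pred_closed.

Definition lmod_quot := Quotient.quot (GRing.ZmodClosed.clone V lspan_pred _).

HB.instance Definition _ := GRing.Zmodule.on lmod_quot.

Definition lproj (x : V) : lmod_quot := \pi_lmod_quot%qT x.

Lemma lprojP x y : lproj x = lproj y <-> lspan S (x - y).
Proof.
have eqE : (lproj x == lproj y) = lspan_pred (x - y).
  by rewrite /lproj -Quotient.idealrBE.
by split=> [/eqP|Sxy]; [rewrite eqE => /asboolP | apply/eqP; rewrite eqE; apply/asboolP].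
Qed.

Lemma lreprK q : lproj (repr q) = q.
Proof. exact: reprK. Qed.

Lemma lrepr_proj x : lspan S (repr (lproj x) - x).
Proof. by apply/lprojP; rewrite lreprK. Qed.

Lemma lproj_ind (P : lmod_quot -> Prop) : (forall x, P (lproj x)) -> forall q, P q.
Proof. by move=> HP q; rewrite -[q]lreprK. Qed.

Lemma lprojD x y : lproj (x + y) = lproj x + lproj y.
Proof. exact: raddfD. Qed.

Definition lquot_scale a (q : lmod_quot) := lproj (a *: repr q).

Lemma lquot_scaleE a x : lquot_scale a (lproj x) = lproj (a *: x).
Proof. by apply/lprojP; rewrite -scalerBr; apply/lspanZ/lrepr_proj. Qed.

Fact lquot_scaleA a b v : lquot_scale a (lquot_scale b v) = lquot_scale (a * b) v.
Proof. by elim/lproj_ind: v => v; rewrite !lquot_scaleE scalerA. Qed.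

Fact lquot_scale1 : left_id 1 lquot_scale.
Proof. by elim/lproj_ind=> v; rewrite lquot_scaleE scale1r. Qed.

Fact lquot_scaleDr : right_distributive lquot_scale +%R.
Proof.
move=> a; elim/lproj_ind=> u; elim/lproj_ind=> v.
by rewrite -lprojD !lquot_scaleE scalerDr lprojD.
Qed.

Fact lquot_scaleDl v : {morph lquot_scale^~ v : a b / a + b}.
Proof.
by move=> a b; elim/lproj_ind: v => v /=; rewrite !lquot_scaleE scalerDl lprojD.
Qed.

HB.instance Definition _ := GRing.Zmodule_isLmodule.Build k lmod_quot
  lquot_scaleA lquot_scale1 lquot_scaleDr lquot_scaleDl.

Lemma lprojZ a x : lproj (a *: x) = a *: lproj x.
Proof. by rewrite -lquot_scaleE. Qed.

Fact lproj_is_linear : linear lproj.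
Proof. by move=> a x y; rewrite lprojD lprojZ. Qed.

HB.instance Definition _ :=
  GRing.isLinear.Build k V lmod_quot *:%R lproj lproj_is_linear.

Definition llift (W : lmodType k) (f : V -> W) (q : lmod_quot) : W := f (repr q).

Lemma lliftE (W : lmodType k) (f : {linear V -> W}) x :
  (forall s, S s -> f s = 0) -> llift f (lproj x) = f x.
Proof.
move=> fS; apply/eqP; rewrite -subr_eq0 /llift -linearB; apply/eqP.
elim: (lrepr_proj x) => [|a s v Ss _ IH]; first exact: linear0.
by rewrite linearP IH fS // scaler0 addr0.
Qed.

End LmodQuotient.

Section AlgQuotient.
Variables (k : pzRingType) (A : pzAlgType k) (S : A -> Prop).

(* The two-sided ideal generated by S is the k-span of this set. *)
Definition two_sided (x : A) : Prop := exists a s b, S s /\ x = a * s * b.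

Lemma lspan_mull a x : lspan two_sided x -> lspan two_sided (a * x).
Proof.
elim=> [|c _ v [a' [s [b [Ss ->]]]] _ IH]; first by rewrite mulr0; apply: lspan0.
rewrite mulrDr -pzscalerAr !mulrA; apply: lspanZD => //.
by exists (a * a'), s, b.
Qed.

Lemma lspan_mulr a x : lspan two_sided x -> lspan two_sided (x * a).
Proof.
elim=> [|c _ v [a' [s [b [Ss ->]]]] _ IH]; first by rewrite mul0r; apply: lspan0.
rewrite mulrDl -pzscalerAl -mulrA; apply: lspanZD => //.
by exists a', s, (b * a).
Qed.

Definition alg_quot := lmod_quot two_sided.

HB.instance Definition _ := GRing.Lmodule.on alg_quot.

Definition aproj : A -> alg_quot := @lproj k A two_sided.

HB.instance Definition _ := GRing.Linear.on aproj.

Lemma aprojZ a x : aproj (a *: x) = a *: aproj x.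
Proof. exact: lprojZ. Qed.

Definition aquot_mul (x y : alg_quot) : alg_quot := aproj (repr x * repr y).

Lemma aquot_mulE x y : aquot_mul (aproj x) (aproj y) = aproj (x * y).
Proof.
apply/lprojP; set x' := repr _; set y' := repr _.
have -> : x' * y' - x * y = (x' - x) * y' + x * (y' - y).
  by rewrite mulrBl mulrBr addrA subrK.
by apply: lspanD; [apply: lspan_mulr | apply: lspan_mull]; apply: lrepr_proj.
Qed.

Fact aquot_mulA : associative aquot_mul.
Proof.
elim/lproj_ind=> x; elim/lproj_ind=> y; elim/lproj_ind=> z.
by rewrite -!/(aproj _) !aquot_mulE mulrA.
Qed.

Fact aquot_mul1l : left_id (aproj 1) aquot_mul.
Proof. by elim/lproj_ind=> x; rewrite -!/(aproj _) aquot_mulE mul1r. Qed.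

Fact aquot_mul1r : right_id (aproj 1) aquot_mul.
Proof. by elim/lproj_ind=> x; rewrite -!/(aproj _) aquot_mulE mulr1. Qed.

Fact aquot_mulDl : left_distributive aquot_mul +%R.
Proof.
elim/lproj_ind=> x; elim/lproj_ind=> y; elim/lproj_ind=> z.
by rewrite -!/(aproj _) -linearD !aquot_mulE mulrDl linearD.
Qed.

Fact aquot_mulDr : right_distributive aquot_mul +%R.
Proof.
elim/lproj_ind=> x; elim/lproj_ind=> y; elim/lproj_ind=> z.
by rewrite -!/(aproj _) -linearD !aquot_mulE mulrDr linearD.
Qed.

Fact aquot_mulZl a (x y : alg_quot) : a *: aquot_mul x y = aquot_mul (a *: x) y.
Proof.
elim/lproj_ind: x => x; elim/lproj_ind: y => y; rewrite -!/(aproj _).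
by rewrite aquot_mulE -!aprojZ aquot_mulE pzscalerAl.
Qed.

Fact aquot_mulZr a (x y : alg_quot) : a *: aquot_mul x y = aquot_mul x (a *: y).
Proof.
elim/lproj_ind: x => x; elim/lproj_ind: y => y; rewrite -!/(aproj _).
by rewrite aquot_mulE -!aprojZ aquot_mulE pzscalerAr.
Qed.

HB.instance Definition _ := isPzAlgebra.Build k alg_quot aquot_mulA aquot_mul1l
  aquot_mul1r aquot_mulDl aquot_mulDr aquot_mulZl aquot_mulZr.
HB.instance Definition _ := GRing.Zmodule_isPzRing.Build alg_quot
  aquot_mulA aquot_mul1l aquot_mul1r aquot_mulDl aquot_mulDr.

Fact aproj_is_monoid_morphism : monoid_morphism aproj.
Proof. by split=> // x y; rewrite -aquot_mulE. Qed.

HB.instance Definition _ :=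
  GRing.isMonoidMorphism.Build A alg_quot aproj aproj_is_monoid_morphism.

End AlgQuotient.

Section FreeModule.
Variables (k : comNzRingType) (X : choiceType).

Definition malg_ext (W : lmodType k) (h : X -> W) (g : {malg k[X]}) : W :=
  \sum_(x <- msupp g) g@_x *: h x.

Lemma malg_extEw (W : lmodType k) (h : X -> W) (g : {malg k[X]}) (d : {fset X}) :
  (msupp g `<=` d)%fset -> malg_ext h g = \sum_(x <- d) g@_x *: h x.
Proof.
move=> le; rewrite /malg_ext (big_fset_incl _ le) //= => x xd /mcoeff_outdom ->.
by rewrite scale0r.
Qed.

Fact malg_ext_is_linear (W : lmodType k) (h : X -> W) : linear (malg_ext h).
Proof.
move=> a u v; pose d := (msupp (a *: u + v) `|` (msupp u `|` msupp v))%fset.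
rewrite !(@malg_extEw _ _ _ d) /d ?fsubsetUl //; first last.
- by rewrite fsubsetU // fsubsetUl orbT.
- by rewrite fsubsetU // fsubsetUr orbT.
rewrite scaler_sumr -big_split /=; apply: eq_bigr => x _.
by rewrite mcoeffD mcoeffZ scalerDl scalerA.
Qed.

HB.instance Definition _ (W : lmodType k) (h : X -> W) :=
  GRing.isLinear.Build k {malg k[X]} W *:%R (malg_ext h) (malg_ext_is_linear h).

Lemma malg_extU (W : lmodType k) (h : X -> W) x : malg_ext h << x >> = h x.
Proof. by rewrite (malg_extEw _ msuppU_le) big_seq_fset1 mcoeffUU scale1r. Qed.

Lemma malg_extP (W : lmodType k) (h : X -> W) a u v :
  malg_ext h (a *: u + v) = a *: malg_ext h u + malg_ext h v.
Proof. exact: linearP. Qed.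

Lemma malg_ext0 (W : lmodType k) (h : X -> W) : malg_ext h 0 = 0.
Proof. exact: linear0. Qed.

Lemma malg_span (g : {malg k[X]}) : lspan (fun u => exists x, u = << x >>) g.
Proof.
rewrite [g]monalgE; elim/big_ind: _ => [||x _]; first exact: lspan0.
  exact: lspanD.
have -> : << g@_x *g x >> = g@_x *: << x >> :> {malg k[X]}.
  by apply/malgP => y; rewrite mcoeffZ !mcoeffU mulrnAr mulr1.
by apply/lspanZ/lspan_gen; exists x.
Qed.

End FreeModule.

Section FreeAlgebra.
Variables (k : comNzRingType) (M : monomType).

Fact malg_scalerAr (a : k) (f g : {malg k[M]}) : a *: (f * g) = f * (a *: g).
Proof.
elim: (malg_span f) => [|b _ v [x ->] _ IHf].
  by rewrite !mul0r scaler0.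
rewrite !mulrDl -!scalerAl scalerDr IHf; congr (_ + _).
rewrite scalerA mulrC -scalerA; congr (_ *: _).
elim: (malg_span g) => [|c _ w [y ->] _ IHg]; first by rewrite !(mulr0, scaler0).
have MU d : << x >> * (d *: << y >>) = d *: (<< x >> * << y >>) :> {malg k[M]}.
  rewrite !malgM_def fgmulUU mulr1.
  have ZU z : d *: << z >> = << d *g z >> :> {malg k[M]}.
    by apply/malgP => t; rewrite mcoeffZ !mcoeffU mulrnAr mulr1.
  by rewrite !ZU fgmulUU mul1r.
rewrite mulrDr scalerDr IHg (scalerDr a) mulrDr; congr (_ + _).
by rewrite (scalerA a c << y >>) !MU scalerA.
Qed.

HB.instance Definition _ := isPzAlgebra.Build k {malg k[M]}
  (@mulrA _) (@mul1r _) (@mulr1 _) (@mulrDl _) (@mulrDr _)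
  (@scalerAl _ _) malg_scalerAr.

End FreeAlgebra.

(* The free associative algebra on the set X. *)
Definition free_alg (k : comNzRingType) (X : choiceType) : pzAlgType k :=
  {malg k[{fmonom X}]}.

Definition free_gen (k : comNzRingType) (X : choiceType) (x : X) : free_alg k X :=
  << fmu x >>.

Section TensorPower.
Variables (k : comNzRingType) (F : pzAlgType k) (n : nat).

Local Notation pure_tuple := {ffun 'I_n -> F}.

Definition upd (u : pure_tuple) (i : 'I_n) (f : F) : pure_tuple :=
  [ffun j => if j == i then f else u j].

Definition tuple_mul (u v : pure_tuple) : pure_tuple := [ffun i => u i * v i].

Definition tuple_perm (s : 'S_n) (u : pure_tuple) : pure_tuple :=
  [ffun i => u (s^-1%g i)].

Inductive multilinearity : {malg k[pure_tuple]} -> Prop :=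
| multilinD u i f g : multilinearity
    (<< upd u i (f + g) >> - << upd u i f >> - << upd u i g >>)
| multilinZ u i a f : multilinearity
    (<< upd u i (a *: f) >> - a *: << upd u i f >>).

(* The tensor power of F over k, as a quotient of the free module on F^n. *)
Definition tens := lmod_quot multilinearity.

HB.instance Definition _ := GRing.Lmodule.on tens.

Definition tproj : {malg k[pure_tuple]} -> tens := @lproj _ _ multilinearity.

HB.instance Definition _ := GRing.Linear.on tproj.

Definition pure (u : pure_tuple) : tens := tproj << u >>.

Lemma pureD u i f g : pure (upd u i (f + g)) = pure (upd u i f) + pure (upd u i g).
Proof.
rewrite /pure -linearD; apply/lprojP/lspan_gen.
by rewrite opprD addrA; apply: multilinD.
Qed.

Lemma pureZ u i a f : pure (upd u i (a *: f)) = a *: pure (upd u i f).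
Proof. by rewrite /pure -[RHS]lprojZ; apply/lprojP/lspan_gen/multilinZ. Qed.

Lemma tens_span t : lspan (fun x => exists u, x = pure u) t.
Proof.
elim/lproj_ind: t => g; rewrite -/(tproj g).
elim: (malg_span g) => [|a _ v [u ->] _ IH]; first by rewrite linear0; apply: lspan0.
by rewrite linearP; apply: lspanZD => //; exists u.
Qed.

Definition malg_mul (p q : {malg k[pure_tuple]}) : {malg k[pure_tuple]} :=
  malg_ext (fun u => malg_ext (fun v => << tuple_mul u v >>) q) p.

Definition tens_mul (x y : tens) : tens := tproj (malg_mul (repr x) (repr y)).

Fact malg_mulPl a p q r : malg_mul (a *: p + q) r = a *: malg_mul p r + malg_mul q r.
Proof. exact: malg_extP. Qed.

Fact malg_mul0l p : malg_mul 0 p = 0.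
Proof. exact: malg_ext0. Qed.

Fact malg_mulPr a p q r : malg_mul r (a *: p + q) = a *: malg_mul r p + malg_mul r q.
Proof.
elim: (malg_span r) => [|b _ v [u ->] _ IH].
  by rewrite !malg_mul0l scaler0 addr0.
have mulU x : malg_mul << u >> x = malg_ext (fun v => << tuple_mul u v >>) x.
  by rewrite /malg_mul malg_extU.
rewrite !malg_mulPl IH !mulU malg_extP; move: (malg_ext _ p) (malg_ext _ q).
move: (malg_mul v p) (malg_mul v q) => x y z t.
by rewrite !scalerDr !scalerA (mulrC b) addrACA.
Qed.

Fact malg_mul0r p : malg_mul p 0 = 0.
Proof.
by apply: (addrI (1 *: malg_mul p 0)); rewrite -malg_mulPr scaler0 !addr0 scale1r.
Qed.

Fact malg_mulZl a p q : malg_mul (a *: p) q = a *: malg_mul p q.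
Proof. by rewrite -[a *: p]addr0 malg_mulPl malg_mul0l addr0. Qed.

Fact malg_mulZr a p q : malg_mul q (a *: p) = a *: malg_mul q p.
Proof. by rewrite -[a *: p]addr0 malg_mulPr malg_mul0r addr0. Qed.

Fact malg_mulBl x y z : malg_mul (x - y) z = malg_mul x z - malg_mul y z.
Proof. by rewrite addrC -scaleN1r malg_mulPl scaleN1r addrC. Qed.

Fact malg_mulBr x y z : malg_mul z (x - y) = malg_mul z x - malg_mul z y.
Proof. by rewrite addrC -scaleN1r malg_mulPr scaleN1r addrC. Qed.

Fact malg_mulUU u v : malg_mul << u >> << v >> = << tuple_mul u v >>.
Proof. by rewrite /malg_mul !malg_extU. Qed.

Fact tuple_mul_updl u i f v : tuple_mul (upd u i f) v = upd (tuple_mul u v) i (f * v i).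
Proof. by apply/ffunP => j; rewrite !ffunE; case: eqP => // ->. Qed.

Fact tuple_mul_updr u i f v : tuple_mul v (upd u i f) = upd (tuple_mul v u) i (v i * f).
Proof. by apply/ffunP => j; rewrite !ffunE; case: eqP => // ->. Qed.

Fact malg_mul_multil p q :
  lspan multilinearity p -> lspan multilinearity (malg_mul p q).
Proof.
elim=> [|c s w Ms _ IHp]; first by rewrite malg_mul0l; apply: lspan0.
rewrite malg_mulPl; apply/lspanD/IHp/lspanZ.
elim: (malg_span q) => [|a _ v [x ->] _ IH]; first by rewrite malg_mul0r; apply: lspan0.
rewrite malg_mulPr; apply/lspanD/IH/lspanZ/lspan_gen.
case: Ms => [u i f g|u i b f].
  rewrite !malg_mulBl !malg_mulUU !tuple_mul_updl mulrDl; exact: multilinD.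
rewrite malg_mulBl malg_mulZl !malg_mulUU !tuple_mul_updl -pzscalerAl.
exact: multilinZ.
Qed.

Fact malg_mul_multir p q :
  lspan multilinearity p -> lspan multilinearity (malg_mul q p).
Proof.
elim=> [|c s w Ms _ IHp]; first by rewrite malg_mul0r; apply: lspan0.
rewrite malg_mulPr; apply/lspanD/IHp/lspanZ.
elim: (malg_span q) => [|a _ v [x ->] _ IH]; first by rewrite malg_mul0l; apply: lspan0.
rewrite malg_mulPl; apply/lspanD/IH/lspanZ/lspan_gen.
case: Ms => [u i f g|u i b f].
  rewrite !malg_mulBr !malg_mulUU !tuple_mul_updr mulrDr; exact: multilinD.
rewrite malg_mulBr malg_mulZr !malg_mulUU !tuple_mul_updr -pzscalerAr.
exact: multilinZ.
Qed.

Lemma tprojP a x y : tproj (a *: x + y) = a *: tproj x + tproj y.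
Proof. exact: linearP. Qed.

Lemma tens_mulE p q : tens_mul (tproj p) (tproj q) = tproj (malg_mul p q).
Proof.
apply/lprojP; set p' := repr _; set q' := repr _.
have -> : malg_mul p' q' - malg_mul p q =
    malg_mul (p' - p) q' + malg_mul p (q' - q).
  by rewrite malg_mulBl malg_mulBr addrA subrK.
by apply: lspanD; [apply: malg_mul_multil | apply: malg_mul_multir];
  apply: lrepr_proj.
Qed.

Lemma tens_mul_pure u v : tens_mul (pure u) (pure v) = pure (tuple_mul u v).
Proof. by rewrite tens_mulE malg_mulUU. Qed.

Fact tens_mulPl a (x y z : tens) :
  tens_mul (a *: x + y) z = a *: tens_mul x z + tens_mul y z.
Proof.
elim/lproj_ind: x => x; elim/lproj_ind: y => y; elim/lproj_ind: z => z.
by rewrite -!/(tproj _) -tprojP !tens_mulE malg_mulPl tprojP.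
Qed.

Fact tens_mulPr a (x y z : tens) :
  tens_mul z (a *: x + y) = a *: tens_mul z x + tens_mul z y.
Proof.
elim/lproj_ind: x => x; elim/lproj_ind: y => y; elim/lproj_ind: z => z.
by rewrite -!/(tproj _) -tprojP !tens_mulE malg_mulPr tprojP.
Qed.

Fact tens_mulDl : left_distributive tens_mul +%R.
Proof. by move=> x y z; rewrite -[x]scale1r tens_mulPl !scale1r. Qed.

Fact tens_mulDr : right_distributive tens_mul +%R.
Proof. by move=> x y z; rewrite -[y]scale1r tens_mulPr !scale1r. Qed.

Fact tens_mul0l x : tens_mul 0 x = 0.
Proof. by apply: (addrI (tens_mul 0 x)); rewrite -tens_mulDl !addr0. Qed.

Fact tens_mul0r x : tens_mul x 0 = 0.
Proof. by apply: (addrI (tens_mul x 0)); rewrite -tens_mulDr !addr0. Qed.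

Fact tens_mulZl a (x y : tens) : a *: tens_mul x y = tens_mul (a *: x) y.
Proof. by rewrite -[in RHS](addr0 (a *: x)) tens_mulPl tens_mul0l addr0. Qed.

Fact tens_mulZr a (x y : tens) : a *: tens_mul x y = tens_mul x (a *: y).
Proof. by rewrite -[in RHS](addr0 (a *: y)) tens_mulPr tens_mul0r addr0. Qed.

Lemma tens_eq_pure (W : lmodType k) (f g : tens -> W) :
    (forall a x y, f (a *: x + y) = a *: f x + f y) ->
    (forall a x y, g (a *: x + y) = a *: g x + g y) ->
  (forall u, f (pure u) = g (pure u)) -> f =1 g.
Proof.
move=> fP gP fg x; elim: (tens_span x) => [|a _ v [u ->] _ IH].
  have h0 (h : tens -> W) : (forall a y z, h (a *: y + z) = a *: h y + h z) -> h 0 = 0.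
    by move=> hP; apply: (addrI (1 *: h 0)); rewrite -hP scaler0 !addr0 scale1r.
  by rewrite !h0.
by rewrite fP gP fg IH.
Qed.

Fact tens_mulA : associative tens_mul.
Proof.
move=> x y z.
apply: (tens_eq_pure (f := fun x => tens_mul x (tens_mul y z))
                     (g := fun x => tens_mul (tens_mul x y) z)) => [a p q|a p q|u].
- by rewrite tens_mulPl.
- by rewrite (tens_mulPl a p q y) tens_mulPl.
apply: (tens_eq_pure (f := fun y => tens_mul (pure u) (tens_mul y z))
                     (g := fun y => tens_mul (tens_mul (pure u) y) z)) => [a p q|a p q|v].
- by rewrite (tens_mulPl a p q z) tens_mulPr.
- by rewrite (tens_mulPr a p q (pure u)) tens_mulPl.
apply: (tens_eq_pure (f := fun z => tens_mul (pure u) (tens_mul (pure v) z))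
             (g := fun z => tens_mul (tens_mul (pure u) (pure v)) z)) => [a p q|a p q|w].
- by rewrite (tens_mulPr a p q (pure v)) tens_mulPr.
- by rewrite tens_mulPr.
rewrite !tens_mul_pure; congr pure.
by apply/ffunP => i; rewrite !ffunE mulrA.
Qed.

Definition tens_one : tens := pure [ffun=> 1].

Fact tens_mul1l : left_id tens_one tens_mul.
Proof.
apply: (tens_eq_pure (f := tens_mul tens_one) (g := id)) => [a p q|//|u].
  exact: tens_mulPr.
by rewrite tens_mul_pure; congr pure; apply/ffunP => i; rewrite !ffunE mul1r.
Qed.

Fact tens_mul1r : right_id tens_one tens_mul.
Proof.
apply: (tens_eq_pure (f := tens_mul^~ tens_one) (g := id)) => [a p q|//|u].
  exact: tens_mulPl.
by rewrite tens_mul_pure; congr pure; apply/ffunP => i; rewrite !ffunE mulr1.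
Qed.

HB.instance Definition _ := isPzAlgebra.Build k tens tens_mulA tens_mul1l
  tens_mul1r tens_mulDl tens_mulDr tens_mulZl tens_mulZr.
HB.instance Definition _ := GRing.Zmodule_isPzRing.Build tens
  tens_mulA tens_mul1l tens_mul1r tens_mulDl tens_mulDr.

(* The place permutation action: the factor at position i moves to s i. *)
Definition tens_perm (s : 'S_n) : tens -> tens :=
  llift (malg_ext (fun u => pure (tuple_perm s u))).

Lemma tens_permE s p :
  tens_perm s (tproj p) = malg_ext (fun u => pure (tuple_perm s u)) p.
Proof.
have perm_upd u i f : tuple_perm s (upd u i f) = upd (tuple_perm s u) (s i) f.
  apply/ffunP => j; rewrite !ffunE -(inj_eq (@perm_inj _ s)) permKV //.
apply: lliftE => _ [u i f g|u i a f].
  by rewrite !linearB /= !malg_extU !perm_upd pureD -addrA -opprD subrr.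
by rewrite linearB linearZ /= !malg_extU !perm_upd pureZ subrr.
Qed.

Fact tens_perm_is_linear s : linear (tens_perm s).
Proof.
move=> a x y; elim/lproj_ind: x => x; elim/lproj_ind: y => y.
by rewrite -!/(tproj _) -tprojP !tens_permE malg_extP.
Qed.

HB.instance Definition _ s :=
  GRing.isLinear.Build k tens tens *:%R (tens_perm s) (tens_perm_is_linear s).

Lemma tens_perm_pure s u : tens_perm s (pure u) = pure (tuple_perm s u).
Proof. by rewrite tens_permE malg_extU. Qed.

(* f_i = 1 (x) ... (x) f (x) ... (x) 1, with f at position i. *)
Definition tens_at (i : 'I_n) (f : F) : tens := pure (upd [ffun=> 1] i f).

(* The image of Z(F)^(x)n in F^(x)n. *)
Definition central_tens : tens -> Prop :=
  lspan (fun t => exists2 u : pure_tuple,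
    (forall i f, u i * f = f * u i) & t = pure u).

Definition tens_deg (Fdeg : nat -> F -> Prop) (m : nat) : tens -> Prop :=
  lspan (fun t => exists (u : pure_tuple) (e : 'I_n -> nat),
    [/\ forall i, Fdeg (e i) (u i), (\sum_(i < n) e i)%N = m & t = pure u]).

End TensorPower.

Section AffineWreath.
Variables (k : comNzRingType) (F : pzAlgType k).
Variables (r : nat) (b bv : 'I_r -> F) (n : nat).

(* t_{i,j}, for the basis b with dual basis bv. *)
Definition tens_t (i j : 'I_n) : tens F n :=
  \sum_(l < r) tens_at i (b l) * tens_at j (bv l).

Definition aff_free : pzAlgType k := free_alg k ('I_n + tens F n + 'S_n)%type.

Local Notation x_ i := (free_gen k (inl (inl i)) : aff_free).
Local Notation f_ f := (free_gen k (inl (inr f)) : aff_free).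
Local Notation s_ s := (free_gen k (inr s) : aff_free).

(* The difference of the two sides of each defining relation.  The first       *)
(* seven families present the free product of k[x_1, ..., x_n], the tensor     *)
(* power and kS_n.  In MathComp [(s * t)%g] is "s, then t", hence the order in *)
(* [aff_SM].                                                                   *)
Inductive aff_rel : aff_free -> Prop :=
| aff_xx i j : aff_rel (x_ i * x_ j - x_ j * x_ i)
| aff_FD f g : aff_rel (f_ (f + g) - (f_ f + f_ g))
| aff_FZ a f : aff_rel (f_ (a *: f) - a *: f_ f)
| aff_FM f g : aff_rel (f_ (f * g) - f_ f * f_ g)
| aff_F1 : aff_rel (f_ 1 - 1)
| aff_SM s t : aff_rel (s_ (t * s)%g - s_ s * s_ t)
| aff_S1 : aff_rel (s_ 1%g - 1)
| aff_Fx f i : aff_rel (f_ f * x_ i - x_ i * f_ f)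
| aff_sx_far (i i' j : 'I_n) : i' = i.+1 :> nat -> j != i -> j != i' ->
    aff_rel (s_ (tperm i i') * x_ j - x_ j * s_ (tperm i i'))
| aff_sx (i i' : 'I_n) : i' = i.+1 :> nat ->
    aff_rel (s_ (tperm i i') * x_ i - (x_ i' * s_ (tperm i i') - f_ (tens_t i i')))
| aff_SF s f : aff_rel (s_ s * f_ f - f_ (tens_perm s f) * s_ s).

Definition affine_wreath : pzAlgType k := alg_quot aff_rel.

Definition aff_x (i : 'I_n) : affine_wreath := aproj aff_rel (x_ i).
Definition aff_F (f : tens F n) : affine_wreath := aproj aff_rel (f_ f).
Definition aff_S (s : 'S_n) : affine_wreath := aproj aff_rel (s_ s).

Variables (Fdeg : nat -> F -> Prop) (delta : nat).

Inductive aff_monomial : nat -> affine_wreath -> Prop :=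
| aff_mon1 : aff_monomial 0 1
| aff_monx i m y : aff_monomial m y -> aff_monomial (delta + m) (aff_x i * y)
| aff_monF i f e m y : Fdeg e f -> aff_monomial m y ->
    aff_monomial (e + m) (aff_F (tens_at i f) * y)
| aff_monS s m y : aff_monomial m y -> aff_monomial m (aff_S s * y).

(* The grading with |x_i| = delta, |f_i| = |f| and |s| = 0. *)
Definition aff_deg (m : nat) : affine_wreath -> Prop := lspan (aff_monomial m).

Section Cyclotomic.
Variables (n_gt0 : (0 < n)%N) (d : nat) (c : 'I_d -> tens F n).

Definition cyclotomic_gen : affine_wreath :=
  \prod_(j < d) (aff_x (Ordinal n_gt0) - aff_F (c j)).

Definition cyclotomic_wreath : pzAlgType k :=
  alg_quot (fun y : affine_wreath => y = cyclotomic_gen).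

Definition cyclotomic_deg (m : nat) (z : cyclotomic_wreath) : Prop :=
  exists2 y, aff_deg m y & z = aproj _ y.

End Cyclotomic.
End AffineWreath.

Section GradedAlgebras.
Variables (k : comNzRingType) (A : pzAlgType k).
Variable (deg : nat -> A -> Prop).

(* [deg m] is the homogeneous component of degree m. *)
Record graded_algebra : Prop := {
  gr_submod : forall m a x y, deg m x -> deg m y -> deg m (a *: x + y);
  gr_zero : forall m, deg m 0;
  gr_one : deg 0 1;
  gr_mul : forall m p x y, deg m x -> deg p y -> deg (m + p) (x * y);
  gr_decomp : forall x, exists N (c : nat -> A),
    (forall m, deg m (c m)) /\ x = \sum_(m < N) c m;
  gr_direct : forall N (c : nat -> A), (forall m, deg m (c m)) ->
    \sum_(m < N) c m = 0 -> forall m, (m < N)%N -> c m = 0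
}.

Definition homogeneous_trace (tr : {scalar A}) : Prop :=
  exists e : nat, forall m x, deg m x -> m != e -> tr x = 0.

(* Bijectivity of f |-> (g |-> tr (g f)) from A to Hom_k(A, k). *)
Definition perfect_trace (tr : {scalar A}) : Prop :=
  forall phi : {scalar A}, exists! f, forall g, phi g = tr (g * f).

Definition frobenius_trace (tr : {scalar A}) : Prop :=
  homogeneous_trace tr /\ perfect_trace tr.

Definition symmetric_trace (tr : {scalar A}) : Prop :=
  frobenius_trace tr /\ forall f g, tr (f * g) = tr (g * f).

Definition symmetric_algebra : Prop :=
  graded_algebra /\ exists tr : {scalar A}, symmetric_trace tr.

Definition max_degree (delta : nat) : Prop :=
  (exists2 f, deg delta f & f != 0) /\
  forall m f, deg m f -> f != 0 -> (m <= delta)%N.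

Definition homogeneous_basis (r : nat) (b : 'I_r -> A) : Prop :=
  (forall l, exists m, deg m (b l)) /\
  forall f, exists! a : {ffun 'I_r -> k}, f = \sum_(l < r) a l *: b l.

End GradedAlgebras.

Definition dual_basis (k : comNzRingType) (A : pzAlgType k) (tr : {scalar A})
    (r : nat) (b bv : 'I_r -> A) : Prop :=
  forall l l', tr (bv l * b l') = (l == l')%:R.

(* Main.v *)
From HB Require Import structures.
Require Import Defs.
From mathcomp Require Import all_boot all_order all_algebra all_fingroup.
From mathcomp Require Import finmap boolp functions monalg.
From mathcomp Require Import ssrAC zify ring.

(** Write T for the n-th tensor power of F.  A symmetrizing trace on the
    cyclotomic quotient is read off from one explicit module over the affine
    wreath product algebra.

    The module E consists of the functions u(w, p) with values in T, where w is
    a word of n colours in nat and p is a permutation.  An element f of T acts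
    by multiplying u(w, p) by its image under p, and a permutation acts by
    translating both arguments.  The variable x_i acts by

      (x_i u)(w, p) = u(w + e_i, p) + c(w_i) u(w, p)
         + sum_(j <> i) ([j < i] - [w_i < w_j]) t_(p i, p j) u(w (i j), (i j) p),

    where c(a) is the a-th cyclotomic parameter, e_i raises the i-th colour by
    one, and w (i j), (i j) p are w and p with the places i and j exchanged.  The
    first two terms form a bidiagonal companion matrix of the product of the
    x - c(a).  In the sum, the indicator [j < i] produces the correction
    t_(i, i+1) of the wreath relations, and the indicator [w_i < w_j] makes the
    x_i commute ([opX_comm]).  A factor x_1 - c(a) lowers the bound on the first
    colour by one ([cyclotomic_step]), so the functions that vanish as soon as
    some colour reaches d form a module over the cyclotomic quotient.

    Let v be the function equal to 1 at (constant word d-1, identity) and to 0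
    elsewhere, let lambda(u) be the trace of u(constant word 0, identity), and
    put tau(a) = lambda(a v).

    - tau(a b) = tau(b a).  Each generator g also acts from the right, by an
      operator R that commutes with all the generators, such that R v = g v and
      lambda(R u) = lambda(g u); hence tau(a g) = lambda(a R v) = lambda(R a v)
      = tau(g a) ([trace_central_right]).  This is elementary for elements of T
      and permutations; for x_1 the operator is [opZ]; the other x_i are
      generated by these.

    - tau is perfect.  Counting the variables shows that the products
      f s x^beta, for f in T, s a permutation and every exponent below d, span
      the quotient: moving x past a permutation renumbers it up to terms with
      fewer variables, and x_i^d is a combination of such terms
      ([fil_reduced]).  In a product of at most n (d-1) variables applied to v,
      only the raising of colours contributes at the constant word 0
      ([trE_gram]).  So the Gram matrix of these products is block triangular,
      and its diagonal blocks are copies of the trace form of T, which is perfect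
      because that of F is ([tau_nondeg], [tau_repr]).

    - tau is homogeneous of degree n d delta, by tracking degrees in E
      ([homog]).  Homogeneity and perfection together also show that the degree
      components of the quotient are independent ([gen_deg_graded]).

    For d = 0 the quotient is the zero algebra. *)

Set Implicit Arguments.
Unset Strict Implicit.
Unset Printing Implicit Defensive.

Import GRing.Theory.
Local Open Scope ring_scope.

(** * Linear spans *)

Section Spans.
Variables (k : pzRingType) (V : lmodType k).

Lemma lspan_ind_lin (S P : V -> Prop) : P 0 ->
  (forall a x y, P x -> P y -> P (a *: x + y)) ->
  (forall x, S x -> P x) -> forall x, lspan S x -> P x.
Proof. by move=> P0 PD PS x; elim=> // a u v Su _; apply: PD; apply: PS. Qed.

Lemma lspan_sub (S S' : V -> Prop) :
  (forall x, S x -> lspan S' x) -> forall x, lspan S x -> lspan S' x.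
Proof.
move=> SS'; apply: lspan_ind_lin => // [|a x y Sx Sy]; first exact: lspan0.
exact/lspanD/Sy/lspanZ.
Qed.

Lemma lspan_sum (S : V -> Prop) I (s : seq I) (P : pred I) (f : I -> V) :
  (forall i, P i -> lspan S (f i)) -> lspan S (\sum_(i <- s | P i) f i).
Proof. by move=> Sf; apply: big_ind => //; [apply: lspan0 | apply: lspanD]. Qed.

Lemma lspanB (S : V -> Prop) x y : lspan S x -> lspan S y -> lspan S (x - y).
Proof. by move=> Sx Sy; rewrite -scaleN1r; apply/lspanD/lspanZ. Qed.

End Spans.

(** * The tensor power of an algebra *)

Section TensorAlgebra.
Variables (k : comNzRingType) (F : pzAlgType k) (n : nat).
Local Notation T := (tens F n).

Lemma pureM (u v : {ffun 'I_n -> F}) : pure u * pure v = pure (tuple_mul u v).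
Proof. exact: tens_mul_pure. Qed.

Lemma tens_at_is_linear i : linear (@tens_at k F n i).
Proof. by move=> a f g; rewrite /tens_at pureD pureZ. Qed.
HB.instance Definition _ i :=
  GRing.isLinear.Build k F T *:%R (@tens_at k F n i) (tens_at_is_linear i).

Lemma tens_atM i f g : tens_at i (f * g) = tens_at i f * tens_at i g :> T.
Proof.
rewrite /tens_at pureM; congr pure; apply/ffunP => j; rewrite !ffunE.
by case: eqP => // _; rewrite mulr1.
Qed.

Lemma tens_atC i j f g : i != j ->
  tens_at i f * tens_at j g = tens_at j g * tens_at i f :> T.
Proof.
move=> ij; rewrite /tens_at !pureM; congr pure; apply/ffunP => l; rewrite !ffunE.
have [->|_] := eqVneq l i; first by rewrite (negbTE ij) mulr1 mul1r.
by rewrite mulr1 mul1r.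
Qed.

Lemma pure_prod_seq (u : {ffun 'I_n -> F}) (s : seq 'I_n) : uniq s ->
  \prod_(i <- s) tens_at i (u i) = pure [ffun i => if i \in s then u i else 1] :> T.
Proof.
elim: s => [_|i s IH /= /andP[si us]].
  by rewrite big_nil; congr pure; apply/ffunP => i; rewrite !ffunE.
rewrite big_cons IH // /tens_at pureM; congr pure; apply/ffunP => j.
rewrite !ffunE inE; have [->|ji] /= := eqVneq j i; last by rewrite mul1r.
by rewrite (negbTE si) mulr1.
Qed.

Lemma pure_prod (u : {ffun 'I_n -> F}) : pure u = \prod_(i < n) tens_at i (u i) :> T.
Proof.
rewrite pure_prod_seq ?index_enum_uniq //; congr pure; apply/ffunP => i.
by rewrite ffunE mem_index_enum.
Qed.

Lemma tensPl a (x y z : T) : (a *: x + y) * z = a *: (x * z) + y * z.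
Proof. exact: tens_mulPl. Qed.

Lemma tensPr a (x y z : T) : z * (a *: x + y) = a *: (z * x) + z * y.
Proof. exact: tens_mulPr. Qed.

Lemma tens_permP s a (x y : T) :
  tens_perm s (a *: x + y) = a *: tens_perm s x + tens_perm s y.
Proof. exact: tens_perm_is_linear. Qed.

Lemma tens_perm0 s : tens_perm s 0 = 0 :> T.
Proof. exact: linear0. Qed.

Lemma tens_permM s (x y : T) : tens_perm s (x * y) = tens_perm s x * tens_perm s y.
Proof.
apply: (tens_eq_pure (f := fun x => tens_perm s (x * y))
          (g := fun x => tens_perm s x * tens_perm s y)) => [a p q|a p q|u].
- by rewrite tensPl tens_permP.
- by rewrite tens_permP tensPl.
apply: (tens_eq_pure (f := fun y => tens_perm s (pure u * y))
          (g := fun y => tens_perm s (pure u) * tens_perm s y)) => [a p q|a p q|v].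
- by rewrite tensPr tens_permP.
- by rewrite tens_permP tensPr.
rewrite pureM !tens_perm_pure pureM; congr pure.
by apply/ffunP => i; rewrite !ffunE.
Qed.

Lemma tens_perm_one s : tens_perm s 1 = 1 :> T.
Proof. by rewrite tens_perm_pure; congr pure; apply/ffunP => i; rewrite !ffunE. Qed.

Lemma tens_perm1 (x : T) : tens_perm 1%g x = x.
Proof.
apply: (tens_eq_pure (f := tens_perm 1%g) (g := id)) => // [a p q|u].
  exact: tens_permP.
by rewrite tens_perm_pure; congr pure; apply/ffunP => i; rewrite ffunE invg1 perm1.
Qed.

Lemma tens_perm_comp s t (x : T) :
  tens_perm s (tens_perm t x) = tens_perm (t * s)%g x.
Proof.
apply: (tens_eq_pure (f := fun x => tens_perm s (tens_perm t x))) => [a p q|a p q|u].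
- by rewrite !tens_permP.
- exact: tens_permP.
rewrite !tens_perm_pure; congr pure; apply/ffunP => i.
by rewrite !ffunE invMg permM.
Qed.

Lemma tens_perm_at s i f : tens_perm s (tens_at i f) = tens_at (s i) f :> T.
Proof.
rewrite tens_perm_pure; congr pure; apply/ffunP => j; rewrite !ffunE.
by rewrite -(inj_eq (@perm_inj _ s)) permKV.
Qed.

(** Products of the commuting copies [tens_at i] of F replace pure tensors in the
    later arguments, which hold for any algebra with such copies. *)
Lemma tens_prod_span (x : T) : lspan
  (fun y => exists u : {ffun 'I_n -> F}, y = \prod_(i < n) tens_at i (u i)) x.
Proof.
apply: lspan_sub (tens_span x) => _ [u ->]; apply: lspan_gen.
by exists u; rewrite pure_prod.
Qed.

Lemma central_tensC (z x : T) : central_tens z -> x * z = z * x.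
Proof.
move: z; apply: lspan_ind_lin => [|a y z Hy Hz|z].
- by rewrite mulr0 mul0r.
- by rewrite tensPr tensPl Hy Hz.
case=> u uC ->.
apply: (tens_eq_pure (f := fun x => x * pure u) (g := fun x => pure u * x)) => [a p q|a p q|v].
- exact: tensPl.
- exact: tensPr.
by rewrite !pureM; congr pure; apply/ffunP => i; rewrite !ffunE uC.
Qed.

End TensorAlgebra.

(** * The product trace on a tensor power *)

Section TensorTrace.
Variables (k : comNzRingType) (F : pzAlgType k) (tr : {scalar F}) (n : nat).
Local Notation T := (tens F n).

Definition pure_trace (u : {ffun 'I_n -> F}) : k^o := \prod_(i < n) tr (u i).

Definition tens_trace (x : T) : k^o := llift (malg_ext pure_trace) x.

(** Isolates the dependence on one factor, which makes multilinearity visible. *)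
Lemma pure_trace_upd (u : {ffun 'I_n -> F}) i f :
  pure_trace (upd u i f) = tr f * \prod_(j < n | j != i) tr (u j).
Proof.
rewrite /pure_trace (bigD1 i) //= !ffunE eqxx; congr (_ * _).
by apply: eq_bigr => j /negbTE ji; rewrite !ffunE ji.
Qed.

Lemma tens_traceE p : tens_trace (tproj p) = malg_ext pure_trace p.
Proof.
apply: lliftE => _ [u i f g|u i a f].
  rewrite !linearB /= !malg_extU !pure_trace_upd linearD /= mulrDl.
  by rewrite -addrA -opprD subrr.
rewrite linearB linearZ /= !malg_extU !pure_trace_upd linearZ /=.
by rewrite -mulrA /GRing.scale /= subrr.
Qed.

Lemma tens_trace_is_scalar : scalar tens_trace.
Proof.
move=> a x y; elim/lproj_ind: x => x; elim/lproj_ind: y => y.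
by rewrite -!/(tproj _) -tprojP !tens_traceE malg_extP.
Qed.
HB.instance Definition _ :=
  GRing.isLinear.Build k T k *%R tens_trace tens_trace_is_scalar.

Lemma tens_traceP a x y : tens_trace (a *: x + y) = a * tens_trace x + tens_trace y.
Proof. exact: tens_trace_is_scalar. Qed.

Lemma tens_trace0 : tens_trace 0 = 0.
Proof. exact: linear0. Qed.

Lemma tens_trace_pure u : tens_trace (pure u) = \prod_(i < n) tr (u i).
Proof. by rewrite tens_traceE malg_extU. Qed.

Hypothesis trC : forall f g, tr (f * g) = tr (g * f).

Lemma tens_traceC x y : tens_trace (x * y) = tens_trace (y * x).
Proof.
apply: (tens_eq_pure (W := k^o) (f := fun x => tens_trace (x * y))
          (g := fun x => tens_trace (y * x))) => [a p q|a p q|u].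
- by rewrite tensPl tens_traceP.
- by rewrite tensPr tens_traceP.
apply: (tens_eq_pure (W := k^o) (f := fun y => tens_trace (pure u * y))
          (g := fun y => tens_trace (y * pure u))) => [a p q|a p q|v].
- by rewrite tensPr tens_traceP.
- by rewrite tensPl tens_traceP.
rewrite !pureM !tens_trace_pure; apply: eq_bigr => i _.
by rewrite !ffunE trC.
Qed.

Lemma tens_trace_perm s x : tens_trace (tens_perm s x) = tens_trace x.
Proof.
apply: (tens_eq_pure (W := k^o) (f := fun x => tens_trace (tens_perm s x))) => [a p q|a p q|u].
- by rewrite tens_permP tens_traceP.
- exact: tens_traceP.
rewrite tens_perm_pure !tens_trace_pure (reindex_inj (@perm_inj _ s)) /=.
by apply: eq_bigr => i _; rewrite ffunE permK.
Qed.

End TensorTrace.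

(** * Dual bases of a tensor power and the elements t_(i,j) *)

Section TensorDuality.
Variables (k : comNzRingType) (F : pzAlgType k) (n : nat).
Variables (T : pzAlgType k) (at_ : 'I_n -> {linear F -> T}) (perm : 'S_n -> T -> T).
Hypothesis atM : forall i f g, at_ i (f * g) = at_ i f * at_ i g.
Hypothesis atC : forall i j f g, i != j -> at_ i f * at_ j g = at_ j g * at_ i f.
Hypothesis perm_at : forall s i f, perm s (at_ i f) = at_ (s i) f.
Hypothesis permM : forall s x y, perm s (x * y) = perm s x * perm s y.
Hypothesis perm_one : forall s, perm s 1 = 1.
Hypothesis permP : forall s a x y, perm s (a *: x + y) = a *: perm s x + perm s y.
Hypothesis T_span : forall x : T,
  lspan (fun y => exists u : {ffun 'I_n -> F}, y = \prod_(i < n) at_ i (u i)) x.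

Variables (tr : {scalar F}) (trT : {scalar T}).
Hypothesis trC : forall f g, tr (f * g) = tr (g * f).
Hypothesis trT_prod : forall u : {ffun 'I_n -> F},
  trT (\prod_(i < n) at_ i (u i)) = \prod_(i < n) tr (u i).

Variables (r : nat) (b bv : 'I_r -> F).
Hypothesis expand_b : forall f, f = \sum_l tr (bv l * f) *: b l.
Hypothesis expand_bv : forall f, f = \sum_l tr (f * b l) *: bv l.

Let perm0 s : perm s 0 = 0.
Proof. by have := permP s (-1) 0 0; rewrite !scaler0 addr0 scaleN1r addNr. Qed.

Let permD s x y : perm s (x + y) = perm s x + perm s y.
Proof. by rewrite -[x in LHS]scale1r permP scale1r. Qed.

Lemma prod_scale (I : Type) (s : seq I) (a : I -> k) (x : I -> T) :
  \prod_(i <- s) (a i *: x i) = (\prod_(i <- s) a i) *: \prod_(i <- s) x i.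
Proof.
elim: s => [|i s IH]; first by rewrite !big_nil scale1r.
by rewrite !big_cons IH -pzscalerAl -pzscalerAr scalerA.
Qed.

Lemma pure_expand (w : 'I_r -> F) (a : F -> 'I_r -> k) :
    (forall f, f = \sum_l a f l *: w l) -> forall u : {ffun 'I_n -> F},
  \prod_(i < n) at_ i (u i) = \sum_(L : {ffun 'I_n -> 'I_r})
    (\prod_(i < n) a (u i) (L i)) *: \prod_(i < n) at_ i (w (L i)).
Proof.
move=> aw u.
under eq_bigr => i _ do rewrite (aw (u i)) linear_sum.
rewrite bigA_distr_bigA /=; apply: eq_bigr => L _.
by under eq_bigr => i _ do rewrite linearZ; rewrite prod_scale.
Qed.

Lemma at_prodM (u v : {ffun 'I_n -> F}) :
  (\prod_(i < n) at_ i (u i)) * (\prod_(i < n) at_ i (v i)) =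
  \prod_(i < n) at_ i (u i * v i).
Proof.
have: uniq (index_enum 'I_n) by exact: index_enum_uniq.
elim: (index_enum _) => [|i s IH]; first by rewrite !big_nil mulr1.
rewrite /= !big_cons => /andP[si us].
rewrite atM -IH // !mulrA; congr (_ * _); rewrite -!mulrA; congr (_ * _).
elim: s si {us IH} => [|j s IH]; first by rewrite big_nil mulr1 mul1r.
rewrite inE negb_or => /andP[ij si]; rewrite big_cons -mulrA IH // mulrA.
by rewrite -(atC _ _ ij) mulrA.
Qed.

Definition bigb (w : 'I_r -> F) (L : {ffun 'I_n -> 'I_r}) : T :=
  \prod_(i < n) at_ i (w (L i)).

Lemma bigbE w L : bigb w L = \prod_(i < n) at_ i ([ffun i => w (L i)] i).
Proof. by apply: eq_bigr => i _; rewrite ffunE. Qed.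

(** The products of the b_l and of the bv_l over all multi-indices are dual bases
    of T, because the trace of T is multiplicative over the factors. *)
Lemma tens_expand_b x : x = \sum_L trT (bigb bv L * x) *: bigb b L.
Proof.
move: x (T_span x); apply: lspan_ind_lin => [|a x y IHx IHy|_ [u ->]].
- by rewrite big1 // => L _; rewrite mulr0 linear0 scale0r.
- rewrite {1}IHx {1}IHy scaler_sumr -big_split; apply: eq_bigr => L _ /=.
  by rewrite mulrDr -pzscalerAr linearP scalerDl scalerA.
rewrite {1}(pure_expand expand_b); apply: eq_bigr => L _; congr (_ *: _).
rewrite bigbE at_prodM.
have -> : \prod_(i < n) at_ i ([ffun i => bv (L i)] i * u i) =
          \prod_(i < n) at_ i ([ffun i => bv (L i) * u i] i).
  by apply: eq_bigr => i _; rewrite !ffunE.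
by rewrite trT_prod; apply: eq_bigr => i _; rewrite !ffunE.
Qed.

Lemma tens_expand_bv x : x = \sum_L trT (x * bigb b L) *: bigb bv L.
Proof.
move: x (T_span x); apply: lspan_ind_lin => [|a x y IHx IHy|_ [u ->]].
- by rewrite big1 // => L _; rewrite mul0r linear0 scale0r.
- rewrite {1}IHx {1}IHy scaler_sumr -big_split; apply: eq_bigr => L _ /=.
  by rewrite mulrDl -pzscalerAl linearP scalerDl scalerA.
rewrite {1}(pure_expand expand_bv); apply: eq_bigr => L _; congr (_ *: _).
rewrite bigbE at_prodM.
have -> : \prod_(i < n) at_ i (u i * [ffun i => b (L i)] i) =
          \prod_(i < n) at_ i ([ffun i => u i * b (L i)] i).
  by apply: eq_bigr => i _; rewrite !ffunE.
by rewrite trT_prod; apply: eq_bigr => i _; rewrite !ffunE.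
Qed.

Lemma tens_trace_nondeg x : (forall y, trT (y * x) = 0) -> x = 0.
Proof.
move=> x0; rewrite (tens_expand_b x) big1 // => L _.
by rewrite x0 scale0r.
Qed.

Lemma tens_trace_repr (phi : {scalar T}) :
  exists h, forall f, phi f = trT (f * h).
Proof.
exists (\sum_L phi (bigb bv L) *: bigb b L) => f.
rewrite {1}(tens_expand_bv f) linear_sum mulr_sumr linear_sum.
apply: eq_bigr => L _ /=.
by rewrite linearZ /= -pzscalerAr linearZ /= mulrC.
Qed.

(** The element t_(i,j) of the wreath relations, over any T with n copies of F. *)
Definition casimir (i j : 'I_n) : T := \sum_(l < r) at_ i (b l) * at_ j (bv l).
Local Notation t := casimir.

Lemma perm_casimir s (i j : 'I_n) : perm s (t i j) = t (s i) (s j).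
Proof.
rewrite /casimir (big_morph _ (permD s) (perm0 s)).
by apply: eq_bigr => l _; rewrite permM !perm_at.
Qed.

(** Expanding b_l f in the basis b on the left and f bv_l in the basis bv on the
    right gives the same sum, with coefficients tr(bv_m b_l f). *)
Lemma casimir_move (i j : 'I_n) f : i != j -> t i j * at_ i f = at_ j f * t i j.
Proof.
move=> ij; rewrite mulr_suml mulr_sumr.
pose c l m := tr (bv m * b l * f) *: (at_ i (b m) * at_ j (bv l)).
transitivity (\sum_l \sum_m c l m).
  apply: eq_bigr => l _; rewrite -mulrA -atC // mulrA -atM.
  rewrite (expand_b (b l * f)) linear_sum mulr_suml; apply: eq_bigr => m _.
  by rewrite linearZ /= -pzscalerAl mulrA.
rewrite exchange_big; apply: eq_bigr => l _.
rewrite mulrA -atC // -mulrA -atM.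
rewrite (expand_bv (f * bv l)) linear_sum mulr_sumr; apply: eq_bigr => m _.
by rewrite linearZ /= -pzscalerAr /c -mulrA [in LHS]trC [in RHS]trC -!mulrA.
Qed.

(** Both sides are the sum of tr(bv_m bv_l) (b_l)_i (b_m)_j, whose coefficients
    are symmetric in l and m because tr is. *)
Lemma casimirC (i j : 'I_n) : i != j -> t i j = t j i.
Proof.
move=> ij; transitivity (\sum_l \sum_m tr (bv m * bv l) *: (at_ i (b l) * at_ j (b m))).
  apply: eq_bigr => l _; rewrite {1}(expand_b (bv l)) linear_sum mulr_sumr.
  by apply: eq_bigr => m _; rewrite linearZ /= -pzscalerAr.
rewrite exchange_big; apply: eq_bigr => l _.
rewrite atC 1?eq_sym // [in RHS](expand_b (bv l)) linear_sum mulr_suml.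
by apply: eq_bigr => m _; rewrite linearZ /= -pzscalerAl trC.
Qed.

(** Multiplication by t_(i,j) exchanges the factors i and j: this is
    [casimir_move] for these two factors, and the other factors commute with
    both. *)
Lemma casimir_comm (i j : 'I_n) x : i != j -> t i j * x = perm (tperm i j) x * t i j.
Proof.
move=> ij; have atE l f : t i j * at_ l f = perm (tperm i j) (at_ l f) * t i j.
  rewrite perm_at; case: tpermP => [->|->|/eqP li /eqP lj].
  - exact: casimir_move.
  - by rewrite casimirC // casimir_move // eq_sym.
  rewrite mulr_suml mulr_sumr; apply: eq_bigr => m _.
  by rewrite -mulrA -(atC _ _ lj) mulrA -(atC _ _ li) !mulrA.
move: x (T_span x); apply: lspan_ind_lin => [|a x y IHx IHy|_ [u ->]].
- by rewrite perm0 mulr0 mul0r.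
- by rewrite permP mulrDr mulrDl -pzscalerAr -pzscalerAl IHx IHy.
elim: (index_enum _) => [|l s IH]; first by rewrite big_nil perm_one mulr1 mul1r.
by rewrite big_cons mulrA atE -mulrA IH mulrA permM.
Qed.

End TensorDuality.

(** * Commutation of sums of operators *)

Section SumCommute.
Variables (k : comNzRingType) (V : lmodType k) (n : nat).
Variables (A : 'I_n -> {linear V -> V}) (S : 'I_n -> 'I_n -> {linear V -> V}).
Hypothesis AA : forall i j u, A i (A j u) = A j (A i u).
Hypothesis Sii : forall i u, S i i u = 0.
Hypothesis AS : forall i j l u, i != j -> i != l -> A i (S j l u) = S j l (A i u).
Hypothesis AS2 : forall i j u, i != j ->
  A i (S j i u) + S i j (A j u) = S j i (A i u) + A j (S i j u).
Hypothesis SS0 : forall i j u, i != j -> S i j (S j i u) = 0.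
Hypothesis SS4 : forall i j l m u, uniq [:: i; j; l; m] ->
  S i l (S j m u) = S j m (S i l u).
Hypothesis SS3 : forall i j l u, uniq [:: i; j; l] ->
  S i l (S j l u) + S i j (S j l u) + S i l (S j i u) =
  S j l (S i l u) + S j l (S i j u) + S j i (S i l u).

(** The commutator of A i + \sum_l S i l and A j + \sum_m S j m is sorted by the
    indices that occur: only i and j (hypotheses AA, AS2, SS0), one further index
    (AS, and SS3, which has the shape of a classical Yang-Baxter equation), or two
    further indices (SS4).  Each group vanishes separately. *)
Lemma sum_operators_comm i j u :
  A i (A j u + \sum_l S j l u) + \sum_l S i l (A j u + \sum_m S j m u) =
  A j (A i u + \sum_l S i l u) + \sum_l S j l (A i u + \sum_m S i m u).
Proof.
have [->//|ij] := eqVneq i j; have ji : j != i by rewrite eq_sym.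
pose cm (f g : V -> V) := f (g u) - g (f u).
have split_i (f : 'I_n -> V) :
    \sum_l f l = f i + f j + \sum_(l | (l != i) && (l != j)) f l.
  by rewrite (bigD1 i) //= (bigD1 j) //= addrA.
apply/eqP; rewrite -subr_eq0; apply/eqP.
have -> : A i (A j u + \sum_l S j l u) + \sum_l S i l (A j u + \sum_m S j m u) -
    (A j (A i u + \sum_l S i l u) + \sum_l S j l (A i u + \sum_m S i m u)) =
  cm (A i) (A j) + (\sum_l cm (A i) (S j l) + \sum_l cm (S i l) (A j)) +
    \sum_l \sum_m cm (S i l) (S j m).
  have -> : \sum_l S i l (A j u + \sum_m S j m u) =
      \sum_l S i l (A j u) + \sum_l \sum_m S i l (S j m u).
    by rewrite -big_split; apply: eq_bigr => l _ /=; rewrite linearD linear_sum.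
  have -> : \sum_l S j l (A i u + \sum_m S i m u) =
      \sum_l S j l (A i u) + \sum_l \sum_m S j m (S i l u).
    rewrite exchange_big -big_split; apply: eq_bigr => l _ /=.
    by rewrite linearD linear_sum.
  have -> : \sum_l cm (A i) (S j l) = \sum_l A i (S j l u) - \sum_l S j l (A i u).
    by rewrite -sumrB.
  have -> : \sum_l cm (S i l) (A j) = \sum_l S i l (A j u) - \sum_l A j (S i l u).
    by rewrite -sumrB.
  have -> : \sum_l \sum_m cm (S i l) (S j m) =
      \sum_l \sum_m S i l (S j m u) - \sum_l \sum_m S j m (S i l u).
    by rewrite -sumrB; apply: eq_bigr => l _; rewrite -sumrB.
  rewrite !linearD !linear_sum /= /cm !addrA.
  by rewrite [LHS](ACl (1*5*2*7*3*6*4*8)).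
have -> : cm (A i) (A j) = 0 by rewrite /cm AA subrr.
have -> : \sum_l cm (A i) (S j l) = cm (A i) (S j i).
  rewrite split_i {2}/cm !Sii linear0 subrr addr0 big1 ?addr0 // => l.
  by case/andP=> li lj; rewrite /cm AS // ?subrr // eq_sym.
have -> : \sum_l cm (S i l) (A j) = cm (S i j) (A j).
  rewrite split_i {1}/cm !Sii linear0 subrr add0r big1 ?addr0 // => l.
  by case/andP=> li lj; rewrite /cm AS // ?subrr // eq_sym.
have -> : cm (A i) (S j i) + cm (S i j) (A j) = 0.
  by rewrite /cm addrACA -opprD AS2 // subrr.
rewrite !add0r split_i [X in X + _ + _]big1 ?add0r => [|l _]; last first.
  by rewrite /cm !Sii linear0 subrr.
have -> : \sum_m cm (S i j) (S j m) =
    \sum_(m | (m != i) && (m != j)) cm (S i j) (S j m).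
  by rewrite split_i /cm !Sii !linear0 !SS0 // !subrr !add0r.
rewrite -big_split big1 // => l /andP[li lj].
have -> : \sum_m cm (S i l) (S j m) = cm (S i l) (S j i) + cm (S i l) (S j l).
  have cm0 : cm (S i l) (S j j) = 0 by rewrite /cm !Sii linear0 subrr.
  rewrite split_i cm0 addr0; congr (_ + _).
  rewrite (bigD1 l) ?li //= big1 ?addr0 // => m /andP[/andP[mi mj] ml].
  rewrite /cm SS4 ?subrr //= !inE !negb_or ij (eq_sym i l) li (eq_sym i m) mi.
  by rewrite (eq_sym j l) lj (eq_sym j m) mj (eq_sym l m) ml.
rewrite /= /cm; have := @SS3 i j l u.
rewrite /= !inE !negb_or ij (eq_sym i l) li (eq_sym j l) lj => /(_ isT) E.
rewrite !addrA; apply/eqP.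
rewrite -[X in _ == X](subrr (S j l (S i l u) + S j l (S i j u) + S j i (S i l u))).
rewrite -{1}E !opprD !addrA; apply/eqP.
by rewrite [LHS](ACl (5*1*3*6*2*4)).
Qed.

End SumCommute.

(** * Colour words *)

Section Words.
Variable n : nat.
Implicit Types (w : {ffun 'I_n -> nat}) (s p : 'S_n).

(** Words carry the right action of permutations by precomposition; with the
    product of permutations read from left to right this gives [wcomp_comp]. *)
Definition wcomp w s : {ffun 'I_n -> nat} := [ffun i => w (s i)].
Definition winc (i : 'I_n) w : {ffun 'I_n -> nat} := [ffun j => (w j + (j == i))%N].

Lemma wcomp_comp w s p : wcomp (wcomp w s) p = wcomp w (p * s)%g.
Proof. by apply/ffunP => i; rewrite !ffunE permM. Qed.

Lemma wcomp1 w : wcomp w 1%g = w.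
Proof. by apply/ffunP => i; rewrite !ffunE perm1. Qed.

Lemma wcomp_inc w i s : wcomp (winc i w) s = winc ((s^-1)%g i) (wcomp w s).
Proof.
apply/ffunP => j; rewrite !ffunE; congr (_ + _)%N.
by rewrite -(inj_eq (@perm_inj _ s) j) permKV.
Qed.

Lemma wincC i j w : winc i (winc j w) = winc j (winc i w).
Proof. by apply/ffunP => l; rewrite !ffunE addnAC. Qed.

(** The two relations between transpositions on which the commutation of the
    operators x_i rests. *)
Lemma tperm3 (T : finType) (i j l : T) : uniq [:: i; j; l] ->
  (tperm i j * tperm j l = tperm j l * tperm i l)%g.
Proof.
rewrite /= !inE negb_or => /andP[/andP[ij il] /andP[jl _]].
apply/permP => x; rewrite !permM.
do !case: tpermP => //; try by move=> *; subst; rewrite eqxx in ij il jl.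
all: by move=> *; congruence.
Qed.

Lemma tperm4 (T : finType) (i j l m : T) : uniq [:: i; j; l; m] ->
  (tperm i l * tperm j m = tperm j m * tperm i l)%g.
Proof.
rewrite /= !inE !negb_or => /and4P[/and3P[ij il im] /andP[jl jm] lm _].
apply/permP => x; rewrite !permM.
do !case: tpermP => //; try by move=> *; subst; rewrite ?eqxx in ij il im jl jm lm.
all: by move=> *; congruence.
Qed.

End Words.

Prenex Implicits winc.

Section WordSize.
Variable n : nat.
Implicit Types (w : {ffun 'I_n -> nat}).

Definition wsize w := (\sum_i w i)%N.
Definition wcst a : {ffun 'I_n -> nat} := [ffun=> a].
Definition wcount (xs : seq 'I_n) : {ffun 'I_n -> nat} := [ffun i => count_mem i xs].

Lemma wsize_inc i w : wsize (winc i w) = (wsize w).+1.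
Proof.
rewrite /wsize (bigD1 i) //= [in RHS](bigD1 i) //= ffunE eqxx addn1 addSn.
congr (_ + _).+1; apply: eq_bigr => j /negbTE ji.
by rewrite ffunE ji addn0.
Qed.

Lemma wsize_comp w s : wsize (wcomp w s) = wsize w.
Proof.
rewrite /wsize [RHS](reindex_inj (@perm_inj _ s)) /=.
by apply: eq_bigr => i _; rewrite ffunE.
Qed.

Lemma wsize_cst a : wsize (wcst a) = (n * a)%N.
Proof.
rewrite /wsize (eq_bigr (fun=> a)) => [|i _]; last by rewrite ffunE.
by rewrite sum_nat_const card_ord.
Qed.

Lemma wcomp_cst a s : wcomp (wcst a) s = wcst a.
Proof. by apply/ffunP => i; rewrite !ffunE. Qed.

Lemma wcomp_eq_cst w a s : (wcomp w s == wcst a) = (w == wcst a).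
Proof.
apply/eqP/eqP => [e|->]; last exact: wcomp_cst.
by rewrite -[w]wcomp1 -(mulVg s) -wcomp_comp e wcomp_cst.
Qed.

Lemma foldr_winc xs : foldr winc (wcst 0) xs = wcount xs.
Proof.
elim: xs => [|i xs IH]; apply/ffunP => j /=; first by rewrite !ffunE.
by rewrite IH !ffunE addnC eq_sym.
Qed.

Lemma wsize_foldr xs w : wsize (foldr winc w xs) = (size xs + wsize w)%N.
Proof. by elim: xs => //= i xs IH; rewrite wsize_inc IH. Qed.

Lemma wsize_count xs : wsize (wcount xs) = size xs.
Proof. by rewrite -foldr_winc wsize_foldr wsize_cst muln0 addn0. Qed.

End WordSize.

(** * Modules over a free algebra *)

Section FreeAction.
Variables (k : comNzRingType) (I : choiceType).
Local Notation A := (free_alg k I).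
Local Notation gen := (@free_gen k I).

Lemma free_mon_cons x (s : seq I) :
  << FMonom (x :: s) >> = gen x * << FMonom s >> :> A.
Proof.
rewrite /free_gen [RHS]malgM_def fgmulUU mulr1.
by congr << _ >>; apply/eqP; rewrite fmP fmM fmuE.
Qed.

Lemma free_ind (P : A -> Prop) : P 0 ->
  (forall a x y, P x -> P y -> P (a *: x + y)) -> P 1 ->
  (forall i y, P y -> P (gen i * y)) -> forall y, P y.
Proof.
move=> P0 PD P1 Pg y; move: (malg_span y); move: y.
apply: lspan_ind_lin => // _ [[s] ->]; elim: s => [|x s IH].
  by rewrite (_ : << _ >> = 1 :> A) // /1%R /=; congr << _ >>; apply/eqP; rewrite fmP fm1.
by rewrite free_mon_cons; apply: Pg.
Qed.

Variables (V : lmodType k) (op : I -> {linear V -> V}).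

(** An algebra freely generated by I acts through any choice of operators: a
    monomial acts by composing the operators of its letters. *)
Definition free_act (g : A) (v : V) : V :=
  malg_ext (fun m : {fmonom I} => foldr (fun x => op x) v m) g.

Lemma free_actP a g h v : free_act (a *: g + h) v = a *: free_act g v + free_act h v.
Proof. exact: malg_extP. Qed.

Lemma free_act0 v : free_act 0 v = 0.
Proof. exact: malg_ext0. Qed.

Lemma free_act1 v : free_act 1 v = v.
Proof. by rewrite /free_act malg_extU fm1. Qed.

Lemma free_act_genM x g v : free_act (gen x * g) v = op x (free_act g v).
Proof.
move: (malg_span g); move: g; apply: lspan_ind_lin => [|a g h IHg IHh|_ [[s] ->]].
- by rewrite mulr0 free_act0 linear0.
- by rewrite mulrDr -pzscalerAr !free_actP linearP; congr (_ *: _ + _).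
by rewrite -free_mon_cons /free_act !malg_extU.
Qed.

Lemma free_act_gen x v : free_act (gen x) v = op x v.
Proof. by rewrite -[gen x]mulr1 free_act_genM free_act1. Qed.

Lemma free_actM g h v : free_act (g * h) v = free_act g (free_act h v).
Proof.
move: g; apply: free_ind => [|a x y IHx IHy||i y IH].
- by rewrite mul0r !free_act0.
- by rewrite mulrDl -pzscalerAl !free_actP; congr (_ *: _ + _).
- by rewrite mul1r free_act1.
rewrite -(mulrA (gen i) y h).
exact: etrans (free_act_genM i (y * h) v)
  (etrans (congr1 (op i) IH) (esym (free_act_genM i y _))).
Qed.

End FreeAction.

(** * Spanning by reduced monomials and duality of the trace *)

(** The relations between variables and permutations are only given for adjacent
    transpositions; this transports consequences to every permutation. *)
Lemma perm_adjacent_ind n (P : 'S_n -> Prop) :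
  P 1%g -> (forall s p, P s -> P p -> P (s * p)%g) ->
  (forall i i' : 'I_n, i' = i.+1 :> nat -> P (tperm i i')) -> forall s, P s.
Proof.
move=> P1 PM Padj.
have Plt m (i j : 'I_n) : j = (i + m).+1 :> nat -> P (tperm i j).
  elim: m j => [|m IH] j ej; first by apply: Padj; rewrite ej addn0.
  have jn : ((i + m).+1 < n)%N by have := ltn_ord j; lia.
  pose j' := Ordinal jn.
  have -> : tperm i j = (tperm j' j * tperm i j' * tperm j' j)%g.
    rewrite -{1}(tpermV j' j) -mulgA -conjgE tpermJ tpermL tpermD //.
      by apply/eqP => /(congr1 val) /=; lia.
    by apply/eqP => /(congr1 val) /=; lia.
  have Pj : P (tperm j' j) by apply: Padj; rewrite ej /= addnS.
  by apply: (PM) => //; apply: (PM) => //; apply: IH.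
have Pt (i j : 'I_n) : P (tperm i j).
  case: (ltngtP i j) => [ij|ji|/val_inj ->]; last by rewrite tperm1.
    by apply: (Plt (j - i.+1)%N); lia.
  by rewrite tpermC; apply: (Plt (i - j.+1)%N); lia.
move=> s; have [ts -> _] := prod_tpermP s.
by elim/big_rec: _ => // ij x _ Px; apply: PM.
Qed.

(** Q stands for any algebra generated by images X, Fm, Sm of the variables, of T
    and of the permutations, subject to the wreath relations. *)
Section Spanning.
Variables (k : comNzRingType) (T Q : pzAlgType k) (n : nat).
Variables (act : 'S_n -> T -> T) (t : 'I_n -> 'I_n -> T).
Variables (X : 'I_n -> Q) (Fm : T -> Q) (Sm : 'S_n -> Q).
Hypothesis XX : forall i j, X i * X j = X j * X i.
Hypothesis FmP : forall a f g, Fm (a *: f + g) = a *: Fm f + Fm g.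
Hypothesis FmM : forall f g, Fm (f * g) = Fm f * Fm g.
Hypothesis Fm1 : Fm 1 = 1.
Hypothesis SmM : forall s p, Sm (p * s)%g = Sm s * Sm p.
Hypothesis Sm1 : Sm 1%g = 1.
Hypothesis FmX : forall f i, Fm f * X i = X i * Fm f.
Hypothesis SmX_far : forall i i' j : 'I_n, i' = i.+1 :> nat -> j != i -> j != i' ->
  Sm (tperm i i') * X j = X j * Sm (tperm i i').
Hypothesis SmX : forall i i' : 'I_n, i' = i.+1 :> nat ->
  Sm (tperm i i') * X i = X i' * Sm (tperm i i') - Fm (t i i').
Hypothesis SmF : forall s f, Sm s * Fm f = Fm (act s f) * Sm s.
Hypothesis Q_gen : forall P : Q -> Prop, P 0 ->
  (forall a x y, P x -> P y -> P (a *: x + y)) -> P 1 ->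
  (forall i y, P y -> P (X i * y)) -> (forall f y, P y -> P (Fm f * y)) ->
  (forall s y, P y -> P (Sm s * y)) -> forall y, P y.

Let Fm0 : Fm 0 = 0.
Proof. by have := FmP (-1) 0 0; rewrite !scaler0 addr0 scaleN1r addNr. Qed.

(** The part without variables: the image of the wreath product of T and S_n. *)
Definition gspan := lspan (fun y => exists f s, y = Fm f * Sm s).

Lemma gspan_gen f s : gspan (Fm f * Sm s).
Proof. by apply: lspan_gen; exists f, s. Qed.

Lemma gspan_F f y : gspan y -> gspan (Fm f * y).
Proof.
move: y; apply: lspan_ind_lin => [|a x y Hx Hy|_ [g [s ->]]].
- by rewrite mulr0; apply: lspan0.
- by rewrite mulrDr -pzscalerAr; apply/lspanD/Hy/lspanZ.
by rewrite mulrA -FmM; apply: gspan_gen.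
Qed.

Lemma gspan_S s y : gspan y -> gspan (Sm s * y).
Proof.
move: y; apply: lspan_ind_lin => [|a x y Hx Hy|_ [g [p ->]]].
- by rewrite mulr0; apply: lspan0.
- by rewrite mulrDr -pzscalerAr; apply/lspanD/Hy/lspanZ.
by rewrite mulrA SmF -mulrA -SmM; apply: gspan_gen.
Qed.

Lemma gspan_mulS s y : gspan y -> gspan (y * Sm s).
Proof.
move: y; apply: lspan_ind_lin => [|a x y Hx Hy|_ [g [p ->]]].
- by rewrite mul0r; apply: lspan0.
- by rewrite mulrDl -pzscalerAl; apply/lspanD/Hy/lspanZ.
by rewrite -mulrA -SmM; apply: gspan_gen.
Qed.

Lemma gspan_Fm f : gspan (Fm f).
Proof. by rewrite -[Fm f]mulr1 -Sm1; apply: gspan_gen. Qed.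

(** Modulo terms without variables, a permutation moves past a variable by
    renumbering it.  The property passes to products of permutations, and for an
    adjacent transposition it follows from the defining relations. *)
Lemma X_S s i : gspan (X i * Sm s - Sm s * X (s^-1 i)%g).
Proof.
move: s i; apply: perm_adjacent_ind => [|s p IHs IHp|j j' jj'] i.
- by rewrite invg1 perm1 Sm1 mul1r mulr1 subrr; apply: lspan0.
- rewrite SmM invMg permM.
  have -> : X i * (Sm p * Sm s) - Sm p * Sm s * X (s^-1 (p^-1 i))%g =
    (X i * Sm p - Sm p * X (p^-1 i)%g) * Sm s +
    Sm p * (X (p^-1 i)%g * Sm s - Sm s * X (s^-1 (p^-1 i))%g).
    by rewrite mulrBl mulrBr !mulrA addrA subrK.
  by apply: lspanD; [apply: gspan_mulS | apply: gspan_S].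
rewrite tpermV; case: tpermP => [->|->|/eqP ij /eqP ij'].
- have SS : Sm (tperm j j') * Sm (tperm j j') = 1 by rewrite -SmM tperm2 Sm1.
  have -> : X j * Sm (tperm j j') - Sm (tperm j j') * X j' =
      - (Sm (tperm j j') * Fm (t j j') * Sm (tperm j j')).
    have -> : Fm (t j j') = X j' * Sm (tperm j j') - Sm (tperm j j') * X j.
      by rewrite SmX // opprB addrC subrK.
    by rewrite mulrBr mulrBl mulrA -!mulrA SS mulr1 mulrA SS mul1r opprB.
  by rewrite -scaleN1r; apply/lspanZ/gspan_mulS/gspan_S/gspan_Fm.
- by rewrite SmX // opprB addrC subrK; apply: gspan_Fm.
by rewrite SmX_far // subrr; apply: lspan0.
Qed.

Definition Xs (xs : seq 'I_n) : Q := \prod_(i <- xs) X i.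

Lemma Xs_cat xs ys : Xs (xs ++ ys) = Xs xs * Xs ys.
Proof. by rewrite /Xs big_cat. Qed.

Lemma Xs_rem i xs : i \in xs -> Xs xs = X i * Xs (rem i xs).
Proof.
elim: xs => //= j xs IH; rewrite inE /Xs big_cons; case: eqVneq => [->//|ij] /= ixs.
by rewrite big_cons -/(Xs _) -/(Xs (rem _ _)) IH // !mulrA XX.
Qed.

Lemma Xs_perm xs ys : perm_eq xs ys -> Xs xs = Xs ys.
Proof.
elim: xs ys => [|i xs IH] ys; first by rewrite perm_sym => /perm_nilP ->.
move=> pxy; have iys : i \in ys by rewrite -(perm_mem pxy) mem_head.
rewrite (Xs_rem iys) {1}/Xs big_cons -/(Xs _) (IH (rem i ys)) //.
by rewrite -(perm_cons i) (perm_trans pxy) // perm_to_rem.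
Qed.

(** The filtration by the number of variables.  The strict inequality makes
    [fil 0] the zero submodule, and a monomial in d variables is reducible when it
    belongs to [fil d]. *)
Definition fil N := lspan (fun y => exists f s xs,
  (size xs < N)%N /\ y = Fm f * Sm s * Xs xs).

Lemma fil_mono N M y : (N <= M)%N -> fil N y -> fil M y.
Proof.
move=> NM; apply: lspan_sub => _ [f [s [xs [sz ->]]]]; apply: lspan_gen.
by exists f, s, xs; rewrite (leq_trans sz).
Qed.

Lemma fil_ind_lin N (P : Q -> Prop) : P 0 ->
  (forall a x y, P x -> P y -> P (a *: x + y)) ->
  (forall f s xs, (size xs < N)%N -> P (Fm f * Sm s * Xs xs)) ->
  forall y, fil N y -> P y.
Proof.
move=> P0 PD PS; apply: lspan_ind_lin => // _ [f [s [xs [sz ->]]]]; exact: PS.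
Qed.

Lemma gspan_Xs N g xs : gspan g -> (size xs < N)%N -> fil N (g * Xs xs).
Proof.
move=> Hg sz; move: g Hg; apply: lspan_ind_lin => [|a x y Hx Hy|_ [f [s ->]]].
- by rewrite mul0r; apply: lspan0.
- by rewrite mulrDl -pzscalerAl; apply/lspanD/Hy/lspanZ.
by apply: lspan_gen; exists f, s, xs.
Qed.

Lemma fil_F N f y : fil N y -> fil N (Fm f * y).
Proof.
move: y; apply: fil_ind_lin => [|a x y Hx Hy|g s xs sz].
- by rewrite mulr0; apply: lspan0.
- by rewrite mulrDr -pzscalerAr; apply/lspanD/Hy/lspanZ.
by rewrite mulrA; apply: gspan_Xs sz; apply/gspan_F/gspan_gen.
Qed.

Lemma fil_S N s y : fil N y -> fil N (Sm s * y).
Proof.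
move: y; apply: fil_ind_lin => [|a x y Hx Hy|g p xs sz].
- by rewrite mulr0; apply: lspan0.
- by rewrite mulrDr -pzscalerAr; apply/lspanD/Hy/lspanZ.
by rewrite mulrA; apply: gspan_Xs sz; apply/gspan_S/gspan_gen.
Qed.

Lemma fil_X N i y : fil N y -> fil N.+1 (X i * y).
Proof.
move: y; apply: fil_ind_lin => [|a x y Hx Hy|f s xs sz].
- by rewrite mulr0; apply: lspan0.
- by rewrite mulrDr -pzscalerAr; apply/lspanD/Hy/lspanZ.
have -> : X i * (Fm f * Sm s * Xs xs) =
    Fm f * (X i * Sm s - Sm s * X (s^-1 i)%g) * Xs xs +
    Fm f * Sm s * Xs ((s^-1 i)%g :: xs).
  rewrite /Xs big_cons mulrBr mulrBl !mulrA -FmX; set z := _ * _ * X _.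
  by rewrite subrK.
apply: lspanD; last by apply: lspan_gen; exists f, s, ((s^-1 i)%g :: xs).
by apply: gspan_Xs (leqW sz); apply/gspan_F/X_S.
Qed.

Lemma fil_Xs N xs y : fil N y -> fil (size xs + N) (Xs xs * y).
Proof.
elim: xs => [|i xs IH] Hy; first by rewrite /Xs big_nil mul1r.
by rewrite /Xs big_cons -mulrA; apply/fil_X/IH.
Qed.

Lemma fil_mulr a b x y : fil a x -> fil b.+1 y -> fil (a + b) (x * y).
Proof.
move=> Hx Hy; move: x Hx; apply: fil_ind_lin => [|l x x' Hx Hx'|f s xs sz].
- by rewrite mul0r; apply: lspan0.
- by rewrite mulrDl -pzscalerAl; apply/lspanD/Hx'/lspanZ.
rewrite -!mulrA; apply/fil_F/fil_S; apply: (@fil_mono (size xs + b.+1)).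
  by rewrite addnS -addSn leq_add2r.
exact: fil_Xs.
Qed.

Lemma gspan_fil g : gspan g -> fil 1 g.
Proof. by move=> Hg; rewrite -[g]mulr1 -[1](big_nil 1 *%R xpredT X); apply: gspan_Xs. Qed.

Lemma fil_1 N : fil N.+1 1.
Proof. by apply: (@fil_mono 1) => //; apply: gspan_fil; rewrite -Fm1; apply: gspan_Fm. Qed.

Lemma fil_Xn N i m : (m < N)%N -> fil N (X i ^+ m).
Proof.
move=> mN; rewrite -[X i ^+ m]mulr1; have -> : X i ^+ m = Xs (nseq m i).
  by rewrite /Xs big_nseq -Monoid.iteropE.
by apply: fil_mono (fil_Xs _ (fil_1 0)); rewrite size_nseq addn1.
Qed.

Lemma fil_exhaust y : exists N, fil N y.
Proof.
move: y; apply: Q_gen => [|a x y [N Hx] [M Hy]||i y [N Hy]|f y [N Hy]|s y [N Hy]].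
- by exists 0; apply: lspan0.
- exists (maxn N M); apply/lspanD/(fil_mono (leq_maxr N M))/Hy/lspanZ.
  exact: fil_mono (leq_maxl N M) Hx.
- by exists 1%N; apply: fil_1.
- by exists N.+1; apply: fil_X.
- by exists N; apply: fil_F.
by exists N; apply: fil_S.
Qed.

Variables (i0 : 'I_n) (d : nat) (c : 'I_d -> T).
Hypothesis cyc : \prod_(j < d) (X i0 - Fm (c j)) = 0.

Lemma fil_cyc (s : seq 'I_d) :
  fil (size s) (\prod_(j <- s) (X i0 - Fm (c j)) - X i0 ^+ size s).
Proof.
elim: s => [|j s IH] /=; first by rewrite big_nil expr0 subrr; apply: lspan0.
rewrite big_cons exprS; set P := \big[_/_]_(_ <- _) _ in IH *.
have -> : (X i0 - Fm (c j)) * P - X i0 * X i0 ^+ size s =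
    X i0 * (P - X i0 ^+ size s) - Fm (c j) * P.
  by rewrite mulrBl mulrBr addrAC.
apply: lspanB; first exact: fil_X.
apply: fil_F; rewrite -(subrK (X i0 ^+ size s) P).
by apply: lspanD; [apply: fil_mono IH | apply: fil_Xn].
Qed.

(** The cyclotomic relation, solved for its leading term x_1^d. *)
Lemma fil_Xd_first : fil d (X i0 ^+ d).
Proof.
have := fil_cyc (index_enum 'I_d); rewrite cyc sub0r.
have -> : size (index_enum 'I_d) = d by rewrite [index_enum _]unlock -enumT size_enum_ord.
by move=> H; rewrite -[X i0 ^+ d]opprK -scaleN1r; apply: lspanZ.
Qed.

(** x_i differs from the conjugate of x_1 by a transposition only by a term
    without variables, so the d-th power of x_i inherits the reduction of
    x_1^d. *)
Lemma fil_Xd i : fil d (X i ^+ d).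
Proof.
pose s := tperm i0 i; pose y := Sm s * X i0 * Sm s.
have SS : Sm s * Sm s = 1 by rewrite -SmM tperm2 Sm1.
have Xy : fil 1 (X i - y).
  apply: gspan_fil; rewrite -[X i]mulr1 -SS mulrA -mulrBl; apply: gspan_mulS.
  by have := X_S s i; rewrite tpermV tpermR.
have yE m : y ^+ m = Sm s * X i0 ^+ m * Sm s.
  elim: m => [|m IH]; first by rewrite !expr0 mulr1 SS.
  by rewrite exprSr IH /y exprSr -!mulrA (mulrA (Sm s) (Sm s)) SS mul1r.
have fil_S1 p : fil 1 (Sm p).
  by apply: gspan_fil; rewrite -[Sm p]mul1r -Fm1; apply: gspan_gen.
have fil_y N m : fil N (X i0 ^+ m) -> fil N (y ^+ m).
  move=> H; rewrite yE -mulrA; apply: fil_S.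
  by rewrite -(addn0 N); apply: fil_mulr.
have dif m : fil m (X i ^+ m - y ^+ m).
  elim: m => [|m IH]; first by rewrite !expr0 subrr; apply: lspan0.
  have -> : X i ^+ m.+1 - y ^+ m.+1 = X i * (X i ^+ m - y ^+ m) + (X i - y) * y ^+ m.
    by rewrite mulrBr mulrBl -!exprS addrA subrK.
  apply: lspanD; first exact: fil_X.
  by rewrite -addn1 addnC; apply: fil_mulr => //; apply/fil_y/fil_Xn.
rewrite -(subrK (y ^+ d) (X i ^+ d)); apply: lspanD; first exact: dif.
exact/fil_y/fil_Xd_first.
Qed.

Definition reduced := lspan (fun y => exists f s xs,
  (forall i, (count_mem i xs < d)%N) /\ y = Fm f * Sm s * Xs xs).

(** Induction on the number of variables: if some x_i occurs d times, the
    variables commute, so x_i^d can be collected on the right and replaced by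
    terms with fewer variables. *)
Lemma fil_reduced N y : fil N y -> reduced y.
Proof.
elim: N y => [|N IH] y.
  by move: y; apply: fil_ind_lin => [|a x y Hx Hy|//]; [apply: lspan0|apply/lspanD/Hy/lspanZ].
move: y; apply: fil_ind_lin => [|a x y Hx Hy|f s xs sz]; first exact: lspan0.
  exact/lspanD/Hy/lspanZ.
have [/forallP lt_d|] := boolP [forall i, count_mem i xs < d]%N.
  by apply: lspan_gen; exists f, s, xs.
rewrite negb_forall => /existsP[i]; rewrite -leqNgt => cd.
apply: IH; pose ys := [seq x <- xs | x != i] ++ nseq (count_mem i xs - d) i.
have pxs : perm_eq xs (ys ++ nseq d i).
  rewrite -catA -nseqD subnK // perm_sym perm_catC.
  rewrite (_ : nseq _ i = filter (pred1 i) xs) ?perm_filterC //.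
  have := all_pred1P i (filter (pred1 i) xs); rewrite size_filter.
  by move/elimT => ->//; apply: filter_all.
have sz' : (size ys + d <= N)%N.
  by move: (perm_size pxs) sz; rewrite size_cat size_nseq => ->.
rewrite (Xs_perm pxs) Xs_cat -!mulrA; apply: (fil_mono sz').
apply/fil_F/fil_S/fil_Xs.
by have := fil_Xd i; rewrite /Xs big_nseq -Monoid.iteropE.
Qed.

(** A list of indices with prescribed multiplicities, so that [Xs (word w)] is
    the monomial x^w. *)
Definition word (w : {ffun 'I_n -> nat}) : seq 'I_n :=
  flatten [seq nseq (w i) i | i <- enum 'I_n].

Lemma wcount_word w : wcount (word w) = w.
Proof.
apply/ffunP => i; rewrite ffunE /word.
have : uniq (enum 'I_n) by exact: enum_uniq.
have -> : w i = if i \in enum 'I_n then w i else 0%N by rewrite mem_enum.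
elim: (enum 'I_n) => //= j s IH /andP[js us].
rewrite count_cat IH // count_nseq inE /=.
have [->|ij] := eqVneq i j; first by rewrite mem_head (negbTE js) mul1n addn0.
by rewrite in_cons (negbTE ij) mul0n.
Qed.

Lemma Xs_count xs ys : wcount xs = wcount ys -> Xs xs = Xs ys.
Proof.
move=> e; apply: Xs_perm; apply/allP => i _ /=.
by have := congr1 (fun w : {ffun 'I_n -> nat} => w i) e; rewrite !ffunE => ->.
Qed.

Local Notation wrd := {ffun 'I_n -> 'I_d}.
Definition wval (be : wrd) : {ffun 'I_n -> nat} := [ffun i => be i : nat].

Lemma expand_reduced y : exists C : wrd -> 'S_n -> T,
  y = \sum_be \sum_s Fm (C be s) * Sm s * Xs (word (wval be)).
Proof.
have [N /fil_reduced] := fil_exhaust y.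
move: y; apply: lspan_ind_lin => [|a x y [C ->] [D ->]|_ [f [s [xs [lt_d ->]]]]].
- by exists (fun _ _ => 0); rewrite big1 // => be _; rewrite big1 // => s _; rewrite Fm0 !mul0r.
- exists (fun be s => a *: C be s + D be s); rewrite scaler_sumr -big_split.
  apply: eq_bigr => be _ /=; rewrite scaler_sumr -big_split; apply: eq_bigr => s _ /=.
  by rewrite FmP !mulrDl -!pzscalerAl.
pose be0 : wrd := [ffun i => Ordinal (lt_d i)].
exists (fun be p => if (be == be0) && (p == s) then f else 0).
rewrite (bigD1 be0) //= (bigD1 s) //= !eqxx big1 => [|p /negbTE ->]; last by rewrite Fm0 !mul0r.
rewrite big1 => [|be /negbTE ->]; last by rewrite big1 // => p _; rewrite Fm0 !mul0r.
rewrite !addr0; congr (_ * _); apply: Xs_count; rewrite wcount_word.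
by apply/ffunP => i; rewrite !ffunE.
Qed.

Variables (trT : {scalar T}) (tau : {scalar Q}).
Hypothesis trC : forall x y, trT (x * y) = trT (y * x).
Hypothesis trT_nondeg : forall x, (forall y, trT (y * x) = 0) -> x = 0.
Hypothesis trT_repr : forall phi : T -> k, scalar phi ->
  exists h, forall f, phi f = trT (f * h).
Hypothesis tauC : forall x y, tau (x * y) = tau (y * x).
(* The Gram formula up to the degree n (d-1) of the longest reduced monomial; it
   is established for the module of coloured functions below. *)
Hypothesis gram : forall f s xs q h, (size xs <= n * d.-1)%N ->
  tau (Fm f * Sm s * Xs xs * Sm q * Fm h) =
  if (wcount xs == wcst n d.-1) && (q * s == 1)%g then trT (f * h) else 0.

Definition wcompl (w : {ffun 'I_n -> nat}) : {ffun 'I_n -> nat} := [ffun i => d.-1 - w i]%N.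

(** The partner of the monomial x^be has the complementary exponents d-1-be, so
    that the product reaches exactly the top exponent.  Among monomials with at
    most as many variables, only x^be reaches it ([gram_dual]): this is the
    triangularity of the Gram matrix. *)
Definition dualX (be : wrd) q h := Xs (word (wcompl (wval be))) * Sm q * Fm h.

Lemma size_word w : size (word w) = wsize w.
Proof. by rewrite -{2}(wcount_word w) wsize_count. Qed.

Lemma wsize_compl be : (wsize (wcompl (wval be)) + wsize (wval be) = n * d.-1)%N.
Proof.
rewrite -wsize_cst /wsize -big_split; apply: eq_bigr => i _ /=.
by rewrite !ffunE subnK // -ltnS (leq_trans (ltn_ord _)) // leqSpred.
Qed.

Lemma gram_dual f s be be' q h : (wsize (wval be) <= wsize (wval be'))%N ->
  tau (Fm f * Sm s * Xs (word (wval be)) * dualX be' q h) =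
  if (be == be') && (q * s == 1)%g then trT (f * h) else 0.
Proof.
move=> le; rewrite /dualX !mulrA -(mulrA (_ * _) (Xs _) (Xs _)) -Xs_cat gram; last first.
  by rewrite size_cat !size_word -(wsize_compl be') addnC leq_add2l.
congr (if _ && _ then _ else _); apply/eqP/eqP => [e|->].
  apply/ffunP => i; apply: val_inj => /=.
  have := congr1 (fun w : {ffun 'I_n -> nat} => w i) e.
  rewrite !ffunE count_cat.
  have cE w j : count_mem j (word w) = w j by rewrite -{2}(wcount_word w) ffunE.
  by rewrite !cE !ffunE; have := ltn_ord (be' i); have := ltn_ord (be i); lia.
apply/ffunP => i; rewrite !ffunE count_cat.
have cE w j : count_mem j (word w) = w j by rewrite -{2}(wcount_word w) ffunE.
by rewrite !cE !ffunE; have := ltn_ord (be' i); lia.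
Qed.

(** Induction on the number of variables, from the largest: once all coefficients
    with more variables vanish, pairing with [dualX] isolates the trace form of T
    on one coefficient. *)
Lemma tau_nondeg y : (forall g, tau (y * g) = 0) -> y = 0.
Proof.
have [C ->] := expand_reduced y => tau0.
suff C0 m be s : (n * d.-1 < wsize (wval be) + m)%N -> C be s = 0.
  rewrite big1 // => be _; rewrite big1 // => s _.
  by rewrite (C0 (n * d.-1).+1) ?Fm0 ?mul0r // addnS ltnS leq_addl.
elim: m be s => [|m IH] be s.
  by rewrite addn0 -(wsize_compl be) ltnNge leq_addl.
rewrite addnS ltnS leq_eqVlt => /orP[/eqP szbe|]; last exact: IH.
apply: trT_nondeg => h; rewrite trC -[RHS](tau0 (dualX be s^-1 h)) mulr_suml linear_sum.
rewrite (bigD1 be) //= [X in _ + X]big1 => [|be' ne]; last first.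
  rewrite mulr_suml linear_sum big1 // => p _.
  have [le|lt] := leqP (wsize (wval be')) (wsize (wval be)).
    by rewrite gram_dual // (negbTE ne).
  by rewrite IH ?Fm0 ?mul0r ?linear0 // szbe ltn_add2r.
rewrite addr0 mulr_suml linear_sum (bigD1 s) //= gram_dual // eqxx mulVg eqxx /=.
rewrite big1 ?addr0 // => p ps; rewrite gram_dual // eqxx /= -eq_mulVg1 eq_sym.
by rewrite (negbTE ps).
Qed.

(** Induction on the number of variables, from the smallest: an error at level N
    is corrected by combinations of [dualX] of that level, which leave the lower
    levels unchanged. *)
Lemma tau_repr (phi : {scalar Q}) : exists y, forall g, phi g = tau (g * y).
Proof.
pose e f s be := Fm f * Sm s * Xs (word (wval be)).
suff [y Hy] : exists y, forall be s f, (wsize (wval be) < (n * d.-1).+1)%N ->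
    phi (e f s be) = tau (e f s be * y).
  exists y => g; have [C ->] := expand_reduced g.
  rewrite mulr_suml !linear_sum; apply: eq_bigr => be _.
  rewrite mulr_suml !linear_sum; apply: eq_bigr => s _; apply: Hy.
  by rewrite ltnS -(wsize_compl be) leq_addl.
elim: (_.+1) => [|N [y Hy]]; first by exists 0.
have ex_h (bs : wrd * 'S_n) : exists h : T, forall f : T,
    phi (e f bs.2 bs.1) - tau (e f bs.2 bs.1 * y) = trT (f * h).
  case: bs => be s /=; apply: trT_repr => a f g /=.
  rewrite /e FmP !mulrDl -!pzscalerAl !linearP /=.
  by rewrite mulrBr opprD addrACA.
have [h Hh] := boolp.choice ex_h.
exists (y + \sum_(be | wsize (wval be) == N) \sum_s dualX be s^-1 (h (be, s))).
move=> be s f; rewrite ltnS leq_eqVlt mulrDr linearD mulr_sumr linear_sum.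
have sumE be' : wsize (wval be') == N -> (wsize (wval be) <= N)%N ->
   tau (e f s be * \sum_p dualX be' p^-1 (h (be', p))) =
   if be == be' then trT (f * h (be', s)) else 0.
  move=> /eqP szbe' szbe; rewrite mulr_sumr linear_sum (bigD1 s) //=.
  rewrite gram_dual ?szbe' // mulVg eqxx andbT big1 ?addr0 // => p ps.
  by rewrite gram_dual ?szbe' // -eq_mulVg1 (negbTE ps) andbF.
case/orP => [/eqP szbe|lt].
  rewrite (bigD1 be) ?szbe //= sumE ?szbe // eqxx big1 => [|be' /andP[szbe' ne]].
    by rewrite addr0 -(Hh (be, s)) /= addrC subrK.
  by rewrite sumE ?szbe // eq_sym (negbTE ne).
rewrite big1 ?addr0; first exact: Hy.
move=> be' szbe'; rewrite sumE // ?(ltnW lt) //; case: eqP => // ebe.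
by move: lt; rewrite ebe (eqP szbe') ltnn.
Qed.

End Spanning.

(** * Gradings detected by a homogeneous trace *)

Section GradedSymmetric.
Variables (k : comNzRingType) (F T Q : pzAlgType k) (n : nat).
Variables (at_ : 'I_n -> {linear F -> T}) (Fdeg : nat -> F -> Prop) (delta : nat).
Variables (X : 'I_n -> Q) (Fm : T -> Q) (Sm : 'S_n -> Q).
Hypothesis FmP : forall a f g, Fm (a *: f + g) = a *: Fm f + Fm g.
Hypothesis FmM : forall f g, Fm (f * g) = Fm f * Fm g.
Hypothesis Fm1 : Fm 1 = 1.
Hypothesis Q_gen : forall P : Q -> Prop, P 0 ->
  (forall a x y, P x -> P y -> P (a *: x + y)) -> P 1 ->
  (forall i y, P y -> P (X i * y)) -> (forall f y, P y -> P (Fm f * y)) ->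
  (forall s y, P y -> P (Sm s * y)) -> forall y, P y.
Hypothesis T_span : forall x : T,
  lspan (fun y => exists u : {ffun 'I_n -> F}, y = \prod_(i < n) at_ i (u i)) x.
Hypothesis F_graded : graded_algebra Fdeg.

(** Degrees are assigned to products of generators, since a quotient by an ideal
    offers no normal form on which to define them. *)
Inductive gen_monomial : nat -> Q -> Prop :=
| gen_mon1 : gen_monomial 0 1
| gen_monx i m y : gen_monomial m y -> gen_monomial (delta + m) (X i * y)
| gen_monF i f e m y : Fdeg e f -> gen_monomial m y ->
    gen_monomial (e + m) (Fm (at_ i f) * y)
| gen_monS s m y : gen_monomial m y -> gen_monomial m (Sm s * y).

Definition gen_deg m := lspan (gen_monomial m).
Let mon_span := lspan (fun y => exists m, gen_monomial m y).

Let Fm0 : Fm 0 = 0.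
Proof. by have := FmP (-1) 0 0; rewrite !scaler0 addr0 scaleN1r addNr. Qed.

Lemma mon_span_mul z : (forall m y, gen_monomial m y -> mon_span (z * y)) ->
  forall y, mon_span y -> mon_span (z * y).
Proof.
move=> Hz; apply: lspan_ind_lin => [|a x y Hx Hy|y [m my]].
- by rewrite mulr0; apply: lspan0.
- by rewrite mulrDr -pzscalerAr; apply/lspanD/Hy/lspanZ.
exact: Hz my.
Qed.

Lemma mon_span_at i f y : mon_span y -> mon_span (Fm (at_ i f) * y).
Proof.
move=> Hy; have [N [c [cdeg ->]]] := gr_decomp F_graded f.
rewrite linear_sum (big_morph Fm (id1 := 0) (op1 := +%R)) //; last first.
  by move=> u v; rewrite -[u]scale1r FmP !scale1r.
rewrite mulr_suml; apply: lspan_sum => e _; apply: mon_span_mul Hy => m z zm.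
by apply: lspan_gen; exists (e + m)%N; apply: gen_monF.
Qed.

Lemma mon_spanT y : mon_span y.
Proof.
move: y; apply: Q_gen => [|a x y Hx Hy||i y Hy|f y Hy|s y Hy].
- exact: lspan0.
- exact/lspanD/Hy/lspanZ.
- by apply: lspan_gen; exists 0%N; apply: gen_mon1.
- apply: mon_span_mul Hy => m z zm; apply: lspan_gen.
  by exists (delta + m)%N; apply: gen_monx.
- move: (T_span f); move: f; apply: lspan_ind_lin => [|a f g Hf Hg|_ [u ->]].
  + by rewrite Fm0 mul0r; apply: lspan0.
  + by rewrite FmP mulrDl -pzscalerAl; apply/lspanD/Hg/lspanZ.
  elim: (index_enum _) => [|i s IH]; first by rewrite big_nil Fm1 mul1r.
  by rewrite big_cons FmM -mulrA; apply: mon_span_at.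
apply: mon_span_mul Hy => m z zm; apply: lspan_gen.
by exists m; apply: gen_monS.
Qed.

Lemma gen_mon_mul m p x y : gen_monomial m x -> gen_monomial p y ->
  gen_monomial (m + p) (x * y).
Proof.
move=> mx py; elim: mx => [|i q z _ IH|i f e q z fe _ IH|s q z _ IH].
- by rewrite mul1r.
- by rewrite -mulrA -addnA; apply: gen_monx.
- by rewrite -mulrA -addnA; apply: gen_monF.
by rewrite -mulrA; apply: gen_monS.
Qed.

Lemma gen_deg_mul m p x y : gen_deg m x -> gen_deg p y -> gen_deg (m + p) (x * y).
Proof.
move=> mx py; move: x mx; apply: lspan_ind_lin => [|a x x' Hx Hx'|x mx].
- by rewrite mul0r; apply: lspan0.
- by rewrite mulrDl -pzscalerAl; apply/lspanD/Hx'/lspanZ.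
move: y py; apply: lspan_ind_lin => [|a y y' Hy Hy'|y py].
- by rewrite mulr0; apply: lspan0.
- by rewrite mulrDr -pzscalerAr; apply/lspanD/Hy'/lspanZ.
by apply/lspan_gen/gen_mon_mul.
Qed.

Lemma gen_deg_decomp y : exists N (c : nat -> Q),
  (forall m, gen_deg m (c m)) /\ y = \sum_(m < N) c m.
Proof.
elim: (mon_spanT y) => [|a u v [m0 um0] _ [N [c [cdeg ->]]]].
  by exists 0%N, (fun=> 0); split=> [m|]; rewrite ?big_ord0 //; apply: lspan0.
exists (maxn m0.+1 N), (fun m => (if m == m0 then a *: u else 0) +
  (if (m < N)%N then c m else 0)); split=> [m|].
  apply: lspanD; last by case: ifP => _; [apply: cdeg | apply: lspan0].
  by case: eqP => [->|_]; [apply/lspanZ/lspan_gen | apply: lspan0].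
rewrite big_split /=; congr (_ + _).
  have lt : (m0 < maxn m0.+1 N)%N by rewrite leq_max ltnSn.
  rewrite (bigD1 (Ordinal lt)) //= eqxx big1 ?addr0 // => j ne.
  by case: eqP => // e; case/eqP: ne; apply: val_inj.
by rewrite (big_ord_widen _ c (leq_maxr m0.+1 N)) big_mkcond.
Qed.

Variables (tau : {scalar Q}) (D : nat).
Hypothesis tauC : forall x y, tau (x * y) = tau (y * x).
Hypothesis tau_nondeg : forall y, (forall g, tau (y * g) = 0) -> y = 0.
Hypothesis tau_repr : forall phi : {scalar Q}, exists y, forall g, phi g = tau (g * y).
Hypothesis tau_deg : forall m y, gen_monomial m y -> m != D -> tau y = 0.

Lemma tau_gen_deg m y : gen_deg m y -> m != D -> tau y = 0.
Proof.
move=> my ne; move: y my; apply: lspan_ind_lin => [|a x y Hx Hy|y my].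
- exact: linear0.
- by rewrite linearP /= Hx Hy mulr0 addr0.
exact: tau_deg my ne.
Qed.

(** Independence of the components comes from the trace: against a homogeneous
    element, only the component of complementary degree has a nonzero trace, so
    when a sum of components vanishes each of them is orthogonal to everything. *)
Lemma gen_deg_graded : graded_algebra gen_deg.
Proof.
split=> [m a x y Hx Hy|m|||x|N c cdeg c0 m mN].
- exact/lspanD/Hy/lspanZ.
- exact: lspan0.
- exact/lspan_gen/gen_mon1.
- exact: gen_deg_mul.
- exact: gen_deg_decomp.
apply: tau_nondeg => g; elim: (mon_spanT g) => [|a u v [p up] _ IH].
  by rewrite mulr0 linear0.
rewrite mulrDr -pzscalerAr linearP /= IH addr0.
suff -> : tau (c m * u) = 0 by rewrite mulr0.
have tau0 j : (j + p)%N != D -> tau (c j * u) = 0.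
  by apply: tau_gen_deg; apply: gen_deg_mul => //; apply: lspan_gen.
have [mpD|] := eqVneq (m + p)%N D; last exact: tau0.
have : tau ((\sum_(j < N) c j) * u) = 0 by rewrite c0 mul0r linear0.
rewrite mulr_suml linear_sum (bigD1 (Ordinal mN)) //= big1 ?addr0 // => j jm.
by apply: tau0; rewrite -mpD eqn_add2r.
Qed.

Lemma gen_deg_symmetric : symmetric_algebra gen_deg.
Proof.
split; first exact: gen_deg_graded.
exists tau; split=> //; split; first by exists D => m x; apply: tau_gen_deg.
move=> phi; have [y Hy] := tau_repr phi; exists y; split=> // z Hz.
apply/eqP; rewrite -subr_eq0; apply/eqP; apply: tau_nondeg => g.
by rewrite tauC mulrBr linearB /= -Hy -Hz subrr.
Qed.

End GradedSymmetric.

(** * Quotients of algebras *)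

Section AlgebraQuotient.
Variables (k : comNzRingType) (A : pzAlgType k) (S : A -> Prop).

Lemma aprojP a x y : aproj S (a *: x + y) = a *: aproj S x + aproj S y.
Proof. by rewrite -[RHS](@lproj_is_linear _ _ (two_sided S)). Qed.

Lemma aprojM x y : aproj S (x * y) = aproj S x * aproj S y.
Proof. by rewrite -aquot_mulE. Qed.

Lemma aproj_eq x y : S (x - y) -> aproj S x = aproj S y.
Proof.
move=> Sxy; apply/lprojP/lspan_gen.
by exists 1, (x - y), 1; rewrite mul1r mulr1.
Qed.

Lemma aproj_surj z : exists x, z = aproj S x.
Proof. by elim/lproj_ind: z => x; exists x. Qed.

(** A functional descends to the quotient by a two-sided ideal as soon as it kills
    the multiples of the generators on both sides. *)
Lemma quotient_functional (f : A -> k) : scalar f ->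
  (forall a s b, S s -> f (a * s * b) = 0) ->
  exists g : {scalar alg_quot S}, forall x, g (aproj S x) = f x.
Proof.
move=> lf f0; pose f' : A -> k^o := f.
have lf' : linear f' by move=> a x y; rewrite /f' lf.
pose fl : {linear A -> k^o} := HB.pack f' (GRing.isLinear.Build k A k^o *:%R f' lf').
pose g : alg_quot S -> k := llift fl.
have gE x : g (aproj S x) = f x.
  by apply: (@lliftE _ _ _ _ fl) => _ [a [s [b [Ss ->]]]]; apply: f0.
have lg : scalar g.
  move=> a x y; have [x' ->] := aproj_surj x; have [y' ->] := aproj_surj y.
  by rewrite -aprojP !gE lf.
exists (HB.pack_for {scalar alg_quot S} g
  (GRing.isLinear.Build k (alg_quot S) k *%R g lg)).
exact: gE.
Qed.

End AlgebraQuotient.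

(** * The module of coloured functions *)

Section WreathModule.
Variables (k : comNzRingType) (T : pzAlgType k) (n : nat).
Variables (act : 'S_n -> T -> T) (t : 'I_n -> 'I_n -> T) (c : nat -> T).
Hypothesis actM : forall s x y, act s (x * y) = act s x * act s y.
Hypothesis act_comp : forall s p x, act s (act p x) = act (p * s)%g x.
Hypothesis actP : forall s a x y, act s (a *: x + y) = a *: act s x + act s y.
Hypothesis act_one : forall s, act s 1 = 1.
Hypothesis act_t : forall s i j, act s (t i j) = t (s i) (s j).
Hypothesis tC : forall i j, i != j -> t i j = t j i.
Hypothesis t_comm : forall i j x, i != j -> t i j * x = act (tperm i j) x * t i j.
Hypothesis cC : forall a x, x * c a = c a * x.
Hypothesis act_c : forall s a, act s (c a) = c a.

Local Notation E := ({ffun 'I_n -> nat} -> 'S_n -> T).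
Implicit Types (u v : E).

Lemma fun2P u v : (forall w p, u w p = v w p) -> u = v.
Proof. by move=> uv; apply/funext => w; apply/funext => p. Qed.

Lemma fun2D u v w p : (u + v) w p = u w p + v w p. Proof. by []. Qed.
Lemma fun2Z a u w p : (a *: u) w p = a *: u w p. Proof. by []. Qed.
Lemma fun2_0 w p : (0 : E) w p = 0. Proof. by []. Qed.
Lemma fun2_sum I (s : seq I) P (u : I -> E) w p :
  (\sum_(i <- s | P i) u i) w p = \sum_(i <- s | P i) u i w p.
Proof. by rewrite !fct_sumE. Qed.

Definition opF f u : E := fun w p => act p f * u w p.
Definition opS s u : E := fun w p => u (wcomp w s) (s * p)%g.
Definition opN i u : E := fun w p => u (winc i w) p.
Definition opC i u : E := fun w p => c (w i) * u w p.
(** The coefficient of the exchange of the places i and j in the action of x_i.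
    The comparison of places accounts for the relation between an adjacent
    transposition and a variable; the comparison of colours compensates it so
    that the variables commute ([opCT_pair], [opTT_pair]). *)
Definition coefT (i j : 'I_n) (w : {ffun 'I_n -> nat}) : k := (j < i)%:R - (w i < w j)%:R.
Definition opT i j u : E := fun w p => if i == j then 0 else
  coefT i j w *: (t (p i) (p j) * u (wcomp w (tperm i j)) (tperm i j * p)%g).
(** The part of x_i that does not exchange places: colours are raised by [opN] and
    multiplied by their parameter by [opC], as in a companion matrix. *)
Definition opA i u := opN i u + opC i u.
Definition opX i u := opA i u + \sum_j opT i j u.

Lemma opF_is_linear f : linear (opF f).
Proof.
move=> a u v; apply: fun2P => w p.
by rewrite /opF !fun2D !fun2Z mulrDr -pzscalerAr.
Qed.
Lemma opS_is_linear s : linear (opS s). Proof. by []. Qed.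
Lemma opN_is_linear i : linear (opN i). Proof. by []. Qed.
Lemma opC_is_linear i : linear (opC i).
Proof.
move=> a u v; apply: fun2P => w p.
by rewrite /opC !fun2D !fun2Z mulrDr -pzscalerAr.
Qed.
Lemma opT_is_linear i j : linear (opT i j).
Proof.
move=> a u v; apply: fun2P => w p; rewrite /opT !fun2D !fun2Z.
case: eqP => _; first by rewrite scaler0 addr0.
by rewrite mulrDr -pzscalerAr scalerDr !scalerA [a * _]mulrC.
Qed.
HB.instance Definition _ f := GRing.isLinear.Build k E E *:%R (opF f) (opF_is_linear f).
HB.instance Definition _ f := GRing.isLinear.Build k E E *:%R (opS f) (opS_is_linear f).
HB.instance Definition _ f := GRing.isLinear.Build k E E *:%R (opN f) (opN_is_linear f).
HB.instance Definition _ f := GRing.isLinear.Build k E E *:%R (opC f) (opC_is_linear f).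
HB.instance Definition _ i j := GRing.isLinear.Build k E E *:%R (opT i j) (opT_is_linear i j).
Lemma opA_is_linear i : linear (opA i).
Proof. by move=> a u v; rewrite /opA !linearP /= scalerDr addrACA. Qed.
HB.instance Definition _ f := GRing.isLinear.Build k E E *:%R (opA f) (opA_is_linear f).
Lemma opX_is_linear i : linear (opX i).
Proof.
move=> a u v; rewrite /opX opA_is_linear.
have -> : \sum_j opT i j (a *: u + v) = a *: \sum_j opT i j u + \sum_j opT i j v.
  by rewrite scaler_sumr -big_split; apply: eq_bigr => j _; rewrite opT_is_linear.
by rewrite addrACA -scalerDr.
Qed.
HB.instance Definition _ f := GRing.isLinear.Build k E E *:%R (opX f) (opX_is_linear f).

Lemma t_tt i j x y : i != j -> t i j * t x y = t (tperm i j x) (tperm i j y) * t i j.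
Proof. by move=> ij; rewrite t_comm // act_t. Qed.

Lemma opTE i j u w p : i != j -> opT i j u w p =
  coefT i j w *: (t (p i) (p j) * u (wcomp w (tperm i j)) (tperm i j * p)%g).
Proof. by rewrite /opT => /negbTE ->. Qed.

Lemma opTT i j l m u w p : i != j -> l != m -> opT i j (opT l m u) w p =
  (coefT i j w * coefT l m (wcomp w (tperm i j))) *:
    (t (p i) (p j) * t (p (tperm i j l)) (p (tperm i j m)) *
      u (wcomp w (tperm l m * tperm i j)%g) (tperm l m * tperm i j * p)%g).
Proof.
move=> ij lm; rewrite !opTE // !permM -pzscalerAr scalerA mulrA.
by rewrite wcomp_comp mulgA.
Qed.

Lemma opAE i u w p : opA i u w p = u (winc i w) p + c (w i) * u w p.
Proof. by []. Qed.

Lemma opAD i u : opA i u = opN i u + opC i u.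
Proof. by []. Qed.

Lemma opXE i u : opX i u = opA i u + \sum_j opT i j u.
Proof. by []. Qed.

Lemma opA_comm i j u : opA i (opA j u) = opA j (opA i u).
Proof.
have [->//|ij] := eqVneq i j.
apply: fun2P => w p; rewrite !opAE wincC !ffunE (negbTE ij) eq_sym (negbTE ij) !addn0.
rewrite !mulrDr !mulrA cC -!addrA; congr (_ + _); rewrite !addrA; congr (_ + _).
exact: addrC.
Qed.

Lemma opAT_comm i j l u : i != j -> i != l -> opA i (opT j l u) = opT j l (opA i u).
Proof.
move=> ij il; have [->|jl] := eqVneq j l.
  by apply: fun2P => w p; rewrite opAE /opT eqxx mulr0 addr0.
apply: fun2P => w p; rewrite !opAE !opTE // opAE.
rewrite wcomp_inc tpermV tpermD 1?eq_sym //.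
rewrite ffunE tpermD 1?eq_sym // -pzscalerAr mulrDr scalerDr !mulrA cC.
congr (_ *: _ + _); rewrite /coefT !ffunE.
by rewrite ![_ == i]eq_sym (negbTE ij) (negbTE il) !addn0.
Qed.

(** On each side both terms evaluate u at the same point, and their coefficients
    add up to [i < j] + [j < i] - [b < a + 1] - [a < b] = 0, where a and b are the
    colours at the two places, a being the one that is raised. *)
Lemma opNT_pair i j u : i != j ->
  opN i (opT j i u) + opT i j (opN j u) = opT j i (opN i u) + opN j (opT i j u).
Proof.
move=> ij; have ji : j != i by rewrite eq_sym.
apply: fun2P => w p; rewrite !fun2D /opN !opTE // !wcomp_inc !tpermV.
rewrite (tC (i := p j)) ?(inj_eq perm_inj) // (tpermC j i) tpermL tpermR.
rewrite -!scalerDl /coefT !ffunE !eqxx (negbTE ij) (negbTE ji) !addn0 !addn1.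
set x := t _ _ * _; set y := t _ _ * _.
suff e (a b : nat) (q r : nat) : a != b ->
    (a < b)%:R - (q < r.+1)%:R + ((b < a)%:R - (r < q)%:R) = 0 :> k.
  by rewrite !e // ?scale0r // addrC e ?scale0r // eq_sym.
by case: (ltngtP a b) => // _ _; rewrite ltnS; case: (ltnP r q) => /= _; ring.
Qed.

(** If the two colours agree, so do their parameters and the sides match term by
    term; if they differ, the coefficients of the two exchanges are opposite. *)
Lemma opCT_pair i j u : i != j ->
  opC i (opT j i u) + opT i j (opC j u) = opT j i (opC i u) + opC j (opT i j u).
Proof.
move=> ij; have ji : j != i by rewrite eq_sym.
apply: fun2P => w p; rewrite !fun2D /opC !opTE //.
rewrite (tC (i := p j)) ?(inj_eq perm_inj) // (tpermC j i) !ffunE tpermL tpermR.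
rewrite -!pzscalerAr !mulrA !cC -!mulrA -!scalerDl.
rewrite /coefT; have [->|wij] := eqVneq (w i) (w j); first by congr (_ *: _); ring.
suff -> : (i < j)%:R - (w j < w i)%:R + ((j < i)%:R - (w i < w j)%:R) = 0 :> k.
  by rewrite !scale0r.
case: (ltngtP (w i)) wij => // _ _; have : i != j :> nat by [].
all: by case: (ltngtP i) => // _ _; rewrite /=; ring.
Qed.

Lemma opAT_pair i j u : i != j ->
  opA i (opT j i u) + opT i j (opA j u) = opT j i (opA i u) + opA j (opT i j u).
Proof.
move=> ij; rewrite !opAD !(linearD (opT _ _)) /= addrACA opNT_pair // opCT_pair //.
by rewrite addrACA.
Qed.

(** One of the factors [j < i] - e and [i < j] - e vanishes, where e is the
    comparison of the colours: e is 0 or 1, and exactly one of the two comparisons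
    of places holds. *)
Lemma opTT_pair i j u : i != j -> opT i j (opT j i u) = 0.
Proof.
move=> ij; have ji : j != i by rewrite eq_sym.
apply: fun2P => w p; rewrite opTT // /coefT !ffunE tpermL tpermR.
suff -> : ((j < i)%:R - (w i < w j)%:R) * ((i < j)%:R - (w i < w j)%:R) = 0 :> k.
  by rewrite scale0r.
have : i != j :> nat by [].
by case: (ltngtP i) => // _ _; case: (w i < w j)%N; rewrite /=; ring.
Qed.

Lemma opTii i u : opT i i u = 0.
Proof. by apply: fun2P => w p; rewrite /opT eqxx fun2_0. Qed.

Lemma opTT_disjoint i j l m u : uniq [:: i; j; l; m] ->
  opT i l (opT j m u) = opT j m (opT i l u).
Proof.
move=> U; move: (U); rewrite /= !inE !negb_or => /and4P[/and3P[ij il im] /andP[jl jm] lm _].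
apply: fun2P => w p; rewrite !opTT // (tperm4 U) /coefT !ffunE.
have [ji [li [mi [lj [mj ml]]]]] :
    j != i /\ l != i /\ m != i /\ l != j /\ m != j /\ m != l.
  by do !split; rewrite eq_sym.
have nn x y : x != y -> p x != p y by rewrite (inj_eq perm_inj).
rewrite !tpermD // t_tt; last exact: nn.
by rewrite !tpermD; try exact: nn; rewrite mulrC.
Qed.

(** The scalar identity behind the Yang-Baxter relation [opTT_triple].  For a single
    total order it is the classical identity for the step function; the difference
    of two such step functions still satisfies it. *)
Lemma coef_triple (i j l : nat) (a b d : nat) : i != j -> i != l -> j != l ->
  ((j < i)%:R - (a < b)%:R) * ((l < j)%:R - (a < d)%:R) +
  ((l < i)%:R - (a < d)%:R) * ((i < j)%:R - (b < d)%:R) =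
  ((l < j)%:R - (b < d)%:R) * ((l < i)%:R - (a < b)%:R) :> k.
Proof.
case: (ltngtP i j) => // ij _; case: (ltngtP i l) => // il _;
case: (ltngtP j l) => // jl _; case: (ltnP a b) => ab; case: (ltnP a d) => ad;
case: (ltnP b d) => bd; rewrite /=; try ring; exfalso; lia.
Qed.

(** The six double exchanges of three places are the two 3-cycles, three times
    each; by [t_tt] all terms with the same 3-cycle have the same product of
    elements t, and [coef_triple] compares their coefficients. *)
Lemma opTT_triple i j l u : uniq [:: i; j; l] ->
  opT i l (opT j l u) + opT i j (opT j l u) + opT i l (opT j i u) =
  opT j l (opT i l u) + opT j l (opT i j u) + opT j i (opT i l u).
Proof.
move=> U; move: (U); rewrite /= !inE !negb_or => /andP[/andP[ij il] /andP[jl _]].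
have [ji li lj] : [/\ j != i, l != i & l != j] by split; rewrite eq_sym.
have e1 : (tperm i j * tperm j l = tperm j l * tperm i l)%g by exact: tperm3.
have e2 : (tperm i l * tperm j i = tperm j l * tperm i l)%g.
  rewrite (tpermC i l) (tpermC j i) tperm3 /= ?inE ?negb_or ?li ?lj ?ij //.
  by rewrite (tpermC l j) e1 (tpermC i l).
have e3 : (tperm i l * tperm j l = tperm j l * tperm i j)%g.
  by rewrite (tpermC j l) tperm3 //= !inE !negb_or ij il lj.
have e4 : (tperm j i * tperm i l = tperm j l * tperm i j)%g.
  by rewrite tperm3 ?e3 //= !inE !negb_or ji il jl.
have nn (p : 'S_n) x y : x != y -> p x != p y by rewrite (inj_eq perm_inj).
apply: fun2P => w p; rewrite !fun2D !opTT //.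
rewrite !tpermL !tpermR !tpermD // e1 e2 e3 e4.
have t1 : t (p i) (p l) * t (p j) (p i) = t (p j) (p l) * t (p i) (p l).
  by rewrite t_tt ?nn // tpermL tpermD ?nn.
have t2 : t (p j) (p i) * t (p j) (p l) = t (p i) (p l) * t (p j) (p i).
  by rewrite t_tt ?nn // tpermL tpermD ?nn.
have t3 : t (p i) (p j) * t (p i) (p l) = t (p j) (p l) * t (p i) (p j).
  by rewrite t_tt ?nn // tpermL tpermD ?nn.
have t4 : t (p i) (p l) * t (p j) (p l) = t (p i) (p j) * t (p i) (p l).
  by rewrite t_tt ?nn // tpermR tpermD ?nn // tC ?nn.
rewrite t2 t1 t4 t3 -!addrA -!scalerDl [RHS]addrC; congr (_ *: _ + _ *: _).
  by rewrite /coefT !ffunE !tpermL !tpermR !tpermD // [RHS]addrC coef_triple.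
by rewrite /coefT !ffunE !tpermL !tpermR !tpermD // coef_triple.
Qed.

Lemma opX_comm i j u : opX i (opX j u) = opX j (opX i u).
Proof.
apply: (@sum_operators_comm k E n opA opT) => *.
- exact: opA_comm.
- exact: opTii.
- exact: opAT_comm.
- exact: opAT_pair.
- exact: opTT_pair.
- exact: opTT_disjoint.
- exact: opTT_triple.
Qed.

Lemma opF_lin a f g u : opF (a *: f + g) u = a *: opF f u + opF g u.
Proof.
by apply: fun2P => w p; rewrite fun2D fun2Z /opF actP mulrDl -pzscalerAl.
Qed.

Lemma opF_mul f g u : opF (f * g) u = opF f (opF g u).
Proof. by apply: fun2P => w p; rewrite /opF actM mulrA. Qed.

Lemma opF_one u : opF 1 u = u.
Proof. by apply: fun2P => w p; rewrite /opF act_one mul1r. Qed.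

Lemma opS_mul s s' u : opS (s' * s)%g u = opS s (opS s' u).
Proof. by apply: fun2P => w p; rewrite /opS wcomp_comp mulgA. Qed.

Lemma opS_one u : opS 1%g u = u.
Proof. by apply: fun2P => w p; rewrite /opS wcomp1 mul1g. Qed.

Lemma opSF s f u : opS s (opF f u) = opF (act s f) (opS s u).
Proof. by apply: fun2P => w p; rewrite /opS /opF act_comp. Qed.

Lemma tperm_mul (i j : 'I_n) (p : 'S_n) : (tperm i j * p = p * tperm (p i) (p j))%g.
Proof. by rewrite -tpermJ conjgE !mulgA mulgV mul1g. Qed.

(** The exchange in p undoes the exchange of factors made by t. *)
Lemma t_slide i j f (p : 'S_n) : i != j ->
  t (p i) (p j) * act (tperm i j * p)%g f = act p f * t (p i) (p j).
Proof.
move=> ij; rewrite tperm_mul -act_comp t_comm ?(inj_eq perm_inj) //.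
by rewrite !act_comp tperm2 mulg1.
Qed.

Lemma opF_A i f u : opF f (opA i u) = opA i (opF f u).
Proof.
by apply: fun2P => w p; rewrite /opF !opAE mulrDr !mulrA cC.
Qed.

Lemma opF_T i j f u : opF f (opT i j u) = opT i j (opF f u).
Proof.
have [->|ij] := eqVneq i j; first by rewrite !opTii linear0.
by apply: fun2P => w p; rewrite /opF !opTE // -pzscalerAr !mulrA t_slide.
Qed.

Lemma opF_X i f u : opF f (opX i u) = opX i (opF f u).
Proof.
rewrite !opXE linearD linear_sum /= opF_A; congr (_ + _).
by apply: eq_bigr => j _; rewrite opF_T.
Qed.

Lemma opS_A s i u : opS s (opA i u) = opA (s i) (opS s u).
Proof.
by apply: fun2P => w p; rewrite /opS !opAE wcomp_inc permK ffunE.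
Qed.

(** The comparison of colours is equivariant, the comparison of places is not: the
    second term measures the defect. *)
Lemma opS_T s i j u : i != j -> opS s (opT i j u) = opT (s i) (s j) (opS s u) +
  ((j < i)%:R - (s j < s i)%:R) *:
    opF (t (s i) (s j)) (opS (tperm (s i) (s j)) (opS s u)).
Proof.
move=> ij; apply: fun2P => w p; rewrite fun2D fun2Z /opF act_t.
rewrite {1}/opS !opTE ?(inj_eq perm_inj) // /opS !wcomp_comp !mulgA -!tperm_mul.
rewrite !permM -scalerDl /coefT !ffunE.
by congr (_ *: _); ring.
Qed.

Lemma opS_X s i u : opS s (opX i u) = opX (s i) (opS s u) +
  \sum_(j | j != i) ((j < i)%:R - (s j < s i)%:R) *:
    opF (t (s i) (s j)) (opS (tperm (s i) (s j)) (opS s u)).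
Proof.
rewrite !opXE (linearD (opS s)) (linear_sum (opS s)) /= opS_A -[RHS]addrA; congr (_ + _).
rewrite (bigD1 i) //= opTii linear0 add0r.
rewrite [X in _ = X + _](bigD1 (s i)) //= opTii add0r.
rewrite [X in _ = X + _](reindex_inj (@perm_inj _ s)) /=.
under [X in _ = X + _]eq_bigl => j do rewrite (inj_eq perm_inj).
by rewrite -big_split; apply: eq_bigr => j ji; rewrite opS_T // eq_sym.
Qed.

Lemma opS_X_far (i i' j : 'I_n) u : i' = i.+1 :> nat -> j != i -> j != i' ->
  opS (tperm i i') (opX j u) = opX j (opS (tperm i i') u).
Proof.
move=> ii' ji ji'; rewrite opS_X tpermD 1?eq_sym // big1 ?addr0 // => l _.
suff -> : (l < j)%:R - (tperm i i' l < j)%:R = 0 :> k by rewrite scale0r.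
have {ji ji'} [ji ji'] : j != i :> nat /\ j != i' :> nat by [].
suff -> : (l < j)%N = (tperm i i' l < j)%N by rewrite subrr.
by case: tpermP => [->|->|//]; lia.
Qed.

Lemma opS_X_near (i i' : 'I_n) u : i' = i.+1 :> nat ->
  opS (tperm i i') (opX i u) = opX i' (opS (tperm i i') u) - opF (t i i') u.
Proof.
move=> ii'; have i'i : i' != i by apply/negP => /eqP e; move: ii'; rewrite e; lia.
rewrite opS_X tpermL (bigD1 i') //= tpermR big1 ?addr0 => [|j /andP[ji ji']].
  rewrite -opS_mul tpermC tperm2 opS_one (tC i'i) ltnNge ii' leqnSn ltnSn /=.
  by rewrite add0r scaleN1r.
suff -> : (j < i)%:R - (tperm i i' j < i')%:R = 0 :> k by rewrite scale0r.
rewrite tpermD 1?eq_sym // ii' ltnS (leq_eqVlt j i).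
by rewrite (_ : (j == i :> nat) = false) ?subrr //; apply: negbTE.
Qed.

(** ** Right multiplication by a variable *)

Section RightMultiplication.
Variable j0 : 'I_n.

(** Right multiplication acts on the value j0 of p instead of on a place, hence at
    the place q where p takes this value.  It exchanges two values of p but no colours,
    and the comparison of places is absent. *)
Definition opZA u : E := fun w p =>
  let q := (p^-1)%g j0 in u (winc q w) p + c (w q) * u w p.
Definition opZT u : E := fun w p => let q := (p^-1)%g j0 in
  - \sum_(j | j != q) (w q < w j)%:R *: (t (p q) (p j) * u w (tperm q j * p)%g).
Definition opZ u := opZA u + opZT u.

Lemma opZA_is_linear : linear opZA.
Proof.
move=> a u v; apply: fun2P => w p; rewrite /opZA !fun2D !fun2Z /=.
by rewrite mulrDr -pzscalerAr scalerDr addrACA.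
Qed.

Lemma opZT_is_linear : linear opZT.
Proof.
move=> a u v; apply: fun2P => w p; rewrite /opZT !fun2D !fun2Z /=.
rewrite scalerN -opprD scaler_sumr -big_split; congr (- _).
apply: eq_bigr => j _ /=.
by rewrite mulrDr -pzscalerAr scalerDr !scalerA [a * _]mulrC.
Qed.
HB.instance Definition _ := GRing.isLinear.Build k E E *:%R opZA opZA_is_linear.
HB.instance Definition _ := GRing.isLinear.Build k E E *:%R opZT opZT_is_linear.

Lemma opZ_is_linear : linear opZ.
Proof. by move=> a u v; rewrite /opZ opZA_is_linear opZT_is_linear addrACA -scalerDr. Qed.
HB.instance Definition _ := GRing.isLinear.Build k E E *:%R opZ opZ_is_linear.

Lemma opZ_F f u : opZ (opF f u) = opF f (opZ u).
Proof.
apply: fun2P => w p; rewrite /opZ /opF !fun2D mulrDr; congr (_ + _).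
  by rewrite /opZA mulrDr !mulrA cC.
rewrite /opZT mulrN mulr_sumr; congr (- _); apply: eq_bigr => j jq.
by rewrite -pzscalerAr !mulrA t_slide // eq_sym.
Qed.

Lemma inv_mulE (s p : 'S_n) : ((s * p)^-1 j0 = s^-1 (p^-1 j0))%g.
Proof. by rewrite invMg permM. Qed.

Lemma opZ_S s u : opZ (opS s u) = opS s (opZ u).
Proof.
apply: fun2P => w p; rewrite /opZ /opS !fun2D /opZA /opZT inv_mulE.
rewrite wcomp_inc ffunE !permKV; congr (_ - _).
rewrite (reindex_inj (@perm_inj _ s)) /=; apply: eq_big => [j|j jq].
  by rewrite -(inj_eq (@perm_inj _ s) j) permKV.
rewrite !ffunE permM permKV; congr (_ *: (_ * u _ _)).
  by rewrite permKV permM.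
by rewrite [RHS]mulgA (tperm_mul _ j) permKV -mulgA.
Qed.

Lemma opZA_A i u : opA i (opZA u) = opZA (opA i u).
Proof.
apply: fun2P => w p; rewrite opAE /opZA /= !opAE wincC !ffunE.
set q := (_ : 'S_n) _; rewrite !mulrDr !mulrA.
have [->//|iq] := eqVneq i q.
by rewrite !addn0 cC [LHS]addrACA.
Qed.

Lemma opZT_T i l u : opT i l (opZT u) = opZT (opT i l u).
Proof.
have [->|il] := eqVneq i l; first by rewrite !opTii linear0.
apply: fun2P => w p; rewrite opTE // /opZT inv_mulE tpermV.
set q := (p^-1)%g j0; rewrite mulrN scalerN mulr_sumr scaler_sumr; congr (- _).
rewrite (reindex_inj (@perm_inj _ (tperm i l))) /=; apply: eq_big => [j|j].
  by rewrite (inj_eq perm_inj).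
rewrite (inj_eq perm_inj) => jq; have qj : q != j by rewrite eq_sym.
rewrite opTE // !ffunE !tpermK -!pzscalerAr !scalerA mulrC !permM !tpermK.
congr (_ *: _); rewrite !mulrA [in RHS]t_tt ?(inj_eq perm_inj) //.
have pE x : tperm (p q) (p j) (p (tperm q j x)) = p x.
  by rewrite -[LHS]permM -tperm_mul permM tpermK.
rewrite !pE; congr (_ * _ * u _ _).
by rewrite mulgA (tperm_mul (tperm i l q)) !tpermK mulgA.
Qed.

(** Raising a colour changes a comparison only when the two colours become equal or
    cease to be equal; in these cases the two words at which u is evaluated
    coincide, and the contributions of left and right multiplication cancel. *)
Lemma opZ_cross_core (i q : 'I_n) u (w : {ffun 'I_n -> nat}) (p : 'S_n) :
  \sum_(j | j != q) ((w q < w j)%:R - (winc i w q < winc i w j)%:R) *: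
    (t (p q) (p j) * u (winc i w) (tperm q j * p)%g) +
  \sum_(l | l != i) (coefT i l w - coefT i l (winc q w)) *:
    (t (p i) (p l) * u (wcomp (winc q w) (tperm i l)) (tperm i l * p)%g) = 0.
Proof.
have [<-{q}|iq] := eqVneq i q.
  rewrite -big_split big1 // => j ji /=.
  have -> : coefT i j w - coefT i j (winc i w) =
      - ((w i < w j)%:R - (winc i w i < winc i w j)%:R).
    by rewrite /coefT; ring.
  rewrite scaleNr !ffunE eqxx (negbTE ji) addn0 addn1 [(w i < w j)%N]leq_eqVlt.
  have [wij|wij] := eqVneq (w i).+1 (w j); last by rewrite subrr !scale0r subrr.
  suff -> : wcomp (winc i w) (tperm i j) = winc i w by rewrite subrr.
  apply/ffunP => l; rewrite !ffunE; case: tpermP => [->|->|//].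
    by rewrite eqxx (negbTE ji) addn0 addn1 wij.
  by rewrite eqxx (negbTE ji) addn0 addn1 wij.
have qi : q != i by rewrite eq_sym.
rewrite (bigD1 i) //= big1 ?addr0 => [|j /andP[jq ji]]; last first.
  by rewrite !ffunE (negbTE qi) (negbTE ji) !addn0 subrr scale0r.
rewrite (bigD1 q) //= big1 ?addr0 => [|j /andP[ji jq]]; last first.
  by rewrite /coefT !ffunE (negbTE iq) (negbTE jq) !addn0 subrr scale0r.
have -> : coefT i q w - coefT i q (winc q w) =
    - ((w i < w q)%:R - (winc q w i < winc q w q)%:R) by rewrite /coefT; ring.
rewrite !ffunE !eqxx (negbTE qi) (negbTE iq) !addn0 !addn1 scaleNr.
have [wiq|wiq] := eqVneq (w i) (w q).
  suff -> : wcomp (winc q w) (tperm i q) = winc i w.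
    by rewrite wiq (tC (i := p i)) ?(inj_eq perm_inj) // (tpermC q) subrr.
  rewrite wcomp_inc tpermV tpermR; apply/ffunP => l; rewrite !ffunE.
  by case: tpermP => [->|->|//]; rewrite wiq.
have e (a b : nat) : a != b -> (a < b)%N = (a < b.+1)%N by move=> ab; lia.
by rewrite -(e (w q)) 1?eq_sym // -(e (w i)) // !subrr !scale0r subrr.
Qed.

Lemma opZ_cross i u :
  opA i (opZT u) + \sum_l opT i l (opZA u) =
  opZT (opA i u) + opZA (\sum_l opT i l u).
Proof.
apply: fun2P => w p; rewrite !fun2D !fun2_sum.
set q := (p^-1)%g j0.
pose U l := t (p i) (p l) * u (wcomp (winc q w) (tperm i l)) (tperm i l * p)%g.
have -> : opA i (opZT u) w p = - \sum_(j | j != q) (winc i w q < winc i w j)%:R *: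
    (t (p q) (p j) * u (winc i w) (tperm q j * p)%g) + c (w i) * opZT u w p.
  by rewrite opAE.
have -> : opZT (opA i u) w p = - \sum_(j | j != q) (w q < w j)%:R *:
    (t (p q) (p j) * u (winc i w) (tperm q j * p)%g) + c (w i) * opZT u w p.
  rewrite /opZT -/q mulrN -opprD mulr_sumr -big_split; congr (- _).
  apply: eq_bigr => j _ /=; rewrite opAE mulrDr scalerDr -pzscalerAr; congr (_ + _).
  by rewrite !mulrA cC.
have -> : \sum_l opT i l (opZA u) w p = \sum_(l | l != i) coefT i l w *: U l +
    c (w q) * \sum_l opT i l u w p.
  rewrite mulr_sumr [in LHS](bigD1 i) // [X in _ = _ + X](bigD1 i) //=.
  rewrite !opTii mulr0 !add0r -big_split; apply: eq_bigr => l li /=.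
  have il : i != l by rewrite eq_sym.
  rewrite !opTE // /opZA /= inv_mulE tpermV -/q /U !wcomp_inc tpermV.
  by rewrite ffunE tpermK mulrDr scalerDr -pzscalerAr !mulrA cC.
have -> : opZA (\sum_l opT i l u) w p =
    \sum_(l | l != i) coefT i l (winc q w) *: U l + c (w q) * \sum_l opT i l u w p.
  rewrite /opZA /= -/q !fun2_sum; congr (_ + _).
  rewrite (bigD1 i) //= opTii add0r; apply: eq_bigr => l li.
  by rewrite opTE 1?eq_sym.
rewrite !addrA; congr (_ + _); rewrite -!addrA ![c (w i) * _ + _]addrC !addrA.
congr (_ + _); apply/eqP; rewrite -subr_eq0 opprD opprK.
rewrite addrACA [X in X + _]addrC -!sumrB /=.
apply/eqP; rewrite -[RHS](opZ_cross_core i q u w p); congr (_ + _).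
  by apply: eq_bigr => j _; rewrite scalerBl.
by apply: eq_bigr => j _; rewrite -scalerBl.
Qed.

(** With the parts commuting separately by [opZA_A] and [opZT_T], only the mixed
    terms [opZ_cross] remain. *)
Lemma opZ_X i u : opX i (opZ u) = opZ (opX i u).
Proof.
have ZE v : opZ v = opZA v + opZT v by [].
rewrite !opXE !ZE (linearD (opA i)) (linearD opZA) (linearD opZT) /= opZA_A.
have -> : \sum_j opT i j (opZA u + opZT u) =
    \sum_j opT i j (opZA u) + \sum_j opT i j (opZT u).
  by rewrite -big_split; apply: eq_bigr => j _; rewrite linearD.
rewrite (linear_sum opZT) /=.
have -> : \sum_j opT i j (opZT u) = \sum_j opZT (opT i j u).
  by apply: eq_bigr => j _; rewrite opZT_T.
have regroup (x y z z' y' x' : E) : y + z = x' + y' -> x + y + (z + z') = x + y' + (x' + z').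
  by move=> e; rewrite !addrA -(addrA x) e !addrA [RHS](ACl (1*3*2*4)).
by apply: regroup; rewrite opZ_cross.
Qed.

End RightMultiplication.

(** ** The trace functional and its Gram matrix *)

Hypothesis act1 : forall x, act 1%g x = x.
Variables (trT : {scalar T}).
Hypothesis trC : forall x y, trT (x * y) = trT (y * x).
Hypothesis tr_act : forall s x, trT (act s x) = trT x.

Lemma opFE f u w p : opF f u w p = act p f * u w p. Proof. by []. Qed.
Lemma opSE s u w p : opS s u w p = u (wcomp w s) (s * p)%g. Proof. by []. Qed.

Let act0 s : act s 0 = 0.
Proof. by have := actP s (-1) 0 0; rewrite !scaler0 addr0 scaleN1r addNr. Qed.

Lemma opX_val i u w p : opX i u w p = u (winc i w) p + c (w i) * u w p +
  \sum_(j | j != i) coefT i j w *: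
    (t (p i) (p j) * u (wcomp w (tperm i j)) (tperm i j * p)%g).
Proof.
rewrite opXE fun2D opAE fun2_sum (bigD1 i) //= opTii add0r.
by congr (_ + _); apply: eq_bigr => j ji; rewrite opTE // eq_sym.
Qed.

Definition vanish m u := forall w p, (wsize w < m)%N -> u w p = 0.

(** Every other term evaluates u at a word of the same size as w. *)
Lemma opX_lead m u i w p : vanish m.+1 u -> (wsize w <= m)%N ->
  opX i u w p = u (winc i w) p.
Proof.
move=> u0 wm; rewrite opX_val (u0 w) // mulr0 addr0 big1 ?addr0 // => j _.
by rewrite u0 ?wsize_comp // mulr0 scaler0.
Qed.

Definition opXs (xs : seq 'I_n) u : E := foldr opX u xs.

Lemma opXs_lead xs m u w p : vanish (size xs + m) u -> (wsize w <= m)%N ->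
  opXs xs u w p = u (foldr winc w xs) p.
Proof.
elim: xs m w p => //= i xs IH m w p u0 wm.
have u1 : vanish (size xs + m.+1) u by rewrite addnS.
rewrite (@opX_lead m) // => [|w' p' w'm].
  rewrite (IH m.+1) ?wsize_inc //; congr (u _ _).
  by elim: xs {IH u0 u1} => //= j xs ->; rewrite wincC.
rewrite (IH m.+1) ?(ltnW w'm) //; apply: u1.
by rewrite wsize_foldr ltn_add2l.
Qed.

Definition trE u : k := trT (u (wcst n 0) 1%g).

Variable d : nat.

Variables (tdeg : nat -> T -> Prop) (delta : nat).
Hypothesis tdeg_one : tdeg 0 1.
Hypothesis tdegM : forall a b x y, tdeg a x -> tdeg b y -> tdeg (a + b) (x * y).
Hypothesis tdeg_act : forall a s x, tdeg a x -> tdeg a (act s x).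
Hypothesis tdeg_t : forall i j, i != j -> tdeg delta (t i j).
Hypothesis tdeg_c : forall a, tdeg delta (c a).
Hypothesis tdeg_tr : forall a x, tdeg a x -> a != (n * delta)%N -> trT x = 0.

(** Degree m for elements of E, tested with the trace: u(w, p) should have degree
    m - (n d - n - |w|) delta, that is, pair to zero with every x whose degree is
    not the complement to n delta.  Where the difference is negative, this asks
    that u(w, p) be orthogonal to everything. *)
Definition homog m u := forall w p a x, tdeg a x ->
  (a + m + wsize w * delta)%N != (n * d * delta)%N -> trT (x * u w p) = 0.

Lemma homog_F m a f u : tdeg a f -> homog m u -> homog (a + m) (opF f u).
Proof.
move=> fa um w p b x bx ne; rewrite /opF mulrA.
by apply: um (tdegM bx (tdeg_act p fa)) _; move: ne; rewrite !addnA.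
Qed.

Lemma homog_S m s u : homog m u -> homog m (opS s u).
Proof.
by move=> um w p b x bx ne; rewrite /opS; apply: um bx _; rewrite wsize_comp.
Qed.

Lemma homog_X m i u : homog m u -> homog (delta + m) (opX i u).
Proof.
move=> um w p b x bx ne; rewrite opX_val !mulrDr !linearD /= mulr_sumr linear_sum.
rewrite (um _ _ _ _ bx); last first.
  by move: ne; rewrite wsize_inc mulSn; congr (_ != _); lia.
rewrite mulrA (um _ _ _ _ (tdegM bx (tdeg_c _))); last first.
  by move: ne; congr (_ != _); lia.
rewrite !add0r big1 // => j ji /=; rewrite -pzscalerAr linearZ /= mulrA.
rewrite (um _ _ _ _ (tdegM bx (tdeg_t _))) ?mulr0 //.
  by rewrite (inj_eq perm_inj) eq_sym.
by move: ne; rewrite wsize_comp; congr (_ != _); lia.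
Qed.

Lemma homog_trE m u : homog m u -> m != (n * d * delta)%N -> trE u = 0.
Proof.
move=> um ne; rewrite /trE -[u _ _]mul1r; apply: um tdeg_one _.
by rewrite wsize_cst muln0 mul0n addn0.
Qed.

Local Notation top := (wcst n d.-1).

(** The cyclic vector of the cyclotomic quotient. *)
Definition vtop : E := fun w p => if (w == top) && (p == 1%g) then 1 else 0.

Lemma opSF_vtop q h w p : opS q (opF h vtop) w p =
  if (w == top) && (q * p == 1)%g then h else 0.
Proof.
rewrite opSE opFE /vtop wcomp_eq_cst.
by case: ifP => [/andP[_ /eqP->]|_]; rewrite ?mulr0 // act1 mulr1.
Qed.

(** With at most n (d-1) variables, a product reaches the constant word d-1 from
    the constant word 0 only if each variable raises a colour; hence the other terms
    of x_i never contribute. *)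
Lemma trE_gram f s xs q h : (size xs <= n * d.-1)%N ->
  trE (opF f (opS s (opXs xs (opS q (opF h vtop))))) =
  if (wcount xs == top) && (q * s == 1)%g then trT (f * h) else 0.
Proof.
move=> xsn; rewrite /trE opFE opSE act1 mulg1 wcomp_cst.
rewrite (@opXs_lead _ 0) ?wsize_cst ?muln0 // => [|w p].
  rewrite foldr_winc opSF_vtop.
  by case: ifP => // _; rewrite mulr0 linear0.
rewrite addn0 => wxs; rewrite opSF_vtop.
case: eqP => //= wtop; move: wxs; rewrite wtop wsize_cst.
by rewrite ltnNge xsn.
Qed.

Lemma homog_vtop : (0 < d)%N -> homog 0 vtop.
Proof.
move=> d_gt0 w p b x bx; rewrite /vtop; case: ifP => [/andP[/eqP -> _]|_ _]; last first.
  by rewrite mulr0 linear0.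
rewrite wsize_cst addn0 mulr1 => ne; apply: tdeg_tr bx _.
move: ne; apply: contra => /eqP ->.
by rewrite -[(n * d.-1 * _)%N]mulnA -mulnDr -mulSn prednK // mulnA.
Qed.

(** ** Right multiplications and the cyclic vector *)

Definition opRF f u : E := fun w p => u w p * f.
(** Elements of T act from the left through p; the twist by the inverse of s makes
    right multiplication by s commute with them. *)
Definition opRS s u : E := fun w p => act (s^-1)%g (u w (p * s)%g).

Lemma opRF_is_linear f : linear (opRF f).
Proof.
move=> a u v; apply: fun2P => w p.
by rewrite /opRF !fun2D !fun2Z mulrDl -pzscalerAl.
Qed.
HB.instance Definition _ f := GRing.isLinear.Build k E E *:%R (opRF f) (opRF_is_linear f).

Lemma opRS_is_linear s : linear (opRS s).
Proof. by move=> a u v; apply: fun2P => w p; rewrite /opRS !fun2D !fun2Z actP. Qed.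
HB.instance Definition _ f := GRing.isLinear.Build k E E *:%R (opRS f) (opRS_is_linear f).

Lemma opRF_F f g u : opRF f (opF g u) = opF g (opRF f u).
Proof. by apply: fun2P => w p; rewrite /opRF /opF mulrA. Qed.

Lemma opRF_S f s u : opRF f (opS s u) = opS s (opRF f u).
Proof. by []. Qed.

Lemma opRF_X f i u : opRF f (opX i u) = opX i (opRF f u).
Proof.
apply: fun2P => w p; rewrite /opRF !opX_val !mulrDl mulr_suml -mulrA.
by congr (_ + _); apply: eq_bigr => j _; rewrite -pzscalerAl mulrA.
Qed.

Lemma opRS_F s g u : opRS s (opF g u) = opF g (opRS s u).
Proof.
by apply: fun2P => w p; rewrite /opRS /opF actM act_comp -mulgA mulgV mulg1.
Qed.

Lemma opRS_S s q u : opRS s (opS q u) = opS q (opRS s u).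
Proof. by apply: fun2P => w p; rewrite /opRS /opS mulgA. Qed.

Lemma opRS_X s i u : opRS s (opX i u) = opX i (opRS s u).
Proof.
have actD x y q : act q (x + y) = act q x + act q y.
  by rewrite -[x in LHS]scale1r actP scale1r.
have actZ a x q : act q (a *: x) = a *: act q x.
  by rewrite -[a *: x]addr0 actP act0 addr0.
apply: fun2P => w p; rewrite /opRS !opX_val !actD actM act_c; congr (_ + _).
rewrite (big_morph _ (fun x y => actD x y _) (act0 _)).
by apply: eq_bigr => j _; rewrite actZ actM act_t !permM !permK mulgA.
Qed.

Lemma opRF_vtop f : opRF f vtop = opF f vtop.
Proof.
apply: fun2P => w p; rewrite /opRF /opF /vtop.
by case: ifP => [/andP[_ /eqP ->]|]; rewrite ?act1 ?mul1r ?mulr1 ?mul0r ?mulr0.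
Qed.

Lemma opRS_vtop s : opRS s vtop = opS s vtop.
Proof.
apply: fun2P => w p; rewrite /opRS /opS /vtop wcomp_eq_cst.
have -> : (p * s == 1)%g = (s * p == 1)%g 
  by rewrite -{1}(invgK s) -eq_mulgV1 eq_sym eq_mulVg1 invgK.
by case: ifP; rewrite ?act_one ?act0.
Qed.

Lemma trE_RF f u : trE (opRF f u) = trE (opF f u).
Proof. by rewrite /trE /opRF /opF act1 trC. Qed.

Lemma trE_RS s u : trE (opRS s u) = trE (opS s u).
Proof. by rewrite /trE /opRS /opS tr_act wcomp_cst mulg1 mul1g. Qed.

Variable i0 : 'I_n.
Hypothesis i0_0 : i0 = 0 :> nat.

Lemma coefT_i0 j w : coefT i0 j w = - (w i0 < w j)%:R.
Proof. by rewrite /coefT i0_0 ltn0 sub0r. Qed.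

Lemma opZ_val u w p : opZ i0 u w p = let q := (p^-1)%g i0 in
  u (winc q w) p + c (w q) * u w p
  - \sum_(j | j != q) (w q < w j)%:R *: (t (p q) (p j) * u w (tperm q j * p)%g).
Proof. by []. Qed.

(** At the constant word 0 and for the first place, all comparisons are false on
    both sides, so the actions of x_1 from the left and from the right agree.  The
    same happens for the cyclic vector, whose word is constant too. *)
Lemma trE_Z u : trE (opZ i0 u) = trE (opX i0 u).
Proof.
rewrite /trE opX_val opZ_val /= invg1 perm1; congr (trT (_ + _)).
rewrite !big1 ?oppr0 // => j _; first by rewrite coefT_i0 !ffunE oppr0 scale0r.
by rewrite !ffunE scale0r.
Qed.

Lemma opZ_vtop : opZ i0 vtop = opX i0 vtop.
Proof.
apply: fun2P => w p; rewrite opX_val opZ_val /=.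
set q := (p^-1)%g i0.
rewrite big1 ?oppr0 => [|j _]; last first.
  rewrite /vtop; case: eqP => [->|_] /=; last by rewrite mulr0 scaler0.
  by rewrite !ffunE ltnn scale0r.
rewrite big1 => [|j _]; last first.
  rewrite /vtop wcomp_eq_cst; case: eqP => [->|_] /=; last by rewrite mulr0 scaler0.
  by rewrite coefT_i0 !ffunE ltnn oppr0 scale0r.
rewrite /q /vtop; have [->|p1] := eqVneq p 1%g; first by rewrite invg1 perm1.
by rewrite !andbF !mulr0.
Qed.

(** ** The cyclotomic relation on bounded functions *)

(** These functions form a submodule because no operator looks at a word with a
    smaller largest colour than the given one. *)
Definition bounded u := forall (w : {ffun 'I_n -> nat}) p i, (d <= w i)%N -> u w p = 0.

Lemma bounded_F f u : bounded u -> bounded (opF f u).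
Proof. by move=> ub w p i wi; rewrite /opF (ub _ _ i) // mulr0. Qed.

Lemma bounded_S s u : bounded u -> bounded (opS s u).
Proof. by move=> ub w p i wi; rewrite /opS (ub _ _ (s^-1 i)%g) // ffunE permKV. Qed.

Lemma bounded_X i u : bounded u -> bounded (opX i u).
Proof.
move=> ub w p j wj; rewrite opX_val !(ub _ _ j) ?mulr0 ?addr0 ?big1 ?addr0 ?ffunE //.
  by move=> l _; rewrite (ub _ _ (tperm i l j)) ?mulr0 ?scaler0 // ffunE tpermK.
by rewrite (leq_trans wj) // leq_addr.
Qed.

Lemma bounded_P a u v : bounded u -> bounded v -> bounded (a *: u + v).
Proof.
by move=> ub vb w p i wi; rewrite fun2D fun2Z (ub _ _ i) // (vb _ _ i) // scaler0 addr0.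
Qed.

Lemma bounded_0 : bounded 0. Proof. by []. Qed.

Lemma bounded_vtop : (0 < d)%N -> bounded vtop.
Proof.
move=> d_gt0 w p i wi; rewrite /vtop; case: eqP => //= e; move: wi; rewrite e ffunE.
by rewrite -ltnS prednK // ltnn.
Qed.

(** For the first place the comparison of places is false, so x_1 only involves
    exchanges with larger colours; at a word whose first colour is at least m, these
    and the raising term evaluate u at first colours above m, where it vanishes.
    There remains c(m) u. *)
Lemma cyclotomic_step m u :
  (forall (w : {ffun 'I_n -> nat}) p, (m < w i0)%N -> u w p = 0) ->
  forall (w : {ffun 'I_n -> nat}) p, (m <= w i0)%N -> (opX i0 u - opF (c m) u) w p = 0.
Proof.
move=> u0 w p wm; rewrite fun2D.
have -> : (- opF (c m) u) w p = - (c m * u w p) by rewrite -[in RHS](act_c p).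
rewrite opX_val u0 ?ffunE ?eqxx ?addn1 ?ltnS // add0r big1 ?addr0 => [|j _]; last first.
  rewrite coefT_i0; case: ltnP => wj; last by rewrite oppr0 scale0r.
  by rewrite u0 ?mulr0 ?scaler0 // ffunE tpermL (leq_ltn_trans wm).
move: wm; rewrite leq_eqVlt => /orP[/eqP <-|/u0 ->]; first exact: subrr.
by rewrite !mulr0 subrr.
Qed.

Hypothesis trT_nondeg : forall x, (forall y, trT (y * x) = 0) -> x = 0.
Hypothesis trT_repr : forall phi : T -> k, scalar phi ->
  exists h, forall f, phi f = trT (f * h).
Variables (F : pzAlgType k) (at_ : 'I_n -> {linear F -> T}) (Fdeg : nat -> F -> Prop).
Hypothesis F_graded : graded_algebra Fdeg.
Hypothesis T_span : forall x : T,
  lspan (fun y => exists u : {ffun 'I_n -> F}, y = \prod_(i < n) at_ i (u i)) x.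
Hypothesis tdeg_at : forall a i f, Fdeg a f -> tdeg a (at_ i f).

(** ** The trace on an algebra with generators and relations *)

(** A is used only through its generators and its action on E. *)
Section Presentation.
Local Notation I := ('I_n + T + 'S_n)%type.
Variables (A : pzAlgType k) (gen : I -> A).
Hypothesis A_ind : forall P : A -> Prop, P 0 ->
  (forall a x y, P x -> P y -> P (a *: x + y)) -> P 1 ->
  (forall i y, P y -> P (gen i * y)) -> forall y, P y.
Local Notation x_ i := (gen (inl (inl i))).
Local Notation f_ f := (gen (inl (inr f))).
Local Notation s_ s := (gen (inr s)).

Definition gen_op (x : I) : {linear E -> E} :=
  match x with
  | inl (inl i) => opX i
  | inl (inr f) => opF f
  | inr s => opS s
  end.

Variable actf : A -> E -> E.
Hypothesis actfP : forall a g h u, actf (a *: g + h) u = a *: actf g u + actf h u.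
Hypothesis actfM : forall g h u, actf (g * h) u = actf g (actf h u).
Hypothesis actf1 : forall u, actf 1 u = u.
Hypothesis actf_gen : forall x u, actf (gen x) u = gen_op x u.
Local Notation v0 := vtop.

Lemma actf_x i u : actf (x_ i) u = opX i u. Proof. exact: actf_gen. Qed.
Lemma actf_f f u : actf (f_ f) u = opF f u. Proof. exact: actf_gen. Qed.
Lemma actf_s s u : actf (s_ s) u = opS s u. Proof. exact: actf_gen. Qed.
Lemma actf0 u : actf 0 u = 0.
Proof. by have := actfP (-1) 0 0 u; rewrite !scaler0 addr0 scaleN1r addNr. Qed.
Lemma actfB g h u : actf (g - h) u = actf g u - actf h u.
Proof. by rewrite -scaleN1r addrC actfP scaleN1r addrC. Qed.

Definition tau_free (g : A) : k := trE (actf g v0).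

Lemma tau_free_scalar : scalar tau_free.
Proof. by move=> a g h; rewrite /tau_free actfP /trE fun2D fun2Z linearP. Qed.

(** These elements form a subalgebra, so it suffices to treat the generators. *)
Definition trace_central h := forall g, tau_free (g * h) = tau_free (h * g).

Lemma trace_central_P a x y : trace_central x -> trace_central y -> trace_central (a *: x + y).
Proof.
move=> Hx Hy g; rewrite mulrDr mulrDl -pzscalerAr -pzscalerAl !tau_free_scalar.
by rewrite Hx Hy.
Qed.

Lemma trace_central_M x y : trace_central x -> trace_central y -> trace_central (x * y).
Proof. by move=> Hx Hy g; rewrite mulrA Hy mulrA Hx mulrA. Qed.

Lemma trace_central_ext x y : (forall u, actf x u = actf y u) -> trace_central x -> trace_central y.
Proof. by move=> xy Hx g; rewrite /tau_free !actfM -!xy -!actfM; apply: Hx. Qed.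

(** The mechanism of symmetry: R plays the role of right multiplication by h, and
    commutes with A since it commutes with the generators. *)
Lemma trace_central_right (R : E -> E) h : linear R ->
  (forall x u, R (gen_op x u) = gen_op x (R u)) -> R v0 = actf h v0 ->
  (forall u, trE (R u) = trE (actf h u)) -> trace_central h.
Proof.
move=> lR RC Rv Rtr g; rewrite /tau_free !actfM -Rv -Rtr.
congr (trE _); move: (v0) => v; have R0 : R 0 = 0.
  by have := lR (-1) 0 0; rewrite !scaler0 addr0 scaleN1r addNr.
move: g; apply: A_ind => [|b x y IHx IHy||i y IH].
- by rewrite !actf0.
- by rewrite !actfP lR IHx IHy.
- by rewrite !actf1.
by rewrite !actfM !actf_gen RC IH.
Qed.

Lemma trace_central_f f : trace_central (f_ f).
Proof.
apply: (@trace_central_right (opRF f)) => [|[[i|g]|s] u||u].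
- exact: opRF_is_linear.
- exact: opRF_X.
- exact: opRF_F.
- exact: opRF_S.
- by rewrite actf_f; apply: opRF_vtop.
by rewrite actf_f; apply: trE_RF.
Qed.

Lemma trace_central_s s : trace_central (s_ s).
Proof.
apply: (@trace_central_right (opRS s)) => [|[[i|g]|p] u||u].
- exact: opRS_is_linear.
- exact: opRS_X.
- exact: opRS_F.
- exact: opRS_S.
- by rewrite actf_s; apply: opRS_vtop.
by rewrite actf_s; apply: trE_RS.
Qed.

Lemma trace_central_x0 : trace_central (x_ i0).
Proof.
apply: (@trace_central_right (opZ i0)) => [|[[i|g]|p] u||u].
- exact: opZ_is_linear.
- by rewrite /= opZ_X.
- exact: opZ_F.
- exact: opZ_S.
- by rewrite actf_x; apply: opZ_vtop.
by rewrite actf_x; apply: trE_Z.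
Qed.

(** From x_1 to all variables, by x_(i+1) = s x_i s + t_(i,i+1) s, which holds as an
    identity of operators on E. *)
Lemma trace_central_x i : trace_central (x_ i).
Proof.
case: i => m; elim: m => [|m IH] mn.
  by rewrite (_ : Ordinal mn = i0); [apply: trace_central_x0 | apply: val_inj].
have mn' : (m < n)%N by apply: ltnW.
pose i := Ordinal mn'; pose i' := Ordinal mn; pose s := tperm i i'.
have := trace_central_P 1
  (trace_central_M (trace_central_s s) (trace_central_M (IH mn') (trace_central_s s)))
  (trace_central_M (trace_central_f (t i i')) (trace_central_s s)).
apply: trace_central_ext => u; rewrite actfP scale1r !actfM !actf_s !actf_x !actf_f -/i -/i'.
rewrite opS_X_near // -opS_mul tperm2 opS_one.
by rewrite subrK.
Qed.

Lemma tau_freeC g h : tau_free (g * h) = tau_free (h * g).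
Proof.
move: h g; apply: A_ind => [g|a x y Hx Hy|g|i y Hy].
- by rewrite mulr0 mul0r.
- exact: trace_central_P.
- by rewrite mulr1 mul1r.
apply: trace_central_M => //; case: i => [[i|f]|s].
- exact: trace_central_x.
- exact: trace_central_f.
exact: trace_central_s.
Qed.

Lemma tau_free_gram f s xs q h : (size xs <= n * d.-1)%N ->
  tau_free (f_ f * s_ s * (\prod_(i <- xs) x_ i) * s_ q * f_ h) =
  if (wcount xs == wcst n d.-1) && (q * s == 1)%g then trT (f * h) else 0.
Proof.
move=> sz; rewrite /tau_free !actfM !actf_f !actf_s.
have -> u : actf (\prod_(i <- xs) x_ i) u = opXs xs u.
  elim: {sz} xs => [|i xs IH]; first by rewrite big_nil actf1.
  by rewrite big_cons actfM actf_x IH.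
exact: trE_gram.
Qed.

Lemma bounded_actf g : (0 < d)%N -> bounded (actf g v0).
Proof.
move=> d_gt0; move: g; apply: A_ind => [|a x y Hx Hy||i y Hy].
- by rewrite actf0; apply: bounded_0.
- by rewrite actfP; apply: bounded_P.
- by rewrite actf1; apply: bounded_vtop.
rewrite actfM; case: i => [[i|f]|s].
- by rewrite actf_x; apply: bounded_X.
- by rewrite actf_f; apply: bounded_F.
by rewrite actf_s; apply: bounded_S.
Qed.

(** The factors are applied from the last parameter to the first; after m of them
    the function vanishes where the first colour is at least d - m. *)
Lemma cyclotomic_actf u : bounded u -> actf (\prod_(j < d) (x_ i0 - f_ (c j))) u = 0.
Proof.
move=> ub.
rewrite -(big_mkord xpredT (fun j => x_ i0 - f_ (c j))).
have step m : (m <= d)%N -> forall (w : {ffun 'I_n -> nat}) p, (d - m <= w i0)%N ->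
    actf (\prod_(d - m <= j < d) (x_ i0 - f_ (c j))) u w p = 0.
  elim: m => [|m IH] md w p.
    by rewrite subn0 big_geq // actf1; apply: ub.
  have j_lt : (d - m.+1 < d)%N by lia.
  rewrite big_ltn // subnSK // actfM actfB actf_x actf_f; apply: cyclotomic_step => //.
  by move=> w' p' lt; apply: IH; [apply: ltnW | lia].
by apply: fun2P => w p; have := step d (leqnn d) w p; rewrite subnn; apply.
Qed.

Lemma actf_eq g h : (forall u, actf g u = actf h u) -> forall u, actf (g - h) u = 0.
Proof. by move=> gh u; rewrite actfB gh subrr. Qed.

(** The defining relations of the affine wreath product algebra, for abstract T. *)
Inductive wreath_rel : A -> Prop :=
| wreath_xx i j : wreath_rel (x_ i * x_ j - x_ j * x_ i)
| wreath_FD f g : wreath_rel (f_ (f + g) - (f_ f + f_ g))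
| wreath_FZ a f : wreath_rel (f_ (a *: f) - a *: f_ f)
| wreath_FM f g : wreath_rel (f_ (f * g) - f_ f * f_ g)
| wreath_F1 : wreath_rel (f_ 1 - 1)
| wreath_SM s p : wreath_rel (s_ (p * s)%g - s_ s * s_ p)
| wreath_S1 : wreath_rel (s_ 1%g - 1)
| wreath_Fx f i : wreath_rel (f_ f * x_ i - x_ i * f_ f)
| wreath_sx_far (i i' j : 'I_n) : i' = i.+1 :> nat -> j != i -> j != i' ->
    wreath_rel (s_ (tperm i i') * x_ j - x_ j * s_ (tperm i i'))
| wreath_sx (i i' : 'I_n) : i' = i.+1 :> nat ->
    wreath_rel (s_ (tperm i i') * x_ i - (x_ i' * s_ (tperm i i') - f_ (t i i')))
| wreath_SF s f : wreath_rel (s_ s * f_ f - f_ (act s f) * s_ s).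

Lemma opF0 u : opF 0 u = 0.
Proof. by have := opF_lin (-1) 0 0 u; rewrite !scaler0 addr0 scaleN1r addNr. Qed.

Lemma wreath_rel_act g u : wreath_rel g -> actf g u = 0.
Proof.
case=> [i j|f g'|a f|f g'||s p||f i|i i' j ii' ji ji'|i i' ii'|s f]; apply: actf_eq => {}u.
- by rewrite !actfM !actf_x opX_comm.
- by rewrite -[f_ f]scale1r actfP !actf_f -[f in LHS]scale1r opF_lin.
- by rewrite -[a *: f_ f]addr0 actfP actf0 !actf_f -[a *: f]addr0 opF_lin opF0.
- by rewrite actfM !actf_f opF_mul.
- by rewrite actf1 actf_f opF_one.
- by rewrite actfM !actf_s opS_mul.
- by rewrite actf1 actf_s opS_one.
- by rewrite !actfM !actf_x !actf_f opF_X.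
- by rewrite !actfM !actf_x !actf_s opS_X_far.
- by rewrite actfB !actfM !actf_x !actf_s !actf_f opS_X_near.
by rewrite !actfM !actf_s !actf_f opSF.
Qed.

Variable rel : A -> Prop.
Hypothesis relE : forall g, rel g <-> wreath_rel g.

Definition rel_quot : pzAlgType k := alg_quot rel.
Definition rproj (g : A) : rel_quot := aproj rel g.
Definition cyclotomic_elt : rel_quot := \prod_(j < d) (rproj (x_ i0) - rproj (f_ (c j))).
Local Notation cyc_rel := (fun y : rel_quot => y = cyclotomic_elt).
Definition cyc_quot : pzAlgType k := alg_quot cyc_rel.

Lemma rprojP a x y : rproj (a *: x + y) = a *: rproj x + rproj y.
Proof. exact: aprojP. Qed.

Lemma rprojM x y : rproj (x * y) = rproj x * rproj y.
Proof. exact: aprojM. Qed.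

Definition qproj (g : A) : cyc_quot := aproj cyc_rel (rproj g).

Lemma qprojP a x y : qproj (a *: x + y) = a *: qproj x + qproj y.
Proof. by rewrite /qproj rprojP; apply: aprojP. Qed.

Lemma qprojM x y : qproj (x * y) = qproj x * qproj y.
Proof. by rewrite /qproj rprojM; apply: aprojM. Qed.

Lemma qproj1 : qproj 1 = 1.
Proof. by []. Qed.

Lemma qproj0 : qproj 0 = 0.
Proof. by have := qprojP (-1) 0 0; rewrite !scaler0 addr0 scaleN1r addNr. Qed.

Lemma qprojB x y : qproj (x - y) = qproj x - qproj y.
Proof. by rewrite -scaleN1r addrC qprojP scaleN1r addrC. Qed.

Lemma qprojD x y : qproj (x + y) = qproj x + qproj y.
Proof. by rewrite -[x in LHS]scale1r qprojP scale1r. Qed.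

Lemma qproj_rel x y : wreath_rel (x - y) -> qproj x = qproj y.
Proof. by rewrite /qproj /rproj => /relE/aproj_eq ->. Qed.

Lemma qproj_surj z : exists x, z = qproj x.
Proof.
by have [y ->] := aproj_surj z; have [x ->] := aproj_surj y; exists x.
Qed.

Lemma cyclotomic_eltE : cyclotomic_elt = rproj (\prod_(j < d) (x_ i0 - f_ (c j))).
Proof.
rewrite (big_morph rproj (id1 := 1) (op1 := *%R)) //; last exact: rprojM.
apply: eq_bigr => j _.
by rewrite -scaleN1r addrC (addrC (x_ i0)) -(scaleN1r (f_ _)) rprojP.
Qed.

Lemma cyc_prod0 : \prod_(j < d) (qproj (x_ i0) - qproj (f_ (c j))) = 0.
Proof.
transitivity (qproj (\prod_(j < d) (x_ i0 - f_ (c j)))).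
  rewrite (big_morph qproj (id1 := 1) (op1 := *%R)) //; last exact: qprojM.
  by apply: eq_bigr => j _; rewrite qprojB.
rewrite /qproj -cyclotomic_eltE -[RHS](_ : aproj cyc_rel 0 = 0) //.
  by apply: aproj_eq; rewrite subr0.
exact: linear0.
Qed.

Lemma qproj_gen_ind (P : cyc_quot -> Prop) : P 0 ->
  (forall a x y, P x -> P y -> P (a *: x + y)) -> P 1 ->
  (forall i y, P y -> P (qproj (x_ i) * y)) ->
  (forall f y, P y -> P (qproj (f_ f) * y)) ->
  (forall s y, P y -> P (qproj (s_ s) * y)) -> forall y, P y.
Proof.
move=> P0 PP P1 Px Pf Ps y; have [g ->] := qproj_surj y.
move: g; apply: A_ind => [|a u v Hu Hv||i u Hu].
- by rewrite qproj0.
- by rewrite qprojP; apply: PP.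
- by rewrite qproj1.
by rewrite qprojM; case: i => [[i|f]|s]; auto.
Qed.

Lemma qproj_FP a f g : qproj (f_ (a *: f + g)) = a *: qproj (f_ f) + qproj (f_ g).
Proof.
rewrite (qproj_rel (wreath_FD _ _)) qprojD (qproj_rel (wreath_FZ _ _)).
by rewrite -[a *: f_ f]addr0 qprojP qproj0 addr0.
Qed.

Lemma qproj_FM f g : qproj (f_ (f * g)) = qproj (f_ f) * qproj (f_ g).
Proof. by rewrite (qproj_rel (wreath_FM _ _)) qprojM. Qed.

Lemma qproj_F1 : qproj (f_ 1) = 1.
Proof. by rewrite (qproj_rel wreath_F1) qproj1. Qed.

Lemma actf_u0 g : actf g 0 = 0.
Proof.
move: g; apply: A_ind => [|a x y Hx Hy||i y Hy].
- exact: actf0.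
- by rewrite actfP Hx Hy scaler0 addr0.
- exact: actf1.
by rewrite actfM Hy actf_gen linear0.
Qed.

(** The functional descends twice: the wreath relations act by zero on E, and the
    cyclotomic element acts by zero on bounded functions, to which the orbit of the
    cyclic vector belongs. *)
Lemma cyc_trace : (0 < d)%N -> exists tau : {scalar cyc_quot},
  forall g, tau (qproj g) = tau_free g.
Proof.
move=> d_gt0; have [tau1 tau1E] : exists tau : {scalar rel_quot},
    forall g, tau (rproj g) = tau_free g.
  apply: quotient_functional => [|a s b rs]; first exact: tau_free_scalar.
  rewrite /tau_free !actfM (wreath_rel_act _ (proj1 (relE _) rs)) /trE.
  by rewrite actf_u0 fun2_0 linear0.
have [tau2 tau2E] : exists tau : {scalar cyc_quot},
    forall y, tau (aproj cyc_rel y) = tau1 y.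
  apply: quotient_functional => [a x y|a s b ->]; first by rewrite linearP.
  have [a' ->] := aproj_surj a; have [b' ->] := aproj_surj b.
  rewrite cyclotomic_eltE -/(rproj a') -/(rproj b') -(rprojM a') -(rprojM _ b') tau1E.
  rewrite /tau_free !actfM.
  rewrite (_ : actf (\prod_(j < d) _) _ = 0) ?actf_u0 /trE ?fun2_0 ?linear0 //.
  exact/cyclotomic_actf/bounded_actf.
by exists tau2 => g; rewrite tau2E tau1E.
Qed.

Local Notation qx := (fun i => qproj (x_ i)).
Local Notation qf := (fun f => qproj (f_ f)).
Local Notation qs := (fun s => qproj (s_ s)).

Lemma monomial_homog m y : (0 < d)%N -> gen_monomial at_ Fdeg delta qx qf qs m y ->
  exists2 g, y = qproj g & homog m (actf g v0).
Proof.
move=> d_gt0; elim=> [|i {}m {}y _ [g -> Hg]|i f e {}m {}y fe _ [g -> Hg]|s {}m {}y _ [g -> Hg]].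
- exists 1; rewrite ?qproj1 // actf1; exact: homog_vtop.
- exists (x_ i * g); rewrite ?qprojM // actfM actf_gen /=.
  exact: homog_X.
- exists (f_ (at_ i f) * g); rewrite ?qprojM // actfM actf_gen /=.
  by apply: homog_F => //; apply: tdeg_at.
by exists (s_ s * g); rewrite ?qprojM // actfM actf_gen /=; apply: homog_S.
Qed.

(** For d = 0 the empty product 1 is a relation and the quotient is zero. *)
Lemma cyc_symmetric : symmetric_algebra (gen_deg at_ Fdeg delta qx qf qs).
Proof.
have [d0|d_gt0] := posnP d.
  have q0 (y z : cyc_quot) : y = z.
    have q10 : 1 = 0 :> cyc_quot.
      by rewrite -cyc_prod0 big1 // => j; have := ltn_ord j; rewrite {2}d0.
    by rewrite -[y]mul1r -[z]mul1r q10 !mul0r.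
  apply: (@gen_deg_symmetric k F T cyc_quot n at_ Fdeg delta qx qf qs qproj_FP
    qproj_FM qproj_F1 qproj_gen_ind T_span F_graded \0 0) => //.
  by move=> phi; exists 0 => g; rewrite (q0 g 0) linear0.
have [tau tauE] := cyc_trace d_gt0.
have tauC x y : tau (x * y) = tau (y * x).
  have [x' ->] := qproj_surj x; have [y' ->] := qproj_surj y.
  rewrite -(qprojM x' y') -(qprojM y' x') !tauE.
  exact: tau_freeC.
have XX i j : qx i * qx j = qx j * qx i by rewrite -!qprojM (qproj_rel (wreath_xx i j)).
have SM s p : qs (p * s)%g = qs s * qs p by rewrite -qprojM (qproj_rel (wreath_SM s p)).
have S1 : qs 1%g = 1 by rewrite (qproj_rel wreath_S1) qproj1.
have FX f i : qf f * qx i = qx i * qf f by rewrite -!qprojM (qproj_rel (wreath_Fx f i)).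
have SX_far (i i' j : 'I_n) : i' = i.+1 :> nat -> j != i -> j != i' ->
    qs (tperm i i') * qx j = qx j * qs (tperm i i').
  by move=> ii' ji ji'; rewrite -!qprojM (qproj_rel (wreath_sx_far ii' ji ji')).
have SX (i i' : 'I_n) : i' = i.+1 :> nat ->
    qs (tperm i i') * qx i = qx i' * qs (tperm i i') - qf (t i i').
  by move=> ii'; rewrite -!qprojM -qprojB (qproj_rel (wreath_sx ii')).
have SF s f : qs s * qf f = qf (act s f) * qs s.
  by rewrite -!qprojM (qproj_rel (wreath_SF s f)).
have gram f s xs q h : (size xs <= n * d.-1)%N ->
    tau (qf f * qs s * Xs qx xs * qs q * qf h) =
    if (wcount xs == wcst n d.-1) && (q * s == 1)%g then trT (f * h) else 0.
  move=> sz; rewrite -tau_free_gram // -tauE.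
  rewrite !qprojM; congr (tau (_ * _ * _ * _)).
  by rewrite (big_morph qproj (id1 := 1) (op1 := *%R)) //; apply: qprojM.
apply: (@gen_deg_symmetric k F T cyc_quot n at_ Fdeg delta qx qf qs qproj_FP
  qproj_FM qproj_F1 qproj_gen_ind T_span F_graded tau (n * d * delta)) => //.
- exact: (tau_nondeg XX qproj_FP qproj_FM qproj_F1 SM S1 FX SX_far SX SF
    qproj_gen_ind cyc_prod0 trC trT_nondeg gram).
- exact: (tau_repr XX qproj_FP qproj_FM qproj_F1 SM S1 FX SX_far SX SF
    qproj_gen_ind cyc_prod0 trT_repr gram).
move=> m y /(monomial_homog d_gt0) [g -> Hg] ne.
by rewrite tauE; apply: homog_trE Hg ne.
Qed.

End Presentation.

Local Notation I := ('I_n + T + 'S_n)%type.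
Local Notation A := (free_alg k I).
Local Notation x_ i := (free_gen k (inl (inl i)) : A).
Local Notation f_ f := (free_gen k (inl (inr f)) : A).
Local Notation s_ s := (free_gen k (inr s) : A).

Variable rel : A -> Prop.
Hypothesis relE : forall g, rel g <-> wreath_rel (@free_gen k I) g.
Local Notation qp := (@qproj A (@free_gen k I) rel).

Lemma presentation_symmetric : symmetric_algebra (gen_deg at_ Fdeg delta
  (fun i => qp (x_ i)) (fun f => qp (f_ f)) (fun s => qp (s_ s))).
Proof.
exact: (cyc_symmetric (@free_ind k I) (free_actP gen_op) (free_actM gen_op)
  (free_act1 gen_op) (free_act_gen gen_op) relE).
Qed.

End WreathModule.

(** * Degrees of dual bases *)

Section BaseAlgebra.
Variables (k : comNzRingType) (F : pzAlgType k) (Fdeg : nat -> F -> Prop).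
Variables (tr : {scalar F}) (delta : nat) (r : nat) (b bv : 'I_r -> F).
Hypothesis F_graded : graded_algebra Fdeg.
Hypothesis tr_sym : symmetric_trace Fdeg tr.
Hypothesis F_max : max_degree Fdeg delta.
Hypothesis b_basis : homogeneous_basis Fdeg b.
Hypothesis bv_dual : dual_basis tr b bv.

Lemma base_trC f g : tr (f * g) = tr (g * f).
Proof. by case: tr_sym => _; apply. Qed.

Lemma base_nondeg x : (forall g, tr (g * x) = 0) -> x = 0.
Proof.
move=> x0; have [[_ perf] _] := tr_sym.
have [y [_ uy]] := perf \0.
rewrite -(uy x) => [|g]; last by rewrite x0.
by apply: uy => g; rewrite mulr0 linear0.
Qed.

Lemma base_expand_b f : f = \sum_l tr (bv l * f) *: b l.
Proof.
have [_ /(_ f) [a [fE _]]] := b_basis; rewrite {1}fE.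
apply: eq_bigr => l _; congr (_ *: _).
rewrite fE mulr_sumr linear_sum (bigD1 l) //= -pzscalerAr linearZ /= bv_dual eqxx mulr1.
rewrite big1 ?addr0 // => l' ne; rewrite -pzscalerAr linearZ /= bv_dual eq_sym.
by rewrite (negbTE ne) mulr0.
Qed.

Lemma base_eq_on_basis x y : (forall l, tr (x * b l) = tr (y * b l)) -> x = y.
Proof.
move=> xy; apply/eqP; rewrite -subr_eq0; apply/eqP/base_nondeg => g.
rewrite base_trC (base_expand_b g) mulr_sumr linear_sum big1 // => l _ /=.
by rewrite -pzscalerAr linearZ /= mulrBl linearB /= xy subrr mulr0.
Qed.

Lemma base_expand_bv f : f = \sum_l tr (f * b l) *: bv l.
Proof.
apply: base_eq_on_basis => l; rewrite mulr_suml linear_sum (bigD1 l) //=.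
rewrite -pzscalerAl linearZ /= bv_dual eqxx mulr1 big1 ?addr0 // => l' ne.
by rewrite -pzscalerAl linearZ /= bv_dual (negbTE ne) mulr0.
Qed.

Lemma tr_neq0_comp x y : tr (x * y) != 0 ->
  exists m z, Fdeg m z /\ tr (z * y) != 0.
Proof.
have [N [c [cdeg ->]]] := gr_decomp F_graded x; rewrite mulr_suml linear_sum => ne.
apply: contrapT => no; move: ne; rewrite big1 ?eqxx // => m _ /=.
apply/eqP/negP => /negP ne; apply: no; exists m, (c m); split=> //.
Qed.

(** The trace lives in the top degree delta: an element f of degree delta pairs
    nontrivially with some homogeneous z, and z f has degree at most delta, so it is
    of degree delta, the degree of the trace. *)
Lemma base_tr_deg m x : Fdeg m x -> m != delta -> tr x = 0.
Proof.
have [[[e tr_e] _] _] := tr_sym; have [[f fdelta fn0] maxd] := F_max.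
suff -> : delta = e by apply: tr_e.
apply: contrapT => ne; case/eqP: fn0; apply: base_nondeg => g.
apply/eqP/negP => /negP /tr_neq0_comp [m' [z [zm ne0]]].
have me : (m' + delta)%N = e.
  apply/eqP; apply: contraNT ne0 => /(tr_e _ (z * f)) ->//.
  exact: gr_mul F_graded _ _ _ _ zm fdelta.
apply: ne; have zf0 : z * f != 0 by apply: contraNneq ne0 => ->; rewrite linear0.
by have := maxd _ _ (gr_mul F_graded zm fdelta) zf0; lia.
Qed.

(** The homogeneous component of bv_l of degree delta - |b_l| has the same pairings
    with the basis as bv_l, so it equals bv_l. *)
Lemma dual_basis_deg l : exists m p, [/\ Fdeg m (b l), Fdeg p (bv l) & (m + p)%N = delta].
Proof.
have one_ne0 := oner_neq0 k; have [/(_ l)[m mb] _] := b_basis.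
have deg_sum q p x y : Fdeg q x -> Fdeg p y -> tr (x * y) != 0 -> (q + p)%N = delta.
  move=> qx py ne0; apply/eqP; apply: contraNT ne0 => ne.
  by rewrite (base_tr_deg (gr_mul F_graded qx py) ne).
have [N [c [cdeg bvE]]] := gr_decomp F_graded (bv l).
have bvne : tr (bv l * b l) != 0 by rewrite bv_dual eqxx.
have [p ptr] : exists p : 'I_N, tr (c p * b l) != 0.
  apply: contrapT => no; move: bvne; rewrite bvE mulr_suml linear_sum big1 ?eqxx // => p _.
  by apply/eqP/negP => /negP ne; apply: no; exists p.
have pm := deg_sum _ _ _ _ (cdeg p) mb ptr.
exists m, p; split=> //; last by rewrite addnC.
suff -> : bv l = c p by [].
have other q y : Fdeg q y -> (p + q)%N = delta -> tr (bv l * y) = tr (c p * y).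
  move=> qy pq; rewrite {1}bvE mulr_suml linear_sum (bigD1 p) //= big1 ?addr0 // => p' ne.
  apply/eqP; apply: contraNT ne => /(deg_sum _ _ _ _ (cdeg p') qy) p'q.
  by apply/eqP/val_inj => /=; lia.
apply: base_eq_on_basis => l'; have [->|ne] := eqVneq l' l; first exact: other mb pm.
have [/(_ l')[q qb] _] := b_basis.
have [pq|pq] := eqVneq (p + q)%N delta; first exact: other qb pq.
rewrite bv_dual eq_sym (negbTE ne); apply/esym/eqP; apply: contraNT pq => ne0.
by rewrite (deg_sum _ _ _ _ (cdeg p) qb ne0).
Qed.

End BaseAlgebra.

(** * Degrees in the tensor power *)

Section TensorDegree.
Variables (k : comNzRingType) (F : pzAlgType k) (Fdeg : nat -> F -> Prop).
Variables (tr : {scalar F}) (delta n : nat).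
Hypothesis F_graded : graded_algebra Fdeg.
Hypothesis tr_deg : forall m x, Fdeg m x -> m != delta -> tr x = 0.
Local Notation T := (tens F n).
Local Notation tdeg := (@tens_deg k F n Fdeg).

Lemma tens_deg_one : tdeg 0 1.
Proof.
apply: lspan_gen; exists [ffun=> 1], (fun=> 0%N); split=> //.
  by move=> i; rewrite ffunE; apply: gr_one.
by rewrite big1.
Qed.

Lemma tens_deg_mul a b x y : tdeg a x -> tdeg b y -> tdeg (a + b) (x * y).
Proof.
move=> ax yb; move: x ax; apply: lspan_ind_lin => [|l x x' Hx Hx'|_ [u [e [ue <- ->]]]].
- by rewrite mul0r; apply: lspan0.
- by rewrite tensPl; exact: lspanD (lspanZ l Hx) Hx'.
move: y yb; apply: lspan_ind_lin => [|l y y' Hy Hy'|_ [v [e' [ve <- ->]]]].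
- by rewrite mulr0; apply: lspan0.
- by rewrite tensPr; exact: lspanD (lspanZ l Hy) Hy'.
rewrite pureM; apply: lspan_gen; exists (tuple_mul u v), (fun i => e i + e' i)%N.
split=> //; last by rewrite big_split.
by move=> i; rewrite ffunE; apply: gr_mul.
Qed.

Lemma tens_deg_perm a s x : tdeg a x -> tdeg a (tens_perm s x).
Proof.
move: x; apply: lspan_ind_lin => [|l x x' Hx Hx'|_ [u [e [ue <- ->]]]].
- by rewrite tens_perm0; apply: lspan0.
- by rewrite tens_permP; exact: lspanD (lspanZ l Hx) Hx'.
rewrite tens_perm_pure; apply: lspan_gen; exists (tuple_perm s u), (fun i => e (s^-1 i)%g).
split=> //; first by move=> i; rewrite ffunE.
by rewrite [RHS](reindex_inj (@perm_inj _ (s^-1)%g)).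
Qed.

Lemma tens_deg_at a i f : Fdeg a f -> tdeg a (tens_at i f : T).
Proof.
move=> af; apply: lspan_gen.
exists (upd [ffun=> 1] i f), (fun j => if j == i then a else 0%N); split=> //.
  by move=> j; rewrite !ffunE; case: eqP => // _; apply: gr_one.
by rewrite -big_mkcond big_pred1_eq.
Qed.

Lemma tens_trace_deg a x : tdeg a x -> a != (n * delta)%N -> tens_trace tr x = 0.
Proof.
move=> ax ne; move: x ax; apply: lspan_ind_lin => [|l x x' Hx Hx'|_ [u [e [ue sume ->]]]].
- exact: tens_trace0.
- by rewrite tens_traceP Hx Hx' mulr0 addr0.
have [i ei] : exists i, e i != delta.
  apply: contrapT => no; case/eqP: ne; rewrite -sume (eq_bigr (fun=> delta)) => [|i _].
    by rewrite sum_nat_const card_ord.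
  by apply/eqP/negP => /negP ne; apply: no; exists i.
by rewrite tens_trace_pure (bigD1 i) //= (tr_deg (ue i)) // mul0r.
Qed.

Lemma tens_t_deg r (b bv : 'I_r -> F) (i j : 'I_n) :
  (forall l, exists m p, [/\ Fdeg m (b l), Fdeg p (bv l) & (m + p)%N = delta]) ->
  tdeg delta (tens_t b bv i j).
Proof.
move=> Hd; apply: lspan_sum => l _; have [m [p [mb pb <-]]] := Hd l.
by apply: tens_deg_mul; apply: tens_deg_at.
Qed.

End TensorDegree.

(** * The cyclotomic quotient *)

Section Degrees.
Variables (k : comNzRingType) (F : pzAlgType k) (r : nat) (b bv : 'I_r -> F).
Variables (n : nat) (Fdeg : nat -> F -> Prop) (delta : nat) (n_gt0 : (0 < n)%N).
Variables (d : nat) (c : nat -> tens F n).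

Local Notation c_ := (fun j : 'I_d => c j).
Local Notation at_ := (fun i => @tens_at k F n i : {linear F -> tens F n}).
Local Notation Q := (cyclotomic_wreath b bv n_gt0 c_).
Local Notation q := (aproj (fun y0 => y0 = cyclotomic_gen b bv n_gt0 c_) : _ -> Q).
Local Notation Qdeg := (@gen_deg k F (tens F n) Q n at_ Fdeg delta
  (fun i => q (aff_x b bv i)) (fun f => q (aff_F b bv f)) (fun s => q (aff_S b bv s))).

(** The degree of the quotient is defined as the image of the degree of the affine
    algebra; the image of a spanning set of monomials spans, so the degree may as
    well be defined by monomials in the quotient. *)
Lemma cyclotomic_degE m z :
  cyclotomic_deg Fdeg delta (n_gt0 := n_gt0) (c := c_) m z <-> Qdeg m z.
Proof.
split=> [[y my ->]|].
  move: y my; apply: lspan_ind_lin => [|a x y Hx Hy|y my].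
  - by rewrite linear0; apply: lspan0.
  - by rewrite aprojP; exact: lspanD (lspanZ a Hx) Hy.
  apply: lspan_gen; elim: my => [|i m' y' _ IH|i f e m' y' fe _ IH|s m' y' _ IH].
  - exact: gen_mon1.
  - by rewrite aprojM; apply: gen_monx IH.
  - by rewrite aprojM; apply: (gen_monF (at_ := at_)) IH.
  - by rewrite aprojM; apply: gen_monS IH.
move: z; apply: lspan_ind_lin => [|a x y [x' Hx ->] [y' Hy ->]|z mz].
- by exists 0; [apply: lspan0 | rewrite linear0].
- exists (a *: x' + y'); last by rewrite aprojP.
  exact: lspanD (lspanZ a Hx) Hy.
suff [y my ->] : exists2 y, aff_monomial Fdeg delta m y & z = q y.
  by exists y => //; apply: lspan_gen.
elim: mz => [|i m' y _ [y' my ->]|i f e m' y fe _ [y' my ->]|s m' y _ [y' my ->]].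
- by exists 1 => //; apply: aff_mon1.
- by exists (aff_x b bv i * y'); [apply: aff_monx | rewrite aprojM].
- by exists (aff_F b bv (tens_at i f) * y'); [apply: aff_monF | rewrite aprojM].
by exists (aff_S b bv s * y'); [apply: aff_monS | rewrite aprojM].
Qed.

Local Notation I := ('I_n + tens F n + 'S_n)%type.
Local Notation Q' := (@cyc_quot k (tens F n) n c d (Ordinal n_gt0) (free_alg k I)
  (@free_gen k I) (@aff_rel k F r b bv n)).
Local Notation q' := (@qproj k (tens F n) n c d (Ordinal n_gt0) (free_alg k I)
  (@free_gen k I) (@aff_rel k F r b bv n)).

Lemma cyclotomic_deg_gen : @cyclotomic_deg k F r b bv n Fdeg delta n_gt0 d c_ =
  @gen_deg k F (tens F n) Q' n at_ Fdeg delta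
    (fun i => q' (free_gen k (inl (inl i)))) (fun f => q' (free_gen k (inl (inr f))))
    (fun s => q' (free_gen k (inr s))).
Proof.
apply: (@etrans _ _ (Qdeg : nat -> Q -> Prop)); last by [].
by apply/funext => m; apply/funext => z; apply/propext/cyclotomic_degE.
Qed.

Lemma cyclotomic_symmetric :
  symmetric_algebra (@gen_deg k F (tens F n) Q' n at_ Fdeg delta
    (fun i => q' (free_gen k (inl (inl i)))) (fun f => q' (free_gen k (inl (inr f))))
    (fun s => q' (free_gen k (inr s)))) ->
  symmetric_algebra (@cyclotomic_deg k F r b bv n Fdeg delta n_gt0 d c_).
Proof. move=> H; rewrite cyclotomic_deg_gen. exact H. Qed.

End Degrees.

Local Notation tat F n := (fun i => @tens_at _ F n i : {linear F -> tens F n}).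

Lemma aff_relE (k : comNzRingType) (F : pzAlgType k) r (b bv : 'I_r -> F) n
    (g : aff_free F n) : aff_rel b bv g <->
  wreath_rel (@tens_perm k F n) (fun i j => casimir (tat F n) b bv i j)
    (@free_gen k ('I_n + tens F n + 'S_n)%type) g.
Proof.
split; case.
- by move=> *; apply: wreath_xx.
- by move=> *; apply: wreath_FD.
- by move=> *; apply: wreath_FZ.
- by move=> f g'; exact (wreath_FM _ _ _ f g').
- exact (wreath_F1 _ _ _).
- by move=> *; apply: wreath_SM.
- by apply: wreath_S1.
- by move=> *; apply: wreath_Fx.
- by move=> *; apply: wreath_sx_far.
- by move=> i i' ii'; exact (wreath_sx _ _ _ ii').
- by move=> *; apply: wreath_SF.
- by move=> *; apply: aff_xx.
- by move=> *; apply: aff_FD.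
- by move=> *; apply: aff_FZ.
- by move=> *; apply: aff_FM.
- by apply: aff_F1.
- by move=> *; apply: aff_SM.
- by apply: aff_S1.
- by move=> *; apply: aff_Fx.
- by move=> *; apply: aff_sx_far.
- by move=> *; apply: aff_sx.
- by move=> *; apply: aff_SF.
Qed.

Theorem corollary6p16 (k : comNzRingType) (F : pzAlgType k)
    (Fdeg : nat -> F -> Prop) (tr : {scalar F}) (delta : nat)
    (r : nat) (b bv : 'I_r -> F)
    (n : nat) (n_gt0 : (0 < n)%N) (d : nat) (c : 'I_d -> tens F n) :
  2%N \notin [pchar k] ->
  graded_algebra Fdeg ->
  symmetric_trace Fdeg tr ->
  max_degree Fdeg delta ->
  homogeneous_basis Fdeg b ->
  dual_basis tr b bv ->
  (forall j : 'I_d, central_tens (c j)) ->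
  (forall (j : 'I_d) (s : 'S_n), tens_perm s (c j) = c j) ->
  (forall j : 'I_d, tens_deg Fdeg delta (c j)) ->
  symmetric_algebra (@cyclotomic_deg k F r b bv n Fdeg delta n_gt0 d c).
Proof.
move=> _ F_graded tr_sym F_max b_basis bv_dual c_central c_inv c_deg.
(* Colours range over all natural numbers, so the parameters are extended by 0. *)
have [c' [cE c'C c'_inv c'_deg]] : exists c' : nat -> tens F n,
    [/\ c = (fun j : 'I_d => c' j), forall a x, x * c' a = c' a * x,
        forall s a, tens_perm s (c' a) = c' a & forall a, tens_deg Fdeg delta (c' a)].
  exists (fun a => if insub a is Some j then c j else 0); split.
  - by apply/funext => j; rewrite valK.
  - by move=> a x; case: insub => [j|]; [apply: central_tensC | rewrite mulr0 mul0r].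
  - by move=> s a; case: insub => [j|]; [apply: c_inv | apply: tens_perm0].
  by move=> a; case: insub => [j|]; [apply: c_deg | apply: lspan0].
rewrite {}cE in c_central c_inv c_deg *.
have trC := base_trC tr_sym.
have exp_b := base_expand_b b_basis bv_dual.
have exp_bv := base_expand_bv tr_sym b_basis bv_dual.
have trFdeg := base_tr_deg F_graded tr_sym F_max.
have bdeg := dual_basis_deg F_graded tr_sym F_max b_basis bv_dual.
have span := @tens_prod_span k F n.
have atM i f g : tat F n i (f * g) = tat F n i f * tat F n i g by exact: tens_atM.
have atC i j f g : i != j -> tat F n i f * tat F n j g = tat F n j g * tat F n i f.
  exact: tens_atC.
pose trT : {scalar tens F n} := @tens_trace k F tr n.
have trprod (u : {ffun 'I_n -> F}) :
    trT (\prod_(i < n) tat F n i (u i)) = \prod_(i < n) tr (u i).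
  by rewrite -(@pure_prod k F n u) [LHS]tens_trace_pure.
have perm_at s i f : tens_perm s (tat F n i f) = tat F n (s i) f by exact: tens_perm_at.
have t_act := perm_casimir perm_at (@tens_permM k F n) (@tens_permP k F n) b bv.
have tC i j : i != j -> casimir (tat F n) b bv i j = casimir (tat F n) b bv j i.
  by move=> ij; exact: (casimirC atC trC exp_b).
have t_comm i j x : i != j ->
    casimir (tat F n) b bv i j * x = tens_perm (tperm i j) x * casimir (tat F n) b bv i j.
  exact: (casimir_comm atM atC perm_at (@tens_permM k F n) (@tens_perm_one k F n)
    (@tens_permP k F n) span trC exp_b exp_bv).
have nondeg := tens_trace_nondeg (trT := trT) atM atC span trprod exp_b.
have repr (phi : tens F n -> k) : scalar phi ->
    exists h, forall f, phi f = trT (f * h).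
  move=> lphi; pose phi' : {scalar tens F n} := HB.pack_for {scalar tens F n} phi
    (GRing.isLinear.Build k (tens F n) k *%R phi lphi).
  exact: (tens_trace_repr (trT := trT) atM atC span trprod exp_bv phi').
have H := presentation_symmetric (@tens_permM k F n) (@tens_perm_comp k F n)
  (@tens_permP k F n) (@tens_perm_one k F n) t_act tC t_comm c'C c'_inv (@tens_perm1 k F n)
  (trT := trT) (@tens_traceC k F tr n trC) (@tens_trace_perm k F tr n) d
  (tens_deg_one n F_graded) (@tens_deg_mul k F Fdeg n F_graded)
  (@tens_deg_perm k F Fdeg n)
  (fun i j _ => tens_t_deg F_graded i j bdeg) c'_deg
  (@tens_trace_deg k F Fdeg tr delta n trFdeg) (i0 := Ordinal n_gt0) (erefl _) nondeg repr
  F_graded span (@tens_deg_at k F Fdeg n F_graded) (aff_relE b bv (n := n)).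
apply: cyclotomic_symmetric; exact H.
Qed.
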